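(* There is an algorithm which, given a field $\mathbb{F}$, a symmetric matrix $M=(m_{ij})$ of order $n$ with entries in $\mathbb{F}$ (given by its nonzero entries), and a tree decomposition $\mathcal{T}$ of width $k$ of the underlying graph of $M$, outputs the diagonal entries of a diagonal matrix $D$ that is congruent to $M$, and runs in time $O(k|\mathcal{T}| + k^2 n)$, where $|\mathcal{T}|$ denotes the number of nodes of $\mathcal{T}$ (each arithmetic operation in $\mathbb{F}$ counting as one step).
   Context: Two square matrices $M,N$ over $\mathbb{F}$ are congruent if $N=PMP^T$ for some non-singular matrix $P$ over $\mathbb{F}$. The underlying graph of a symmetric matrix $M=(m_{ij})$ of order $n$ is the graph $G$ with vertex set $[n]=\{1,\ldots,n\}$ in which distinct vertices $i,j$ are adjacent if and only if $m_{ij}\neq 0$. A tree decomposition of a graph $G=(V,E)$ is a tree $\mathcal{T}$ whose nodes $i$ are each associated with a bag $B_i\subseteq V$ such that: (1) every vertex of $V$ lies in some bag; (2) for every edge $\{v,w\}\in E$ some bag contains both $v$ and $w$; (3) for every $v\in V$ the nodes whose bags contain $v$ induce a connected subtree of $\mathcal{T}$. Its width is $\max_i(|B_i|-1)$.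
   Formalization: In characteristic 2 the output is claimed correct only if M is congruent to some diagonal matrix (over F_2, [[0,1],[1,0]] is not); the time bound holds always. In the bound k is replaced by max(1,k), since for width 0 the literal bound O(0) is impossible. *)

(* Defs.v *)
From mathcomp Require Import all_boot all_order all_algebra.

Set Implicit Arguments.
Unset Strict Implicit.
Unset Printing Implicit Defensive.

Import GRing.Theory.
Local Open Scope ring_scope.

(* In characteristic 2 a symmetric matrix need not be congruent to a diagonal
   one: the 2 x 2 exchange matrix is alternating, and so are all matrices
   congruent to it. *)
Definition congruent (F : fieldType) n (M N : 'M[F]_n) : Prop :=
  exists2 P : 'M[F]_n, P \in unitmx & N = P *m M *m P^T.

Definition underlying_graph (F : fieldType) n (M : 'M[F]_n) : rel 'I_n :=
  fun i j => (i != j) && (M i j != 0).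

(* Cycles of length 2 in the sense of [ucycle] traverse one edge back and
   forth, so they are allowed. *)
Record is_tree (T : finType) (e : rel T) : Prop := IsTree {
  tree_sym : symmetric e;
  tree_irrefl : irreflexive e;
  tree_nonempty : (0 < #|T|)%N;
  tree_connected : forall x y, connect e x y;
  tree_acyclic : forall c, ucycle e c -> (size c <= 2)%N }.

Record tree_decomposition (V T : finType) (g : rel V) (e : rel T)
    (B : T -> {set V}) : Prop := TreeDecomposition {
  td_tree : is_tree e;
  td_vertex : forall v, exists x, v \in B x;
  td_edge : forall v w, g v w -> exists x, (v \in B x) && (w \in B x);
  td_connected : forall v x y, v \in B x -> v \in B y ->
    connect [rel a b | [&& e a b, v \in B a & v \in B b]] x y }.

(* Truncated predecessor: an empty bag counts as 0 instead of -1, which only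
   matters for the graph without vertices. *)
Definition width (V T : finType) (B : T -> {set V}) : nat :=
  \max_(x : T) #|B x|.-1.

(* Model of computation: structured programs for a random access machine with
   integer registers and arrays (natural numbers) and field registers and
   arrays.  There is no integer multiplication, as usual for the uniform cost
   criterion.  The syntax does not mention the field, so a program is uniform
   in it: a field is used only through its operations and the test x == 0. *)

Inductive nexp : Type :=
| NConst of nat
| NVar of nat                    (* integer register *)
| NGet of nat & nexp             (* NGet a i is entry i of integer array a *)
| NAdd of nexp & nexp
| NSub of nexp & nexp.           (* truncated subtraction *)

Inductive fexp : Type :=
| FZero
| FOne
| FVar of nat                    (* field register *)
| FGet of nat & nexp             (* FGet a i is entry i of field array a *)
| FAdd of fexp & fexp
| FSub of fexp & fexp
| FMul of fexp & fexp
| FDiv of fexp & fexp.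

Inductive bexp : Type :=
| BLt of nexp & nexp
| BEq of nexp & nexp
| BFZero of fexp
| BNot of bexp
| BAnd of bexp & bexp.

Inductive cmd : Type :=
| Skip
| NSet of nat & nexp
| NPut of nat & nexp & nexp      (* NPut a i v stores v in entry i of a *)
| FSet of nat & fexp
| FPut of nat & nexp & fexp
| Seq of cmd & cmd
| If of bexp & cmd & cmd
| While of bexp & cmd.

Record state (F : fieldType) : Type := State {
  nvar : nat -> nat;
  narr : nat -> nat -> nat;
  fvar : nat -> F;
  farr : nat -> nat -> F }.

Definition upd (A : Type) (f : nat -> A) (i : nat) (v : A) : nat -> A :=
  fun j => if j == i then v else f j.

Section Semantics.

Variable F : fieldType.
Implicit Types (s : state F) (e : nexp) (f : fexp) (b : bexp).

Fixpoint neval s e : nat :=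
  match e with
  | NConst c => c
  | NVar x => nvar s x
  | NGet a i => narr s a (neval s i)
  | NAdd e1 e2 => neval s e1 + neval s e2
  | NSub e1 e2 => neval s e1 - neval s e2
  end%N.

Fixpoint feval s f : F :=
  match f with
  | FZero => 0
  | FOne => 1
  | FVar x => fvar s x
  | FGet a i => farr s a (neval s i)
  | FAdd f1 f2 => feval s f1 + feval s f2
  | FSub f1 f2 => feval s f1 - feval s f2
  | FMul f1 f2 => feval s f1 * feval s f2
  | FDiv f1 f2 => feval s f1 / feval s f2
  end.

Fixpoint beval s b : bool :=
  match b with
  | BLt e1 e2 => (neval s e1 < neval s e2)%N
  | BEq e1 e2 => neval s e1 == neval s e2
  | BFZero f => feval s f == 0
  | BNot b1 => ~~ beval s b1
  | BAnd b1 b2 => beval s b1 && beval s b2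
  end.

(* Every constant, register or array access, arithmetic operation, comparison
   and connective costs one step; so does every store. *)
Fixpoint ncost e : nat :=
  match e with
  | NConst _ | NVar _ => 1
  | NGet _ i => (ncost i).+1
  | NAdd e1 e2 | NSub e1 e2 => (ncost e1 + ncost e2).+1
  end.

Fixpoint fcost f : nat :=
  match f with
  | FZero | FOne | FVar _ => 1
  | FGet _ i => (ncost i).+1
  | FAdd f1 f2 | FSub f1 f2 | FMul f1 f2 | FDiv f1 f2 =>
      (fcost f1 + fcost f2).+1
  end.

Fixpoint bcost b : nat :=
  match b with
  | BLt e1 e2 | BEq e1 e2 => (ncost e1 + ncost e2).+1
  | BFZero f => (fcost f).+1
  | BNot b1 => (bcost b1).+1
  | BAnd b1 b2 => (bcost b1 + bcost b2).+1
  end.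

Definition set_nvar s x v := State (upd (nvar s) x v) (narr s) (fvar s) (farr s).
Definition set_narr s a i v :=
  State (nvar s) (upd (narr s) a (upd (narr s a) i v)) (fvar s) (farr s).
Definition set_fvar s x v := State (nvar s) (narr s) (upd (fvar s) x v) (farr s).
Definition set_farr s a i v :=
  State (nvar s) (narr s) (fvar s) (upd (farr s) a (upd (farr s a) i v)).

(* exec c s k s' : started in s, the program c halts in s' after k steps. *)
Inductive exec : cmd -> state F -> nat -> state F -> Prop :=
| ExecSkip s : exec Skip s 1 s
| ExecNSet s x e :
    exec (NSet x e) s (ncost e).+1 (set_nvar s x (neval s e))
| ExecNPut s a i e :
    exec (NPut a i e) s (ncost i + ncost e).+1
      (set_narr s a (neval s i) (neval s e))
| ExecFSet s x f :
    exec (FSet x f) s (fcost f).+1 (set_fvar s x (feval s f))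
| ExecFPut s a i f :
    exec (FPut a i f) s (ncost i + fcost f).+1
      (set_farr s a (neval s i) (feval s f))
| ExecSeq c1 c2 s1 s2 s3 k1 k2 :
    exec c1 s1 k1 s2 -> exec c2 s2 k2 s3 ->
    exec (Seq c1 c2) s1 (k1 + k2) s3
| ExecIf b c1 c2 s s' k :
    exec (if beval s b then c1 else c2) s k s' ->
    exec (If b c1 c2) s (bcost b + k) s'
| ExecWhileFalse b c s :
    ~~ beval s b -> exec (While b c) s (bcost b) s
| ExecWhileTrue b c s1 s2 s3 k1 k2 :
    beval s1 b -> exec c s1 k1 s2 -> exec (While b c) s2 k2 s3 ->
    exec (While b c) s1 (bcost b + k1 + k2) s3.

Lemma exec_det c s k1 s1 k2 s2 :
  exec c s k1 s1 -> exec c s k2 s2 -> k1 = k2 /\ s1 = s2.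
Proof.
move=> H; elim: H k2 s2 => {c s k1 s1};
  try by intros; match goal with H : exec _ _ _ _ |- _ => inversion H end.
- move=> c1 c2 s1 s2 s3 k1 k2 _ IH1 _ IH2 k s H.
  inversion H as [| | | | |? ? ? ? ? ? ? E1 E2| | |]; subst.
  by case: (IH1 _ _ E1) => -> ?; subst; case: (IH2 _ _ E2) => -> ->.
- move=> b c1 c2 s s' k _ IH k2 s2 H.
  inversion H as [| | | | | |? ? ? ? ? ? E| |]; subst.
  by case: (IH _ _ E) => -> ->.
- move=> b c s /negP nb k2 s2 H.
  by inversion H.
- move=> b c s1 s2 s3 k1 k2 hb _ IH1 _ IH2 k s H.
  inversion H as [| | | | | | |? ? ? nb|? ? ? ? ? ? ? ? E1 E2]; subst.
    by rewrite hb in nb.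
  by case: (IH1 _ _ E1) => -> ?; subst; case: (IH2 _ _ E2) => -> ->.
Qed.

End Semantics.

(* The input lists may be in any order: nz lists the positions of the nonzero
   entries of M, bs x the vertices in the bag of the node x, and es the edges
   of the tree, each of them once and in either orientation. *)
Definition represents (F : fieldType) n t (M : 'M[F]_n) (e : rel 'I_t)
    (B : 'I_t -> {set 'I_n}) (nz : seq ('I_n * 'I_n))
    (bs : 'I_t -> seq 'I_n) (es : seq ('I_t * 'I_t)) : Prop :=
  [/\ perm_eq nz (enum [pred p : 'I_n * 'I_n | M p.1 p.2 != 0]),
      forall x, perm_eq (bs x) (enum (B x)) &
      perm_eq (es ++ [seq (p.2, p.1) | p <- es])
              (enum [pred p : 'I_t * 'I_t | e p.1 p.2])].

(* Registers 0, 1, 2 hold n, the number t of nodes and the number of nonzero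
   entries.  Integer arrays 0 and 1 and field array 0 hold the row, the column
   and the value of these entries.  Integer array 3 holds the concatenated bags;
   the bag of x starts there at the position in entry x of integer array 2 and
   ends before the one in entry x + 1.  Integer arrays 4 and 5 hold the end
   points of the tree edges.  Vertices and nodes are numbered from 0.  All
   other memory cells contain 0. *)
Definition input_state (F : fieldType) n t (M : 'M[F]_n)
    (nz : seq ('I_n * 'I_n)) (bs : 'I_t -> seq 'I_n)
    (es : seq ('I_t * 'I_t)) : state F :=
  let bags := [seq bs x | x <- enum 'I_t] in
  {| nvar := nth 0%N [:: n; t; size nz];
     narr := fun a => nth 0%N (nth [::] [::
       [seq val p.1 | p <- nz];
       [seq val p.2 | p <- nz];
       0%N :: scanl addn 0%N (map size bags);
       map val (flatten bags);
       [seq val p.1 | p <- es];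
       [seq val p.2 | p <- es]] a);
     fvar := fun=> 0;
     farr := fun a => nth 0 (nth [::] [:: [seq M p.1 p.2 | p <- nz]] a) |}.

(* The output is read off the first n entries of field array 1. *)
Definition output (F : fieldType) n (s : state F) : 'rV[F]_n :=
  \row_(i < n) farr s 1 i.

(* Main.v *)
Require Import Defs.
From mathcomp Require Import all_boot all_order all_algebra.
From mathcomp Require Import zify ring.

(* Root the tree and eliminate the vertices in the order in which their topmost
   bags are met bottom-up.  When u is eliminated, its neighbours lie in its topmost
   bag, so a nonzero pivot costs O(k^2).  If the diagonal entry of u is 0, its row is
   deferred: each node keeps the deferred rows of its subtree in echelon form with
   respect to the elimination order, so at most one of them, r, has a nonzero entry
   in column u when u is eliminated, and then r and u are eliminated together as a
   2 x 2 block.  Moving the deferred rows of a node to its parent costs O(k) per row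
   operation; each operation moves the leading column of a row past another pivot of
   its node, and the sum over the rows of k + 2 minus the number of pivots up to the
   leading column shows that there are O(k n) of them.  The 2 x 2 blocks that remain
   are hyperbolic planes; they split if 2 is invertible or next to a nonzero diagonal
   entry, and otherwise the matrix is alternating, hence 0 if it is diagonalizable.
   The matrix is kept in a dense array, since unused memory costs no time. *)

Set Implicit Arguments.
Unset Strict Implicit.
Unset Printing Implicit Defensive.

Import GRing.Theory.
Local Open Scope ring_scope.

(** * Programs with time credits *)

(** Why rows wait: pairing an isotropic vertex u at once with a neighbour w would also eliminate w,
    whose other neighbours may lie outside the bag, and the fill-in would leave the bags. So the row
    of u waits until the turn of w. Several waiting rows may then meet the same column, which is
    what the echelon form prevents; but no useful bound holds for the reductions done at a single
    node, so they are paid by amortization. With k+1 as the bound on the bags, a new deferred row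
    raises the potential by at most k+2. Eliminating a pair removes a pivot from a node that carries
    at most k+1 rows, and this raises the potential by at most k+1. Each reduction lowers it by at
    least 1. The value k+2 exceeds the number of pivots in a bag, so that a row which becomes zero
    also releases a unit. Since each vertex is eliminated once, the total rise is O(kn). To make
    such an argument a loop invariant, the remaining time is a budget that the program logic passes
    from command to command. *)

Fixpoint writes_nvar (c : cmd) (x : nat) : bool :=
  match c with
  | NSet y _ => x == y
  | Seq c1 c2 | If _ c1 c2 => writes_nvar c1 x || writes_nvar c2 x
  | While _ c1 => writes_nvar c1 x
  | _ => false
  end.

Fixpoint writes_narr (c : cmd) (x : nat) : bool :=
  match c with
  | NPut y _ _ => x == y
  | Seq c1 c2 | If _ c1 c2 => writes_narr c1 x || writes_narr c2 x
  | While _ c1 => writes_narr c1 x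
  | _ => false
  end.

Fixpoint writes_fvar (c : cmd) (x : nat) : bool :=
  match c with
  | FSet y _ => x == y
  | Seq c1 c2 | If _ c1 c2 => writes_fvar c1 x || writes_fvar c2 x
  | While _ c1 => writes_fvar c1 x
  | _ => false
  end.

Fixpoint writes_farr (c : cmd) (x : nat) : bool :=
  match c with
  | FPut y _ _ => x == y
  | Seq c1 c2 | If _ c1 c2 => writes_farr c1 x || writes_farr c2 x
  | While _ c1 => writes_farr c1 x
  | _ => false
  end.

Fixpoint loop_free (c : cmd) : bool :=
  match c with
  | Seq c1 c2 | If _ c1 c2 => loop_free c1 && loop_free c2
  | While _ _ => false
  | _ => true
  end.

(** The value 0 for a loop is a dummy: the bound is meant for programs satisfying [loop_free]. *)
Fixpoint max_cost (c : cmd) : nat :=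
  match c with
  | Skip => 1
  | NSet _ e => (ncost e).+1
  | NPut _ i e => (ncost i + ncost e).+1
  | FSet _ f => (fcost f).+1
  | FPut _ i f => (ncost i + fcost f).+1
  | Seq c1 c2 => max_cost c1 + max_cost c2
  | If b c1 c2 => bcost b + maxn (max_cost c1) (max_cost c2)
  | While _ _ => 0
  end%N.

Definition for_range (j e : nat) (body : cmd) : cmd :=
  While (BLt (NVar j) (NVar e))
    (Seq body (NSet j (NAdd (NVar j) (NConst 1)))).

Definition for_bag (x j e w : nat) (body : cmd) : cmd :=
  Seq (NSet j (NGet 2 (NVar x)))
  (Seq (NSet e (NGet 2 (NAdd (NVar x) (NConst 1))))
  (for_range j e (Seq (NSet w (NGet 3 (NVar j))) body))).

Section Logic.

Variable F : fieldType.
Local Open Scope nat_scope.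
Implicit Types (s : state F) (c : cmd).

(** The frame rule. Whether a program writes a cell is decided by computation on its syntax, so that
    the side conditions are closed by [//]. *)
Record same c s s' : Prop := Same {
  same_nvar : forall x, ~~ writes_nvar c x -> nvar s' x = nvar s x;
  same_narr : forall a, ~~ writes_narr c a -> narr s' a = narr s a;
  same_fvar : forall x, ~~ writes_fvar c x -> fvar s' x = fvar s x;
  same_farr : forall a, ~~ writes_farr c a -> farr s' a = farr s a }.

Lemma same_trans c s1 s2 s3 : same c s1 s2 -> same c s2 s3 -> same c s1 s3.
Proof.
case=> a1 b1 c1 d1 [a2 b2 c2 d2]; split=> x hx.
- by rewrite a2 ?a1.
- by rewrite b2 ?b1.
- by rewrite c2 ?c1.
- by rewrite d2 ?d1.
Qed.

Lemma same_sub c c' s s' :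
  (forall x, writes_nvar c x -> writes_nvar c' x) ->
  (forall x, writes_narr c x -> writes_narr c' x) ->
  (forall x, writes_fvar c x -> writes_fvar c' x) ->
  (forall x, writes_farr c x -> writes_farr c' x) ->
  same c s s' -> same c' s s'.
Proof.
move=> h1 h2 h3 h4 [a1 b1 c1 d1]; split=> x hx.
- by apply: a1; apply: contra hx => /h1.
- by apply: b1; apply: contra hx => /h2.
- by apply: c1; apply: contra hx => /h3.
- by apply: d1; apply: contra hx => /h4.
Qed.

Lemma exec_same c s k s' : exec c s k s' -> same c s s'.
Proof.
elim=> {c s k s'} //=.
- by move=> s x e; split=> //= y; rewrite /upd; case: (y == x).
- by move=> s a i e; split=> //= y; rewrite /upd; case: (y == a).
- by move=> s x f; split=> //= y; rewrite /upd; case: (y == x).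
- by move=> s a i f; split=> //= y; rewrite /upd; case: (y == a).
- move=> c1 c2 s1 s2 s3 k1 k2 _ h1 _ h2; apply: same_trans.
    by apply: same_sub h1 => x /= ->.
  by apply: same_sub h2 => x /= ->; rewrite orbT.
- move=> b c1 c2 s s' k _; case: (beval s b) => h; apply: same_sub h => x /= ->;
  by rewrite ?orbT.
- move=> b c s1 s2 s3 k1 k2 _ _ h1 _ h2; apply: same_trans h2.
  exact: same_sub h1.
Qed.

(* [Q] receives the number of steps that remain of the budget [m]. *)
Definition wp c (Q : nat -> state F -> Prop) m s : Prop :=
  exists k s' m', [/\ exec c s k s', k + m' <= m & Q m' s'].

Fixpoint run c s : state F :=
  match c with
  | Skip | While _ _ => s
  | NSet x e => set_nvar s x (neval s e)
  | NPut a i e => set_narr s a (neval s i) (neval s e)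
  | FSet x f => set_fvar s x (feval s f)
  | FPut a i f => set_farr s a (neval s i) (feval s f)
  | Seq c1 c2 => run c2 (run c1 s)
  | If b c1 c2 => if beval s b then run c1 s else run c2 s
  end.

Lemma exec_run c s : loop_free c ->
  exists2 k, exec c s k (run c s) & k <= max_cost c.
Proof.
elim: c s => [|x e|a i e|x f|a i f|c1 IH1 c2 IH2|b c1 IH1 c2 IH2|b c IH] s //=.
- by exists 1 => //; constructor.
- by move=> _; eexists; [constructor|].
- by move=> _; eexists; [constructor|].
- by move=> _; eexists; [constructor|].
- by move=> _; eexists; [constructor|].
- case/andP => /IH1 h1 /IH2 h2; have [k1 e1 l1] := h1 s.
  have [k2 e2 l2] := h2 (run c1 s); exists (k1 + k2); last exact: leq_add.
  by econstructor; eauto.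
- case/andP => /IH1 h1 /IH2 h2.
  have [k ek lk] : exists2 k, exec (if beval s b then c1 else c2) s k
     (if beval s b then run c1 s else run c2 s)
     & k <= maxn (max_cost c1) (max_cost c2).
    case: (beval s b); [have [k ek lk] := h1 s|have [k ek lk] := h2 s];
    by exists k => //; rewrite leq_max lk ?orbT.
  exists (bcost b + k); last by rewrite leq_add2l.
  by constructor.
Qed.

Lemma wp_run c (Q : nat -> state F -> Prop) m s m' :
  loop_free c -> max_cost c + m' <= m -> Q m' (run c s) -> wp c Q m s.
Proof.
move=> hl hm hQ; have [k ek lk] := exec_run s hl.
by exists k, (run c s), m'; split=> //; lia.
Qed.

(** The frame rule for time: d steps of the budget are set aside and handed back afterwards. *)
Lemma wp_conseq c (Q Q' : nat -> state F -> Prop) m s d :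
  wp c Q m s -> (forall m' s', same c s s' -> Q m' s' -> Q' (m' + d) s') ->
  wp c Q' (m + d) s.
Proof.
move=> [k [s' [m' [ek lk hQ]]]] h; exists k, s', (m' + d); split=> //; first lia.
by apply: h => //; apply: exec_same ek.
Qed.

Lemma wp_mono c (Q Q' : nat -> state F -> Prop) m1 m s :
  wp c Q m1 s -> m1 <= m ->
  (forall m' s', same c s s' -> Q m' s' -> Q' m' s') -> wp c Q' m s.
Proof.
move=> [k [s' [m' [ek lk hQ]]]] hm h; exists k, s', m'; split=> //; first lia.
by apply: h => //; apply: exec_same ek.
Qed.

Lemma wp_bounded c (P : state F -> Prop) (Q : nat -> state F -> Prop) b m m' s :
  wp c (fun _ => P) b s -> b + m' <= m ->
  (forall s', same c s s' -> P s' -> Q m' s') -> wp c Q m s.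
Proof.
move=> [k [s' [m1 [ek lk hP]]]] hm h; exists k, s', m'; split=> //; first lia.
by apply: h => //; apply: exec_same ek.
Qed.

Lemma wp_seq c1 c2 Q m s :
  wp c1 (fun m' s' => wp c2 Q m' s') m s -> wp (Seq c1 c2) Q m s.
Proof.
move=> [k1 [s1 [m1 [e1 l1 [k2 [s2 [m2 [e2 l2 hQ]]]]]]]].
exists (k1 + k2), s2, m2; split=> //; last lia.
by econstructor; eauto.
Qed.

Lemma wp_if b c1 c2 Q m s m' :
  bcost b + m' <= m -> (beval s b -> wp c1 Q m' s) ->
  (~~ beval s b -> wp c2 Q m' s) -> wp (If b c1 c2) Q m s.
Proof.
move=> hm h1 h2.
have [k [s' [m1 [ek lk hQ]]]] : wp (if beval s b then c1 else c2) Q m' s.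
  by case: ifP => [/h1//|/negbT/h2].
by exists (bcost b + k), s', m1; split=> //; [constructor|lia].
Qed.

(** The budget doubles as the variant: every iteration pays at least one step for the test, so
    induction on the budget gives termination. *)
Lemma wp_while b c (I Q : nat -> state F -> Prop) m0 s0 :
  I m0 s0 ->
  (forall m s, same (While b c) s0 s -> I m s -> beval s b ->
     exists2 m1, bcost b + m1 <= m & wp c I m1 s) ->
  (forall m s, same (While b c) s0 s -> I m s -> ~~ beval s b ->
     exists2 m1, bcost b + m1 <= m & Q m1 s) ->
  wp (While b c) Q m0 s0.
Proof.
move=> I0 hT hF; have hb : 0 < bcost b by case: (b).
suff H : forall N m s, m <= N -> same (While b c) s0 s -> I m s -> wp (While b c) Q m s.
  exact: (H m0).
elim=> [|N IH] m s hm hs hI.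
  case: (boolP (beval s b)) => [/(hT _ _ hs hI) [m1 h]|/(hF _ _ hs hI) [m1 h]]; lia.
case: (boolP (beval s b)) => hbs; last first.
  have [m1 h hQ] := hF _ _ hs hI hbs.
  by exists (bcost b), s, m1; split=> //; constructor.
have [m1 h1 [k1 [s1 [m2 [e1 l1 hI1]]]]] := hT _ _ hs hI hbs.
have [|||k2 [s2 [m3 [e2 l2 hQ]]]] := IH m2 s1; rewrite ?(leq_trans l1)//; first lia.
  by apply: same_trans hs _; apply: same_sub (exec_same e1).
exists (bcost b + k1 + k2), s2, m3; split=> //; last lia.
by econstructor; eauto.
Qed.

(** The 7 steps of an iteration are 3 for the test and 4 for the increment; the final 3 are the
    failing test. *)
Lemma wp_for_range j e body (I : nat -> nat -> state F -> Prop) Q m0 s0 a b :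
  ~~ writes_nvar body j -> ~~ writes_nvar body e -> e != j ->
  nvar s0 j = a -> nvar s0 e = b -> a <= b -> I a m0 s0 ->
  (forall i m s, same (for_range j e body) s0 s -> a <= i < b ->
     nvar s j = i -> I i m s ->
     exists2 m1, m1 + 7 <= m &
     wp body (fun m' s' => I i.+1 m' (set_nvar s' j i.+1)) m1 s) ->
  (forall m s, same (for_range j e body) s0 s -> I b m s ->
     exists2 m', m' + 3 <= m & Q m' s) ->
  wp (for_range j e body) Q m0 s0.
Proof.
move=> wj we nej ja eb leab I0 hB hQ.
apply: (@wp_while _ _
  (fun m s => exists i, [/\ a <= i <= b, nvar s j = i, nvar s e = b & I i m s])).
- by exists a; rewrite leqnn leab.
- move=> m s sm [i [/andP[lai lib] hj he hI]] /=; rewrite hj he => ltib.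
  have [|m1 h1 hw] := hB i m s sm _ hj hI; first by rewrite lai.
  exists (m1 + 4); first lia.
  apply: wp_seq; apply: (wp_conseq hw) => m' s' sm' hI'.
  apply: (@wp_run _ _ _ _ m') => //=; first lia.
  rewrite (same_nvar sm' wj) hj addn1; exists i.+1; split=> //=.
  - lia.
  - by rewrite /upd eqxx.
  - by rewrite /upd (negPf nej) (same_nvar sm' we).
- move=> m s sm [i [/andP[lai lib] hj he hI]] /=; rewrite hj he -leqNgt => lebi.
  have eib : i = b by lia.
  rewrite eib in hI; have [m' h hQ'] := hQ _ _ sm hI.
  by exists m' => //; lia.
Qed.

Lemma wp_for_bounded j e body (I : nat -> state F -> Prop) d
    (Q : nat -> state F -> Prop) m m' s0 b :
  ~~ writes_nvar body j -> ~~ writes_nvar body e -> e != j ->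
  nvar s0 j = 0 -> nvar s0 e = b -> I 0 s0 ->
  (forall i s, same (for_range j e body) s0 s -> i < b ->
     nvar s j = i -> I i s ->
     wp body (fun _ s' => I i.+1 (set_nvar s' j i.+1)) d s) ->
  (d + 7) * b + 3 + m' <= m ->
  (forall s, same (for_range j e body) s0 s -> I b s -> Q m' s) ->
  wp (for_range j e body) Q m s0.
Proof.
move=> wj we nej ja eb I0 hB hm hQ.
apply: (@wp_for_range _ _ _
  (fun i m1 s => I i s /\ (d + 7) * (b - i) + 3 + m' <= m1) _ _ _ _ _
  wj we nej ja eb); rewrite ?subn0 //.
- move=> i m1 s sm /andP[_ ltib] hj [hI hm1].
  have e1 : b - i = (b - i.+1).+1 by lia.
  rewrite e1 mulnS in hm1; exists (d + ((d + 7) * (b - i.+1) + 3 + m')); first lia.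
  apply: (wp_conseq (hB _ _ sm ltib hj hI)) => m2 s' _ h; split=> //; lia.
- move=> m1 s sm [hI]; rewrite subnn => h; exists m'; first lia.
  exact: hQ.
Qed.

(** An iteration costs 10 besides its body: 7 for the loop and 3 for loading the vertex into w. The
    8 steps that fetch the bounds of the bag are rounded up to 10. The invariant speaks of the
    visited prefix of the bag and must tolerate changes of the three loop registers. *)
Lemma wp_for_bag n x j e w body (I : seq 'I_n -> nat -> state F -> Prop) Q m0 s0
    X (l : seq 'I_n) :
  ~~ writes_nvar body j -> ~~ writes_nvar body e -> ~~ writes_narr body 3 ->
  e != j -> w != j -> w != e -> x != j ->
  nvar s0 x = X -> narr s0 2 X.+1 = narr s0 2 X + size l ->
  (forall i (h : i < size l),
     narr s0 3 (narr s0 2 X + i) = tnth (in_tuple l) (Ordinal h)) ->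
  (forall l1 m s y v, y \in [:: j; e; w] -> I l1 m s -> I l1 m (set_nvar s y v)) ->
  10 <= m0 -> I [::] (m0 - 10) s0 ->
  (forall l1 v l2 m s, l = l1 ++ v :: l2 -> same (for_bag x j e w body) s0 s ->
     nvar s w = v -> I l1 (m + 10) s -> wp body (I (rcons l1 v)) m s) ->
  (forall l1 m s, I l1 m s -> 10 <= m) ->
  (forall m s, same (for_bag x j e w body) s0 s -> I l m s ->
     exists2 m', m' + 3 <= m & Q m' s) ->
  wp (for_bag x j e w body) Q m0 s0.
Proof.
move=> wj we w3 nej nwj nwe nxj hX hX1 hl hst hm0 I0 hB hge hQ.
apply: wp_seq; apply: (@wp_run _ _ _ _ (m0 - 3)) => //=; first lia.
apply: wp_seq; apply: (@wp_run _ _ _ _ (m0 - 8)) => //=; first lia.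
set s1 := set_nvar _ e _.
have sm1 : same (for_bag x j e w body) s0 s1.
  by split=> //= y; rewrite /upd; case: (y == e); case: (y == j); rewrite ?orbT.
pose st := narr s0 2 X.
have E1 : nvar s1 j = st by rewrite /= /upd (eq_sym j) (negPf nej) eqxx /= hX.
have E2 : nvar s1 e = st + size l.
  by rewrite /= /upd eqxx /= (negPf nxj) hX addn1.
apply: (@wp_for_range _ _ _ (fun i m s => exists2 m', m' + 2 <= m &
   I (take (i - st) l) m' s) _ _ _ _ _ _ _ nej E1 E2).
- by rewrite /= eq_sym (negPf nwj).
- by rewrite /= eq_sym (negPf nwe).
- lia.
- exists (m0 - 10); first lia; rewrite subnn take0; apply: (hst _ _ _ e); rewrite ?inE ?eqxx ?orbT //.
  by apply: (hst _ _ _ j); rewrite ?inE ?eqxx.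
- move=> i m s sm /andP[ha hb] hj [m' hm hI].
  have sms : same (for_bag x j e w body) s0 s.
    apply: same_trans sm1 _; apply: same_sub sm => y //= ->; by rewrite !orbT.
  have hi : i - st < size l by lia.
  have hg := hge _ _ _ hI.
  exists (m - 7); first lia.
  apply: wp_seq; apply: (@wp_run _ _ _ _ (m - 10)) => //=; first lia.
  set v := tnth (in_tuple l) (Ordinal hi).
  have n3 : narr s 3 = narr s0 3.
    by apply: (same_narr sms); rewrite /= orbF w3.
  rewrite hj n3; have -> : narr s0 3 i = v by rewrite -(hl _ hi) subnKC.
  have Ev d : nth d l (i - st) = v by rewrite /v (tnth_nth d).
  have El : l = take (i - st) l ++ v :: drop (i - st).+1 l.
    rewrite -{1}(cat_take_drop (i - st) l) (drop_nth v) //; by rewrite Ev.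
  have hI1 : I (take (i - st) l) (m' - 10 + 10) (set_nvar s w v).
    by apply: (hst _ _ _ w); rewrite ?inE ?eqxx ?orbT // subnK.
  have sms' : same (for_bag x j e w body) s0 (set_nvar s w v).
    case: sms => a1 b1 c1 d1; split=> //= y hy; rewrite /upd.
    case: (y =P w) => [eyw|_]; last exact: a1.
    by move: hy; rewrite eyw eqxx !orbT.
  have hw : wp body (I (rcons (take (i - st) l) v)) (m' - 10) (set_nvar s w v).
    by apply: (hB _ _ _ _ _ El sms' _ hI1); rewrite /= /upd eqxx.
  have -> : m - 10 = m' - 10 + (m - 10 - (m' - 10)) by lia.
  apply: (wp_conseq hw).
  move=> m1 s' _ hI'; exists m1; first lia.
  have -> : i.+1 - st = (i - st).+1 by lia.
  rewrite (take_nth v) // Ev.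
  by apply: (hst _ _ _ j); rewrite ?inE ?eqxx.
- move=> m s sm [m' hm]; rewrite addKn take_size => hI.
  have [|m2 h2 h2'] := hQ m' s _ hI; last by exists m2 => //; lia.
  apply: same_trans sm1 _; apply: same_sub sm => y //= ->; by rewrite !orbT.
Qed.

End Logic.

(** * Congruences *)

Section Congruence.

Variables (F : fieldType) (n : nat).
Implicit Types (S M : 'M[F]_n) (r u i j : 'I_n).

Lemma congruent_refl M : congruent M M.
Proof. by exists 1%:M; rewrite ?unitmx1 // trmx1 mul1mx mulmx1. Qed.

Lemma congruent_trans M N S : congruent M N -> congruent N S -> congruent M S.
Proof.
move=> [P uP ->] [Q uQ ->]; exists (Q *m P); first by rewrite unitmx_mul uQ.
by rewrite trmx_mul !mulmxA.
Qed.

Lemma congruent_sym M N : congruent M N -> congruent N M.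
Proof.
move=> [P uP ->]; exists (invmx P); first by rewrite unitmx_inv.
rewrite !mulmxA mulVmx // mul1mx -mulmxA trmx_inv mulmxV ?mulmx1 //.
by rewrite unitmx_tr.
Qed.

(** Congruence by 1 + X, where X has a in column r and b in column u. As a and b vanish at r and u,
    X squares to 0 and 1 - X is the inverse. The case r = u is included and gives the eliminations
    with a single pivot. *)
Lemma congruent_add2 S S' r u (a b : 'I_n -> F) :
  a r = 0 -> a u = 0 -> b r = 0 -> b u = 0 ->
  (forall i j, S' i j = S i j + a i * S r j + b i * S u j + a j * S i r
     + b j * S i u + a i * a j * S r r + b i * b j * S u u
     + a i * b j * S r u + b i * a j * S u r) ->
  congruent S S'.
Proof.
move=> ar au br bu ES'.
pose X : 'M[F]_n := \matrix_(i, k) ((k == r)%:R * a i + (k == u)%:R * b i).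
have sumX (x y : F) (f : 'I_n -> F) :
    \sum_k ((k == r)%:R * x + (k == u)%:R * y) * f k = x * f r + y * f u.
  rewrite (eq_bigr (fun k => (if k == r then x * f r else 0)
                           + (if k == u then y * f u else 0))); last first.
    move=> k _; rewrite mulrDl.
    by congr (_ + _); case: eqP => [->|_]; rewrite ?mul1r ?mul0r.
  by rewrite big_split /= -!big_mkcond !big_pred1_eq.
have XX : X *m X = 0.
  apply/matrixP=> i j; rewrite !mxE.
  under eq_bigr do rewrite mxE.
  by rewrite sumX !mxE ar au br bu !(mulr0, addr0).
exists (1%:M + X).
  have : (1%:M + X) *m (1%:M - X) = 1%:M.
    by rewrite mulmxDl !mulmxBr !mul1mx mulmx1 XX subr0 subrK.
  by case/mulmx1_unit.
have XA (A : 'M[F]_n) i j : (X *m A) i j = a i * A r j + b i * A u j.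
  by rewrite !mxE; under eq_bigr do rewrite mxE; rewrite sumX.
have AX (A : 'M[F]_n) i j : (A *m X^T) i j = a j * A i r + b j * A i u.
  rewrite !mxE; under eq_bigr do rewrite !mxE mulrC; exact: sumX.
apply/matrixP=> i j; rewrite linearD /= trmx1 mulmxDr mulmx1 !mulmxDl !mul1mx.
rewrite [RHS]mxE [X in X + _]mxE [X in _ + X]mxE !AX !XA ES'; ring.
Qed.

(** With the right x and y this is the orthogonal sum of the block on {r, u} and its Schur
    complement. For r = u and pivot c, take x = -1/c and y = 0. For a block with S r r = 0, S r u =
    b and S u u = c, the inverse has the entries -c/b^2 at (r, r), 1/b at (r, u) and 0 at (u, u),
    whence x = c/b^2, y = -1/b and no term in S i u times S u j. *)
Definition elim_mx S r u (x y : F) : 'M[F]_n :=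
  \matrix_(i, j)
    if (i \in [:: r; u]) || (j \in [:: r; u])
    then (if (i \in [:: r; u]) && (j \in [:: r; u]) then S i j else 0)
    else S i j + x * (S i r * S r j) + y * (S i r * S u j + S i u * S r j).

Definition symm S := forall i j, S i j = S j i.

Lemma elim_mx_congruent1 S u : symm S -> S u u != 0 ->
  congruent S (elim_mx S u u (- 1 / S u u) 0).
Proof.
move=> sS c0.
apply: (@congruent_add2 _ _ u u
         (fun i => if i == u then 0 else - S i u / S u u) (fun=> 0));
  rewrite ?eqxx // => i j.
rewrite mxE !inE !orbb; case: (eqVneq i u) => [->|iu]; case: (eqVneq j u) => [->|ju] /=.
- by ring.
- by rewrite (sS u j); field.
- by field.
- by rewrite (sS u j); field.
Qed.

Lemma elim_mx_congruent2 S r u : symm S -> r != u -> S r r = 0 -> S r u != 0 ->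
  congruent S (elim_mx S r u (S u u / (S r u * S r u)) (- 1 / S r u)).
Proof.
move=> sS ru rr b0.
pose a i := S u u / (S r u * S r u) * S i r - S i u / S r u.
pose b i := - S i r / S r u.
apply: (@congruent_add2 _ _ r u
  (fun i => if i \in [:: r; u] then 0 else a i)
  (fun i => if i \in [:: r; u] then 0 else b i));
  rewrite ?inE ?eqxx ?orbT // => i j.
rewrite mxE rr (sS u r) /a /b !inE.
have ur : (u == r) = false by rewrite eq_sym (negPf ru).
case: (eqVneq i r) => [->|ir]; [|case: (eqVneq i u) => [->|iu]];
  (case: (eqVneq j r) => [->|jr]; [|case: (eqVneq j u) => [->|ju]]);
  rewrite /= ?eqxx ?ur ?(negPf ru) /= ?rr ?(sS u r) ?(sS r j) ?(sS u j) ?(sS r i) ?(sS u i); by field.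
Qed.

Lemma congruent_row_op S S' i0 j0 (x : F) : i0 != j0 ->
  (forall i j, S' i j = S i j + (i == i0)%:R * x * S j0 j
     + (j == i0)%:R * x * S i j0
     + (i == i0)%:R * (j == i0)%:R * (x * x) * S j0 j0) ->
  congruent S S'.
Proof.
move=> ij ES'.
apply: (@congruent_add2 _ _ j0 j0 (fun i => (i == i0)%:R * x) (fun=> 0));
  rewrite ?(eq_sym j0) ?(negPf ij) ?mul0r //= => i j.
by rewrite ES'; ring.
Qed.

Definition block2 S r u := forall j, j != r -> j != u -> S r j = 0 /\ S u j = 0.

(** Clearing the block with diagonal 0, c and off-diagonal b by the pivot c leaves -b^2/c at r.
    Negation is written as subtraction from 0 because the programs compute it so. *)
Definition split_pair S r u : 'M[F]_n :=
  \matrix_(i, j) if (i == r) && (j == r) then 0 - S r u * S r u / S u u else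
    if ((i == r) && (j == u)) || ((i == u) && (j == r)) then 0 else S i j.

Lemma split_pair_congruent S r u : symm S -> r != u -> S r r = 0 ->
  S u u != 0 -> block2 S r u -> congruent S (split_pair S r u).
Proof.
move=> sS ru rr c0 blk.
apply: (@congruent_row_op _ _ r u (- S r u / S u u)) => // i j.
rewrite mxE.
case: (eqVneq i r) => [->|ir]; case: (eqVneq j r) => [->|jr] /=;
  rewrite ?(negPf ru) ?rr ?(sS u r) /= ?(eq_sym u r) ?(negPf ru) /=.
- by field.
- case: (eqVneq j u) => [->|ju] /=; first by field.
  have [-> ->] := blk j jr ju; ring.
- case: (eqVneq i u) => [->|iu] /=; first by rewrite (sS u r); field.
  have [h1 h2] := blk i ir iu; rewrite (sS i r) (sS i u) h1 h2; ring.
- by rewrite andbF /=; ring.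
Qed.

(** The diagonal block with entries d and -b^2/d has the same determinant -b^2 as the hyperbolic
    plane that it replaces; d must be a value which the form can be made to take at i0. *)
Definition hyper_split S i0 r0 (d : F) : 'M[F]_n :=
  \matrix_(i, j) if (i == i0) && (j == i0) then d else
    if (i == r0) && (j == r0) then 0 - S i0 r0 * S i0 r0 / d else
    if ((i == r0) && (j == i0)) || ((i == i0) && (j == r0)) then 0 else S i j.

Definition pair_mx S i0 r0 (x b y : F) : 'M[F]_n :=
  \matrix_(i, j) if (i == i0) && (j == i0) then x else
    if (i == r0) && (j == r0) then y else
    if ((i == r0) && (j == i0)) || ((i == i0) && (j == r0)) then b else S i j.

(** Adding x times r0 to i0 gives i0 the diagonal value 2xb, which is d for x = d/(2b); then r0 is
    cleared by the pivot d. *)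
Lemma hyper_split_odd S i0 r0 (d : F) : symm S -> i0 != r0 ->
  S i0 i0 = 0 -> S r0 r0 = 0 -> S i0 r0 != 0 -> d != 0 -> (2%:R : F) != 0 ->
  block2 S i0 r0 -> congruent S (hyper_split S i0 r0 d).
Proof.
move=> sS ir ii rr b0 d0 h2 blk; set b := S i0 r0 in b0.
have blk' j : j != i0 -> j != r0 -> [/\ S i0 j = 0, S r0 j = 0, S j i0 = 0 & S j r0 = 0].
  by move=> h1 h3; have [e1 e2] := blk j h1 h3; rewrite (sS j i0) (sS j r0).
apply: (@congruent_trans _ (pair_mx S i0 r0 d b 0)).
  apply: (@congruent_row_op _ _ i0 r0 (d / (2%:R * b))) => // i j.
  rewrite mxE.
  case: (eqVneq i i0) => [->|hi]; case: (eqVneq j i0) => [->|hj] /=;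
    rewrite ?(negPf ir) ?ii ?rr ?(sS r0 i0) -/b /=.
  - by field; rewrite h2 b0.
  - case: (eqVneq j r0) => [Ej|hj']; rewrite ?Ej /=; first by rewrite rr -/b; ring.
    by have [-> -> _ _] := blk' j hj hj'; ring.
  - case: (eqVneq i r0) => [Ei|hi']; rewrite ?Ei /=; first by rewrite (sS r0 i0) rr -/b; ring.
    by have [_ _ -> ->] := blk' i hi hi'; ring.
  - case: (eqVneq i r0) => [Ei|hi']; rewrite ?Ei /=; case: (eqVneq j r0) => [Ej|hj']; rewrite ?Ej /=;
    rewrite ?rr; ring.
apply: (@congruent_row_op _ _ r0 i0 (- b / d)); first by rewrite eq_sym.
have ri : (r0 == i0) = false by rewrite eq_sym (negPf ir).
move=> i j; rewrite !mxE !eqxx /= ?ri ?(negPf ir) /=.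
case: (eqVneq i i0) => [->|hi]; case: (eqVneq j i0) => [->|hj] /=;
  rewrite ?ri ?(negPf ir) /= ?andbF ?orbF //=.
- by ring.
- case: (eqVneq j r0) => [Ej|hj']; rewrite ?Ej /=; first by field.
  by have [-> _ _ _] := blk' j hj hj'; ring.
- case: (eqVneq i r0) => [Ei|hi']; rewrite ?Ei /=; first by field.
  by have [_ _ -> _] := blk' i hi hi'; ring.
- case: (eqVneq i r0) => [Ei|hi']; rewrite ?Ei /=; case: (eqVneq j r0) => [Ej|hj']; rewrite ?Ej /=.
  + by rewrite -/b; field.
  + by have [-> _ _ _] := blk' j hj hj'; ring.
  + by have [_ _ -> _] := blk' i hi hi'; ring.
  + by ring.
Qed.

Lemma symm_elim_mx S r u x y : symm S -> symm (elim_mx S r u x y).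
Proof.
move=> sS i j; rewrite !mxE orbC andbC (sS i j); case: ifP => // _.
by rewrite (sS i r) (sS r j) (sS u j) (sS i u); ring.
Qed.

(* A hyperbolic plane next to <d> splits as <d> + <- b^2 / d> even in
   characteristic 2: add the vector i1 to i0, eliminate i0, and then r0, which is
   no longer isotropic. *)
Lemma hyper_split_diag S i0 r0 i1 : symm S -> i0 != r0 -> i1 != i0 -> i1 != r0 ->
  S i0 i0 = 0 -> S r0 r0 = 0 -> S i0 r0 != 0 -> S i1 i1 != 0 ->
  block2 S i0 r0 -> (forall j, j != i1 -> S i1 j = 0) ->
  congruent S (hyper_split S i0 r0 (S i1 i1)).
Proof.
move=> sS ir ni nr ii rr b0 d0 blk iso.
set b := S i0 r0 in b0; set d := S i1 i1 in d0.
pose A1 : 'M[F]_n := \matrix_(i, j) (S i j + (i == i0)%:R * 1 * S i1 j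
     + (j == i0)%:R * 1 * S i i1
     + (i == i0)%:R * (j == i0)%:R * (1 * 1) * S i1 i1).
pose A2 := elim_mx A1 i0 i0 (- 1 / A1 i0 i0) 0.
pose A3 := elim_mx A2 r0 r0 (- 1 / A2 r0 r0) 0.
have ri : (r0 == i0) = false by rewrite eq_sym (negPf ir).
have n1 : (i0 == i1) = false by rewrite eq_sym (negPf ni).
have n2 : (r0 == i1) = false by rewrite eq_sym (negPf nr).
have zi0 : S i0 i1 = 0 by rewrite sS iso // n1.
have zr0 : S r0 i1 = 0 by rewrite sS iso // n2.
have z0i : S i1 i0 = 0 by rewrite iso // n1.
have z0r : S i1 r0 = 0 by rewrite iso // n2.
have Sri : S r0 i0 = b by rewrite sS.
have neqs := (eqxx, ri, negPf ir, n1, n2, negPf ni, negPf nr).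
have vals := (ii, rr, zi0, zr0, z0i, z0r, Sri).
have sA1 : symm A1 by move=> i j; rewrite !mxE (sS i j) (sS i i1) (sS i1 j); ring.
have d1 : A1 i0 i0 = d by rewrite mxE !neqs /= ?vals -/d; ring.
have d2 : A2 r0 r0 = - (b * b) / d.
  by rewrite /A2 d1 !mxE !inE !neqs /= ?vals -/b; field.
have h : congruent S A1.
  by apply: (@congruent_row_op _ _ i0 i1 1); rewrite ?n1 // => i j; rewrite mxE.
apply: congruent_trans h _; apply: (@congruent_trans _ A2).
  by apply: elim_mx_congruent1; rewrite ?d1.
suff -> : hyper_split S i0 r0 d = A3.
  apply: elim_mx_congruent1; first exact: symm_elim_mx.
  by rewrite d2 !mulf_neq0 ?oppr_eq0 ?mulf_neq0 ?invr_neq0.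
have far j : j != i0 -> j != r0 -> j != i1 ->
    [/\ S i0 j = 0, S r0 j = 0 & S i1 j = 0] /\
    [/\ S j i0 = 0, S j r0 = 0 & S j i1 = 0].
  move=> h1 h3 h4; have [e1 e2] := blk j h1 h3.
  by rewrite (sS j i0) (sS j r0) (sS j i1) e1 e2 iso.
apply/matrixP=> i j; rewrite /A3 d2 /A2 d1 !mxE !inE.
case: (eqVneq i i0) => [->|hi0]; [|case: (eqVneq i r0) => [->|hi1];
   [|case: (eqVneq i i1) => [->|hi2]]];
 (case: (eqVneq j i0) => [->|hj0]; [|case: (eqVneq j r0) => [->|hj1];
   [|case: (eqVneq j i1) => [->|hj2]]]);
 rewrite ?neqs /= ?neqs /= ?vals //=;
 try (have [[e1 e2 e3] [e4 e5 e6]] := far i hi0 hi1 hi2; rewrite ?e1 ?e2 ?e3 ?e4 ?e5 ?e6);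
 try (have [[e1' e2' e3'] [e4' e5' e6']] := far j hj0 hj1 hj2;
      rewrite ?e1' ?e2' ?e3' ?e4' ?e5' ?e6');
 rewrite -/b -/d; try (by ring); by field; rewrite d0 oppr_eq0 mulf_neq0.
Qed.

End Congruence.

(** * The elimination invariant *)

(** All that the elimination uses of the tree. Ranks count down: the vertex of largest rank goes
    first, since ranks are handed out from the root downwards. [eo_par] carries the connectedness
    condition: below its home, a vertex passes from each bag to the parent bag. *)
Record elim_order n t (B : 'I_t -> {set 'I_n}) (pos : 'I_t -> nat)
    (par : 'I_t -> option 'I_t) (home : 'I_n -> 'I_t) (rank : 'I_n -> nat) : Prop :=
  ElimOrder {
  eo_pos : injective pos;
  eo_rank : injective rank;
  eo_home : forall v, v \in B (home v);
  eo_max : forall v x, v \in B x -> (pos x <= pos (home v))%N;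
  eo_par : forall v x, v \in B x -> x != home v ->
    exists2 y, par x = Some y & v \in B y;
  eo_up : forall x y, par x = Some y -> (pos x < pos y)%N;
  eo_mono : forall v w, (rank v < rank w)%N -> (pos (home w) <= pos (home v))%N }.

Section Invariant.

Variables (F : fieldType) (n t : nat) (B : 'I_t -> {set 'I_n}).
Variables (pos : 'I_t -> nat) (par : 'I_t -> option 'I_t).
Variables (home : 'I_n -> 'I_t) (rank : 'I_n -> nat).
Hypothesis eo : elim_order B pos par home rank.

Implicit Types (S : 'M[F]_n) (own : 'I_n -> option ('I_t * 'I_n)).
Implicit Types (u v w r : 'I_n) (x y z : 'I_t).

(** On the way up from a common bag neither vertex disappears before the lower home, that of u, is
    reached. Hence the order is a perfect elimination order for the graph in which every bag is a
    clique, and fill-in stays inside the bags. *)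
Lemma later_in_bag u w z : u \in B z -> w \in B z ->
  (pos (home u) <= pos (home w))%N -> w \in B (home u).
Proof.
elim: {z}_.+1 {-2}z (ltnSn (pos (home u) - pos z)) => // N IH z hN hu hw hp.
have [<-//|nz] := eqVneq z (home u).
have hz : (pos z < pos (home u))%N.
  rewrite ltn_neqAle (eo_max eo hu) andbT.
  by apply: contra nz => /eqP/(eo_pos eo)->.
have [y py hy] := eo_par eo hu nz.
have [|y' py' hy'] := eo_par eo hw _.
  by apply: contraTneq hz => ->; rewrite -leqNgt.
move: py'; rewrite py => -[E]; rewrite -{}E in hy'.
apply: (IH y) => //.
by have := eo_up eo py; have := eo_max eo hu; lia.
Qed.

Definition set_own own r o : 'I_n -> option ('I_t * 'I_n) :=
  fun q => if q == r then o else own q.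

Lemma set_own_eq own r o : set_own own r o r = o.
Proof. by rewrite /set_own eqxx. Qed.

Lemma set_own_neq own r o q : q != r -> set_own own r o q = own q.
Proof. by rewrite /set_own => /negPf ->. Qed.

(* [cnt] vertices are still to be eliminated, those of rank less than [cnt].
   [own r = Some (y, p)] means that the eliminated vertex [r] is isotropic and
   its row is deferred at node [y] with leading column [p]; [mate] records the
   hyperbolic pairs, shifted by one so that 0 means none. *)
Record invariant own S cnt (mate : nat -> nat) i : Prop := Invariant {
  inv_symm : symm S;
  inv_live : forall u w, (rank u < cnt)%N -> (rank w < cnt)%N -> u != w ->
    S u w != 0 -> exists z, (u \in B z) && (w \in B z);
  inv_own : forall r y p, own r = Some (y, p) ->
    [/\ (cnt <= rank r)%N, (i <= pos y)%N, S r p != 0 &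
    forall j, S r j != 0 -> [/\ (rank j < cnt)%N, j \in B y & (rank j <= rank p)%N]];
  inv_fin : forall r, (cnt <= rank r)%N -> own r = None ->
    forall j, j != r -> S r j != 0 ->
    [/\ (cnt <= rank j)%N, mate r = j.+1 & S r r = 0] }.

Lemma inv_own_diag own S cnt mate i r y p : invariant own S cnt mate i ->
  own r = Some (y, p) -> S r r = 0.
Proof.
move=> h /(inv_own h) [h1 _ _ h2]; apply/eqP/negPn/negP => /h2 [].
by rewrite ltnNge h1.
Qed.

Lemma inv_own_dead own S cnt mate i r y p j : invariant own S cnt mate i ->
  own r = Some (y, p) -> (cnt <= rank j)%N -> S r j = 0.
Proof.
move=> h /(inv_own h) [_ _ _ h2] hj; apply/eqP/negPn/negP => /h2 [].
by rewrite ltnNge hj.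
Qed.

Section Forget.

Variables (own : 'I_n -> option ('I_t * 'I_n)) (S : 'M[F]_n) (cnt : nat).
Variables (mate : nat -> nat) (i : nat) (u : 'I_n).
Hypothesis inv : invariant own S cnt.+1 mate i.
Hypotheses (ru : rank u = cnt) (pu : pos (home u) = i).

Lemma forget_rank w : (rank w < cnt.+1)%N -> w != u -> (rank w < cnt)%N.
Proof.
move=> h; apply: contraNT => h'; apply/eqP/(eo_rank eo); lia.
Qed.

(** If the row w, deferred at y with leading column p, meets column u, then u lies in the bag of y,
    so y is not above [home u]; and it is not below, since the nodes before position i hold no
    deferred rows. As u has the largest live rank, it is the leading column. *)
Lemma own_forgotten w : own w = Some (home u, u) \/ S w u = 0 \/
  ((rank w < cnt.+1)%N \/ own w = None).
Proof.
have [-> |hS] := eqVneq (S w u) 0; first by right; left.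
case Ew: (own w) => [[y p]|]; last by right; right; right.
left; have [h1 h2 h3 h4] := inv_own inv Ew.
have [e1 e2 e3] := h4 _ hS; have [f1 f2 f3] := h4 _ h3.
have -> : u = p by apply: (eo_rank eo); lia.
suff -> : y = home u by have -> : u = p by apply: (eo_rank eo); lia.
by apply: (eo_pos eo); have := eo_max eo e2; lia.
Qed.

Lemma forget_support w : w != u -> S u w != 0 ->
  ((rank w < cnt)%N /\ w \in B (home u)) \/ own w = Some (home u, u).
Proof.
move=> wu hS; have [lw|dw] := ltnP (rank w) cnt.+1.
  left; have lw' := forget_rank lw wu; split=> //.
  have [||z /andP[hu hw]] := inv_live inv _ lw _ hS; rewrite ?ru //.
    by rewrite eq_sym.
  apply: later_in_bag hu hw _; apply: (eo_mono eo); lia.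
right; have hS' : S w u != 0 by rewrite (inv_symm inv).
have [//|[E|[|E]]] := own_forgotten w; first by rewrite E eqxx in hS'.
  lia.
have uw : u != w by rewrite eq_sym.
by have [] := inv_fin inv dw E uw hS'; rewrite ru; lia.
Qed.

Lemma forget_own w : own w != Some (home u, u) -> own w != None -> S w u = 0.
Proof.
move=> h1 h2; have [E|[//|[h|E]]] := own_forgotten w.
- by rewrite E eqxx in h1.
- case E: (own w) h2 => [[y p]|] // _.
  by have [] := inv_own inv E; lia.
- by rewrite E in h2.
Qed.

Lemma own_live : own u = None.
Proof.
by case E: (own u) => [[y p]|] //; have [] := inv_own inv E; rewrite ru; lia.
Qed.

Lemma finished_row r : (cnt.+1 <= rank r)%N -> own r = None ->
  forall j, (rank j < cnt.+1)%N -> S r j = 0.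
Proof.
move=> h1 h2 j hj; apply/eqP/negPn/negP => hS.
have [E|jr] := eqVneq j r; first by move: hj; rewrite E; lia.
have [] := inv_fin inv h1 h2 jr hS; lia.
Qed.

(** The leading column is the one eliminated soonest, hence of largest rank. [None] stands for a
    zero row, which is then finished. *)
Definition leading (r : 'I_n) (o : option 'I_n) S :=
  if o is Some p then
    S r p != 0 /\ (forall j, S r j != 0 -> (rank j <= rank p)%N)
  else forall j, S r j = 0.

Lemma inv_defer o : S u u = 0 -> (forall w, own w != Some (home u, u)) ->
  leading u o S ->
  invariant (set_own own u (omap (pair (home u)) o)) S cnt mate i.
Proof.
move=> uu hno hl; split; first exact: inv_symm inv.
- by move=> v w hv hw; apply: (inv_live inv); apply: ltnW.
- move=> r y p; rewrite /set_own; have [->|nru] := eqVneq r u.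
    case: o hl => [q [h1 h2]|] //= [<- <-]; split; rewrite ?ru ?pu // => j hS.
    have ju : j != u by apply: contraNneq hS => ->; rewrite uu.
    have [[h3 h4]|E] := forget_support ju hS; last by have := hno j; rewrite E eqxx.
    by split=> //; apply: h2.
  move=> E; have [h1 h2 h3 h4] := inv_own inv E; split=> //; first exact: ltnW.
  move=> j hS; have [f1 f2 f3] := h4 _ hS; split=> //; apply: forget_rank => //.
  apply: contraNneq hS => ->; apply/eqP/forget_own; first exact: hno.
  by rewrite E.
- move=> r hr; rewrite /set_own; have [->|nru] := eqVneq r u.
    case: o hl => //= hl _ j _; by rewrite hl eqxx.
  have hr' : (cnt.+1 <= rank r)%N.
    by rewrite ltn_neqAle hr andbT -ru; apply: contra nru => /eqP/(eo_rank eo)->.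
  by move=> E j jr hS; have [h1 h2 h3] := inv_fin inv hr' E jr hS; split=> //; apply: ltnW.
Qed.

(** Since no deferred row meets column u, the neighbours of u are all live and lie in the bag of its
    home, so every new nonzero entry joins two vertices of that bag. *)
Lemma inv_elim1 a : S u u != 0 -> (forall w, own w != Some (home u, u)) ->
  invariant own (elim_mx S u u a 0) cnt mate i.
Proof.
move=> uu hno.
have sE v w : v != u -> w != u -> elim_mx S u u a 0 v w = S v w + a * (S v u * S u w).
  by move=> h1 h2; rewrite mxE !inE !orbb (negPf h1) (negPf h2) /= mul0r addr0.
have sE0 v w : v != u -> S v u = 0 -> elim_mx S u u a 0 v w = S v w.
  move=> h1 h2; have [->|wu] := eqVneq w u; last by rewrite sE // h2 mul0r mulr0 addr0.
  by rewrite mxE !inE (negPf h1) !eqxx /= h2.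
split; first exact/symm_elim_mx/(inv_symm inv).
- move=> v w hv hw vw.
  have vu : v != u by apply: contraTneq hv => ->; rewrite ru ltnn.
  have wu : w != u by apply: contraTneq hw => ->; rewrite ru ltnn.
  rewrite sE // => hS; have [E|hvw] := eqVneq (S v w) 0; last first.
    by apply: (inv_live inv) hvw => //; apply: ltnW.
  rewrite E add0r !mulf_eq0 !negb_or in hS; case/and3P: hS => _ h1 h2.
  exists (home u); rewrite (inv_symm inv) in h1.
  have [[_ ->]|E1] := forget_support vu h1; last by have := hno v; rewrite E1 eqxx.
  by have [[_ ->]|E1] := forget_support wu h2; last by have := hno w; rewrite E1 eqxx.
- move=> r y p E; have [h1 h2 h3 h4] := inv_own inv E.
  have nru : r != u by apply: contraTneq h1 => ->; rewrite ru; lia.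
  have z : S r u = 0 by apply: forget_own; rewrite ?hno // E.
  split; rewrite ?sE0 //; first exact: ltnW.
  move=> j; rewrite sE0 // => hS; have [f1 f2 f3] := h4 _ hS; split=> //.
  apply: forget_rank => //; by apply: contraNneq hS => ->; rewrite z.
- move=> r hr E j jr; have [e|nru] := eqVneq r u.
    by rewrite e in jr *; rewrite mxE !inE (negPf jr) !eqxx.
  have hr' : (cnt.+1 <= rank r)%N.
    by rewrite ltn_neqAle hr andbT -ru; apply: contra nru => /eqP/(eo_rank eo)->.
  have z : S r u = 0 by apply: finished_row => //; rewrite ru.
  rewrite !sE0 // => hS; have [h1 h2 h3] := inv_fin inv hr' E jr hS.
  by split=> //; apply: ltnW.
Qed.

Section Pair.

Variables (r : 'I_n) (a b : F).
Hypotheses (Er : own r = Some (home u, u)).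
Hypothesis uniq_r : forall w, own w = Some (home u, u) -> w = r.

Let E := elim_mx S r u a b.

Lemma pair_neq : r != u.
Proof. by apply/eqP => e; move: Er; rewrite e own_live. Qed.

Lemma pair_mxE v w : v \notin [:: r; u] -> w \notin [:: r; u] ->
  E v w = S v w + a * (S v r * S r w) + b * (S v r * S u w + S v u * S r w).
Proof. by move=> /negPf h1 /negPf h2; rewrite mxE h1 h2. Qed.

Lemma pair_mx0 v w : v \notin [:: r; u] -> S v r = 0 -> S v u = 0 -> E v w = S v w.
Proof.
move=> h1 z1 z2; have [h2|h2] := boolP (w \in [:: r; u]).
  rewrite mxE (negPf h1) h2 /=.
  by move: h2; rewrite !inE => /orP[/eqP->|/eqP->]; rewrite ?z1 ?z2.
by rewrite pair_mxE // z1 z2 !(mul0r, mulr0, addr0).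
Qed.

Lemma pair_block : block2 E r u.
Proof.
move=> j jr ju; have h : j \notin [:: r; u] by rewrite !inE negb_or jr.
by rewrite !mxE (negPf h) !inE !eqxx orbT.
Qed.

(** Common to the two outcomes, the block being split at once or kept as a hyperbolic pair: they
    differ from E only in the rows and columns of r and u and in the partners recorded for these
    two. *)
Lemma inv_pair_gen E' (mate' : nat -> nat) : symm E' ->
  (forall v w, v \notin [:: r; u] -> E' v w = E v w) ->
  (forall j, j != r -> E' r j != 0 -> [/\ (cnt <= rank j)%N, mate' r = j.+1 & E' r r = 0]) ->
  (forall j, j != u -> E' u j != 0 -> [/\ (cnt <= rank j)%N, mate' u = j.+1 & E' u u = 0]) ->
  (forall q : 'I_n, q \notin [:: r; u] -> mate' q = mate q) ->
  invariant (set_own own r None) E' cnt mate' i.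
Proof.
move=> sE' hE' hr hu hm; have [dr _ _ _] := inv_own inv Er.
have ninru q : (q \notin [:: r; u]) = (q != r) && (q != u).
  by rewrite !inE negb_or.
have live_nin q : (rank q < cnt)%N -> q \notin [:: r; u].
  move=> h; rewrite ninru; apply/andP; split; apply: contraTneq h => ->; lia.
(* The support of r lies in the bag because r is deferred at [home u], that of u because r is the
   only deferred row in column u. So the fill-in of the block stays in one bag. *)
have live_bag q : (rank q < cnt)%N -> S q r != 0 \/ S q u != 0 -> q \in B (home u).
  move=> hq; have := live_nin _ hq; rewrite ninru => /andP[qr qu].
  case=> h; rewrite (inv_symm inv) in h.
    by have [_ _ _ /(_ _ h) []] := inv_own inv Er.
  have [[]//|E1] := forget_support qu h.
  by rewrite (uniq_r E1) eqxx in qr.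
split=> //.
- move=> v w hv hw vw; rewrite hE' ?live_nin // pair_mxE ?live_nin // => hS.
  have [Z|hvw] := eqVneq (S v w) 0; last first.
    by apply: (inv_live inv) hvw => //; apply: ltnW.
  have nz q q' : q * q' != 0 :> F -> q != 0 /\ q' != 0.
    by rewrite mulf_eq0 negb_or => /andP.
  exists (home u); apply/andP; split; apply: live_bag => //.
    apply/orP; apply: contraNT hS; rewrite negb_or !negbK => /andP[/eqP-> /eqP->].
    by rewrite Z !(mul0r, mulr0, addr0).
  rewrite (inv_symm inv w r) (inv_symm inv w u).
  apply/orP; apply: contraNT hS; rewrite negb_or !negbK => /andP[/eqP-> /eqP->].
  by rewrite Z !(mul0r, mulr0, addr0).
- move=> q y p; rewrite /set_own; have [//|qr Eq] := eqVneq q r.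
  have [h1 h2 h3 h4] := inv_own inv Eq.
  have qu : q != u by apply: contraTneq h1 => ->; rewrite ru; lia.
  have zu : S q u = 0.
    apply: forget_own; rewrite Eq //; apply: contra qr => /eqP e.
    by rewrite -(uniq_r (etrans Eq e)).
  have zr : S q r = 0 by apply: inv_own_dead Eq _; [exact: inv|exact: dr].
  have hq : q \notin [:: r; u] by rewrite ninru qr.
  rewrite hE' // pair_mx0 //; split=> //; first exact: ltnW.
  move=> j; rewrite hE' // pair_mx0 // => hS; have [f1 f2 f3] := h4 _ hS; split=> //.
  apply: forget_rank => //; by apply: contraNneq hS => ->; rewrite zu.
- move=> q hq; rewrite /set_own; have [->|qr] := eqVneq q r; first by move=> _; apply: hr.
  move=> Eq j jq; have [e|qu] := eqVneq q u.
    by rewrite e in jq *; apply: hu.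
  have hq' : (cnt.+1 <= rank q)%N.
    by rewrite ltn_neqAle hq andbT -ru; apply: contra qu => /eqP/(eo_rank eo)->.
  have nq : q \notin [:: r; u] by rewrite ninru qr.
  have zu : S q u = 0 by apply: finished_row => //; rewrite ru.
  have zr : S q r = 0.
    rewrite (inv_symm inv); apply: inv_own_dead Er _; [exact: inv|exact: hq'].
  rewrite !hE' // !pair_mx0 // hm // => hS.
  by have [h1 h2 h3] := inv_fin inv hq' Eq jq hS; split=> //; apply: ltnW.
Qed.

Lemma pair_diag : E r r = 0 /\ E u u = S u u /\ E r u = S r u.
Proof.
rewrite !mxE !inE !eqxx (inv_own_diag inv Er).
by case: (u == r).
Qed.

Lemma inv_split_pair : E u u != 0 ->
  invariant (set_own own r None) (split_pair E r u) cnt mate i.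
Proof.
move=> c0; have [e1 [e2 e3]] := pair_diag; have nru := pair_neq.
have sE : symm E by apply/symm_elim_mx/(inv_symm inv).
apply: inv_pair_gen => //.
- move=> v w; rewrite [LHS]mxE [RHS]mxE (sE v w) (andbC (w == r) (v == r)).
  by rewrite (andbC (w == r) (v == u)) (andbC (w == u)) orbC.
- by move=> v w; rewrite !inE negb_or => /andP[/negPf h1 /negPf h2]; rewrite mxE h1 h2.
- move=> j jr; rewrite mxE eqxx (negPf jr) (negPf nru) /= orbF.
  case: (eqVneq j u) => [_|ju]; rewrite ?eqxx //.
  by have [-> _] := pair_block jr ju; rewrite eqxx.
- move=> j ju; rewrite mxE eqxx (eq_sym u r) (negPf nru) /=.
  case: (eqVneq j r) => [_|jr]; rewrite ?eqxx //.
  by have [_ ->] := pair_block jr ju; rewrite eqxx.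
Qed.

Lemma inv_keep_pair (mate' : nat -> nat) : S u u = 0 ->
  mate' r = u.+1 -> mate' u = r.+1 ->
  (forall q : 'I_n, q \notin [:: r; u] -> mate' q = mate q) ->
  invariant (set_own own r None) E cnt mate' i.
Proof.
move=> uu m1 m2 m3; have [e1 [e2 e3]] := pair_diag; have nru := pair_neq.
have [dr _ _ _] := inv_own inv Er.
apply: inv_pair_gen => //; first exact/symm_elim_mx/(inv_symm inv).
- move=> j jr hS; have [->|ju] := eqVneq j u; first by rewrite ru e1.
  by have [h _] := pair_block jr ju; rewrite h eqxx in hS.
- move=> j ju hS; have [->|jr] := eqVneq j r; first by rewrite e2 uu m2 ltnW.
  by have [_ h] := pair_block jr ju; rewrite h eqxx in hS.
Qed.

End Pair.

End Forget.

Definition reduce_mx S r r' (a : F) : 'M[F]_n :=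
  \matrix_(i, j) if i == r then S r j - a * S r' j else
    if j == r then S r i - a * S r' i else S i j.

(** All entries among r and r' vanish, as both are eliminated and deferred; this is why the term
    quadratic in a is absent from [reduce_mx]. *)
Lemma reduce_mx_congruent own S cnt mate i r r' a o o' :
  invariant own S cnt mate i -> r != r' ->
  own r = Some o -> own r' = Some o' -> congruent S (reduce_mx S r r' a).
Proof.
case: o o' => [y p] [y' p'] inv rr' Er Er'.
have sS := inv_symm inv.
have [dr _ _ _] := inv_own inv Er; have [dr' _ _ _] := inv_own inv Er'.
have z1 := inv_own_dead inv Er dr; have z2 := inv_own_dead inv Er dr'.
have z3 := inv_own_dead inv Er' dr; have z4 := inv_own_dead inv Er' dr'.
apply: (@congruent_row_op _ _ _ _ r r' (- a)) => // v w; rewrite mxE.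
case: (eqVneq v r) => [->|vr]; case: (eqVneq w r) => [->|wr] /=.
- by rewrite z1 z2 z3 z4; ring.
- by ring.
- by rewrite (sS r v) (sS r' v); ring.
- by ring.
Qed.

(** The multiple is chosen to cancel column p, and both rows live on ranks up to that of p, so the
    new leading column has smaller rank. This strict drop is what lowers the potential. *)
Lemma inv_reduce own S cnt mate i r r' y p o :
  invariant own S cnt mate i -> r != r' ->
  own r = Some (y, p) -> own r' = Some (y, p) ->
  leading r o (reduce_mx S r r' (S r p / S r' p)) ->
  invariant (set_own own r (omap (pair y) o)) (reduce_mx S r r' (S r p / S r' p))
     cnt mate i
  /\ (forall q, o = Some q -> (rank q < rank p)%N).
Proof.
move=> inv rr' Er Er'; set a := S r p / S r' p; set S' := reduce_mx _ _ _ _ => hl.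
have sS := inv_symm inv.
have [dr iy hrp hr] := inv_own inv Er; have [dr' _ hrp' hr'] := inv_own inv Er'.
have z j : (cnt <= rank j)%N -> S r j = 0 by apply: inv_own_dead inv Er.
have z' j : (cnt <= rank j)%N -> S r' j = 0 by apply: inv_own_dead inv Er'.
have ES' j : S' r j = S r j - a * S r' j by rewrite mxE eqxx.
have hS' j : S' r j != 0 -> [/\ (rank j < cnt)%N, j \in B y & (rank j < rank p)%N].
  move=> h; have jp : j != p.
    by apply: contraNneq h => ->; rewrite ES' /a divfK // subrr.
  suff [h1 h2 h3] : [/\ (rank j < cnt)%N, j \in B y & (rank j <= rank p)%N].
    split=> //; rewrite ltn_neqAle h3 andbT; by apply: contra jp => /eqP/(eo_rank eo)->.
  have [e|/hr//] := eqVneq (S r j) 0; apply: hr'.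
  by apply: contraNneq h => e'; rewrite ES' e e' mulr0 subr0.
have nE v w : v != r -> w != r -> S' v w = S v w.
  by move=> /negPf h1 /negPf h2; rewrite mxE h1 h2.
have nE' v w : (cnt <= rank v)%N -> v != r -> S' v w = S v w.
  move=> h1 h2; have [->|] := eqVneq w r; last exact: nE.
  by rewrite mxE (negPf h2) eqxx z // z' // (sS v r) z // mulr0 subr0.
split; first split.
- move=> v w; rewrite !mxE.
  by case: (v =P r) => [e1|_]; case: (w =P r) => [e2|_]; rewrite ?e1 ?e2.
- move=> v w hv hw; rewrite nE; first exact: (inv_live inv).
    by apply: contraTneq hv => ->; rewrite -leqNgt.
  by apply: contraTneq hw => ->; rewrite -leqNgt.
- move=> q y' p'; rewrite /set_own; have [->|qr] := eqVneq q r.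
    case: o hl => // p1 [h1 h2] [<- <-]; split=> // j hj.
    by have [f1 f2 f3] := hS' _ hj; split=> //; apply: h2.
  move=> Eq; have [h1 h2 h3 h4] := inv_own inv Eq.
  rewrite nE' //; split=> // j; rewrite nE' //; exact: h4.
- move=> q hq; rewrite /set_own; have [->|qr] := eqVneq q r.
    by case: o hl => // hl _ j _; rewrite hl eqxx.
  move=> Eq j jq; rewrite !nE' //; exact: (inv_fin inv).
- by move=> q Eo; move: hl; rewrite Eo => -[/hS' []].
Qed.

(* All deferred rows of [x] change owner at once, before they are inserted one by
   one at [y]: this only adds pivots to [y], so no potential is lost. *)
Definition switch x y own : 'I_n -> option ('I_t * 'I_n) :=
  fun r => omap (fun o => (if o.1 == x then y else o.1, o.2)) (own r).

(** Once the vertices with home x are gone, a live vertex in the bag of x has its home further up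
    and therefore lies in the bag of the parent. In particular a node that still holds a deferred
    row has a parent. *)
Lemma inv_done own S cnt mate x :
  invariant own S cnt mate (pos x) ->
  (forall v, (rank v < cnt)%N -> (pos x < pos (home v))%N) ->
  forall r z p, own r = Some (z, p) -> z = x -> exists2 y, par x = Some y &
    (pos x < pos y)%N /\ forall j, S r j != 0 -> j \in B y.
Proof.
move=> inv hl r z p Er zx; rewrite {}zx in Er; have [h1 h2 h3 h4] := inv_own inv Er.
have nh j : (rank j < cnt)%N -> x != home j.
  by move/hl; apply: contraTneq => <-; rewrite ltnn.
have [f1 f2 f3] := h4 _ h3; have [y py hy] := eo_par eo f2 (nh _ f1).
exists y => //; split; first exact: (eo_up eo py).
move=> j /h4 [g1 g2 g3]; have [y' py' hy'] := eo_par eo g2 (nh _ g1).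
by move: py'; rewrite py => -[->].
Qed.

(** At a root no deferred row is left, since its leading column would need a parent of x; the target
    y is arbitrary there. *)
Lemma inv_switch own S cnt mate x y :
  invariant own S cnt mate (pos x) ->
  (forall v, (rank v < cnt)%N -> (pos x < pos (home v))%N) ->
  (par x = Some y \/ par x = None) ->
  invariant (switch x y own) S cnt mate (pos x).+1.
Proof.
move=> inv hl hpar; split; first exact: inv_symm inv.
- exact: (inv_live inv).
- move=> r z p; rewrite /switch; case Er: (own r) => [[z' p']|] //= [Ez <-].
  have [h1 h2 h3 h4] := inv_own inv Er; split=> //.
    rewrite -Ez; case: (eqVneq z' x) => [e|ne].
      have [y' py [h _]] := inv_done inv hl Er e; case: hpar; rewrite py // => -[<-].
      by [].
    by rewrite ltn_neqAle h2 andbT; apply: contra ne => /eqP/(eo_pos eo)->.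
  move=> j hj; have [g1 g2 g3] := h4 _ hj; split=> //.
  rewrite -Ez; case: (eqVneq z' x) => [e|//].
  have [y' py [_ h]] := inv_done inv hl Er e; case: hpar; rewrite py // => -[<-].
  exact: h.
- move=> r hr; rewrite /switch; case Er: (own r) => [[]|] //= _; exact: (inv_fin inv).
Qed.

End Invariant.

(** * The potential that pays for the row reductions *)

Section Potential.

Variables (n t : nat) (rank : 'I_n -> nat) (K : nat).
Local Open Scope nat_scope.
Implicit Types (own : 'I_n -> option ('I_t * 'I_n)).
Implicit Types (p q r u : 'I_n) (x y z : 'I_t).

Definition pivots own y : {set 'I_n} := [set q | [exists r, own r == Some (y, q)]].

(** The order is that of the ranks: these are the pivots eliminated no later than p, p included. *)
Definition later_pivots own y p : nat := #|[set q in pivots own y | rank p <= rank q]|.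

(** K will be one more than the bound on the bags. Pivots of a node lie in its bag, so every
    deferred row has positive weight. *)
Definition weight own r : nat :=
  if own r is Some (y, p) then K - later_pivots own y p else 0.

(* Pays for the row operations: reducing a row moves its leading column past
   a pivot of its node, so [later_pivots] grows. *)
Definition potential own : nat := \sum_r weight own r.

Lemma pivotsP own y q : reflect (exists r, own r = Some (y, q)) (q \in pivots own y).
Proof.
by rewrite inE; apply: (iffP existsP) => -[r h]; exists r; apply/eqP.
Qed.

Lemma leq_potential own own' : (forall r, weight own' r <= weight own r) ->
  potential own' <= potential own.
Proof. by move=> h; apply: leq_sum. Qed.

Lemma leq_later_pivots own own' y y' p : pivots own y \subset pivots own' y' ->
  later_pivots own y p <= later_pivots own' y' p.
Proof.
move=> h; apply: subset_leq_card; apply/subsetP => q; rewrite 2![_ \in [set _ in _ | _]]inE.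
by case/andP => /(subsetP h) -> ->.
Qed.

(** The pivot p survives in r', so no other row gets heavier. The row r either becomes zero and
    loses its positive weight, or counts all its former pivots and its new leading column. *)
Lemma potential_reduce own r r' y p o :
  r != r' -> own r = Some (y, p) -> own r' = Some (y, p) ->
  later_pivots own y p < K ->
  (forall q, o = Some q -> rank q < rank p) ->
  potential (set_own own r (omap (pair y) o)) < potential own.
Proof.
move=> rr' Er Er' hK ho; set own' := set_own _ _ _.
have sub z : pivots own z \subset pivots own' z.
  apply/subsetP => q /pivotsP[s Es]; apply/pivotsP.
  have [e|sr] := eqVneq s r; last by exists s; rewrite /own' set_own_neq.
  exists r'; rewrite /own' set_own_neq 1?eq_sym // Er' -Es e Er.
  by [].
rewrite /potential (bigD1 r) //= [X in _ < X](bigD1 r) //= -addSn leq_add //.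
  rewrite /weight {1}/own' set_own_eq Er; case: o ho @own' sub => [q|] ho own' sub /=; last lia.
  suff : later_pivots own y p < later_pivots own' y q by move: hK; lia.
  apply: proper_card; apply/properP; split.
    apply/subsetP => s; rewrite 2![_ \in [set _ in _ | _]]inE => /andP[/(subsetP (sub y)) -> /=].
    by apply: leq_trans; apply/ltnW/ho.
  exists q; rewrite ![_ \in [set _ in _ | _]]inE ?leqnn ?andbT.
    by apply/pivotsP; exists r; rewrite /own' set_own_eq.
  by rewrite negb_and -(ltnNge _ (rank p)) ho ?orbT.
apply: leq_sum => s sr; rewrite /weight {1}/own' set_own_neq //.
case: (own s) => [[z q]|] //; apply: leq_sub2l; exact: leq_later_pivots.
Qed.

Lemma potential_switch own x y : potential (switch x y own) <= potential own.
Proof.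
apply: leq_potential => r; rewrite /weight {1}/switch; case: (own r) => [[z p]|] //=.
apply: leq_sub2l; apply: leq_later_pivots; apply/subsetP => q /pivotsP[s Es].
by apply/pivotsP; exists s; rewrite /switch Es.
Qed.

Lemma potential_add own u o : own u = None ->
  potential (set_own own u o) <= potential own + K.
Proof.
move=> Eu; set own' := set_own _ _ _.
have sub z : pivots own z \subset pivots own' z.
  apply/subsetP => q /pivotsP[s Es]; apply/pivotsP; exists s.
  by rewrite /own' set_own_neq //; apply/eqP => e; rewrite e Eu in Es.
rewrite /potential (bigD1 u) //= [X in _ <= X + _](bigD1 u) //=.
have -> : weight own u = 0 by rewrite /weight Eu.
rewrite addnC add0n leq_add //; last first.
  by rewrite /weight; case: (own' u) => [[]|] *; rewrite ?leq_subr.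
apply: leq_sum => s su; rewrite /weight {1}/own' set_own_neq //.
case: (own s) => [[z q]|] //; apply: leq_sub2l; exact: leq_later_pivots.
Qed.

(** Only the pivot p of the node x disappears, so each row at x gains at most one unit and the other
    rows gain nothing. *)
Lemma potential_del own r x p N : own r = Some (x, p) ->
  #|[set w | if own w is Some (z, _) then z == x else false]| <= N ->
  potential (set_own own r None) <= potential own + N.
Proof.
move=> Er hN; set own' := set_own _ _ _; set A := [set w | _] in hN.
apply: leq_trans (_ : \sum_w (weight own w + (w \in A)) <= _); last first.
  by rewrite big_split /= leq_add2l -big_mkcond /= sum1_card.
apply: leq_sum => w _; rewrite /weight {1}/own' /set_own.
have [//|wr] := eqVneq w r.
rewrite inE; case Ew: (own w) => [[z q]|] //.
have sub : pivots own z \subset (if z == x then p |: pivots own' z else pivots own' z).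
  apply/subsetP => q' /pivotsP[s Es].
  have [e|sr] := eqVneq s r.
    by move: Es; rewrite e Er => -[<- <-]; rewrite eqxx in_setU1 eqxx.
  have h : q' \in pivots own' z by apply/pivotsP; exists s; rewrite /own' set_own_neq.
  by case: ifP => // _; rewrite in_setU1 h orbT.
case: (eqVneq z x) sub => [_|_] sub /=; last first.
  by rewrite addn0; apply: leq_sub2l; exact: leq_later_pivots.
suff : later_pivots own z q <= (later_pivots own' z q).+1 by lia.
apply: (@leq_trans #|p |: [set q' in pivots own' z | rank q <= rank q']|); last first.
  by rewrite cardsU1 -[in X in _ <= X]add1n leq_add2r; case: (_ \notin _).
apply: subset_leq_card; apply/subsetP => q'; rewrite in_setU1 2![_ \in [set _ in _ | _]]inE.
case/andP => /(subsetP sub); rewrite in_setU1 => /orP[->//|-> ->]; by rewrite orbT.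
Qed.

End Potential.

(** * The main loop *)

Definition entry (i j : nat) : fexp := FGet 2 (NAdd (NGet 6 (NVar i)) (NVar j)).
Definition put_entry (i j : nat) (f : fexp) : cmd :=
  FPut 2 (NAdd (NGet 6 (NVar i)) (NVar j)) f.
Definition pivot_at (y p : nat) : nexp := NGet 14 (NAdd (NGet 6 (NVar y)) (NVar p)).
Definition put_pivot (y p : nat) (e : nexp) : cmd :=
  NPut 14 (NAdd (NGet 6 (NVar y)) (NVar p)) e.
Definition off_pair (w : nat) : bexp :=
  BAnd (BNot (BEq (NVar w) (NVar 6))) (BNot (BEq (NVar w) (NVar 7))).

(* Integer registers: 3 main counter, 4 current node, 5 number of vertices still
   to be eliminated, 6 vertex being eliminated, 7 deferred row, 8 target node,
   9 leading column, 10 flag, 17 pivot row.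
   Integer arrays: 6 multiples of n, 7 bottom-up order of the nodes, 8 degrees,
   9 sums of neighbours, 10 parents, 11 homes of the vertices, 12 vertices by
   rank, 13 ranks, 14 deferred row by node and leading column, 15 partners in
   hyperbolic pairs; entries of 10, 11, 13, 14, 15 are shifted by one.
   Field array 2 is the matrix. *)
Definition find_leading : cmd :=
  Seq (NSet 10 (NConst 0))
  (for_bag 8 11 12 13
    (If (BAnd (BNot (BFZero (entry 7 13))) (BLt (NVar 10) (NGet 13 (NVar 13))))
      (Seq (NSet 10 (NGet 13 (NVar 13))) (NSet 9 (NVar 13)))
      Skip)).

Definition reduce_row : cmd :=
  Seq (FSet 0 (FDiv (entry 7 9) (entry 17 9)))
  (for_bag 8 11 12 13
    (Seq (put_entry 7 13 (FSub (entry 7 13) (FMul (FVar 0) (entry 17 13))))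
         (put_entry 13 7 (entry 7 13)))).

(** Gaussian reduction of one row. Register 10 is the loop condition: it is 0 both when the row has
    been stored as a pivot and when it has become zero. *)
Definition insert_row : cmd :=
  While (BLt (NConst 0) (NVar 10))
    (If (BEq (pivot_at 8 9) (NConst 0))
      (Seq (put_pivot 8 9 (NAdd (NVar 7) (NConst 1))) (NSet 10 (NConst 0)))
      (Seq (NSet 17 (NSub (pivot_at 8 9) (NConst 1)))
      (Seq reduce_row find_leading))).

Definition eliminate_pair : cmd :=
  Seq
  (for_bag 4 11 12 13 (If (off_pair 13)
    (for_bag 4 14 15 16 (If (off_pair 16)
      (put_entry 13 16 (FAdd (FAdd (entry 13 16)
        (FMul (FVar 0) (FMul (entry 13 7) (entry 7 16))))
        (FMul (FVar 1) (FAdd (FMul (entry 13 7) (entry 6 16))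
                             (FMul (entry 13 6) (entry 7 16))))))
      Skip)) Skip))
  (for_bag 4 11 12 13 (If (off_pair 13)
    (Seq (Seq (put_entry 13 6 FZero) (put_entry 6 13 FZero))
         (Seq (put_entry 13 7 FZero) (put_entry 7 13 FZero))) Skip)).

Definition prepare_pair : cmd :=
  Seq (NSet 7 (NSub (NVar 7) (NConst 1)))
  (Seq (put_pivot 4 6 (NConst 0))
  (Seq (FSet 0 (FDiv (entry 6 6) (FMul (entry 7 6) (entry 7 6))))
       (FSet 1 (FDiv (FSub FZero FOne) (entry 7 6))))).

Definition record_mates : cmd :=
  Seq (NPut 15 (NVar 6) (NAdd (NVar 7) (NConst 1)))
      (NPut 15 (NVar 7) (NAdd (NVar 6) (NConst 1))).

Definition split_at (i j : nat) : cmd :=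
  Seq (put_entry i i (FSub FZero
         (FDiv (FMul (entry i j) (entry i j)) (entry j j))))
  (Seq (put_entry i j FZero) (put_entry j i FZero)).

(** Setting register 7 to u itself lets [eliminate_pair], with second coefficient 0, perform the
    elimination by a single pivot; it also names the row that [find_leading] and [insert_row] treat
    when u is deferred. *)
Definition forget : cmd :=
  Seq (NSet 7 (pivot_at 4 6))
  (If (BLt (NConst 0) (NVar 7))
    (Seq prepare_pair
    (Seq eliminate_pair
      (If (BFZero (entry 6 6)) record_mates (split_at 7 6))))
    (Seq (NSet 7 (NVar 6))
      (If (BFZero (entry 6 6))
        (Seq (NSet 8 (NVar 4)) (Seq find_leading insert_row))
        (Seq (Seq (FSet 0 (FDiv (FSub FZero FOne) (entry 6 6))) (FSet 1 FZero))
             eliminate_pair)))).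

(** Register 9 is both the loop variable and the leading column expected by [insert_row], which may
    overwrite it: the loop reloads it from the bag. The 1 put in register 10 only says that there is
    a row to place. *)
Definition push_rows : cmd :=
  Seq (NSet 8 (NGet 10 (NVar 4)))
  (If (BLt (NConst 0) (NVar 8))
    (Seq (NSet 8 (NSub (NVar 8) (NConst 1)))
    (for_bag 4 18 19 9
      (Seq (NSet 7 (pivot_at 4 9))
      (If (BLt (NConst 0) (NVar 7))
        (Seq (Seq (NSet 7 (NSub (NVar 7) (NConst 1)))
             (Seq (put_pivot 4 9 (NConst 0)) (NSet 10 (NConst 1))))
             insert_row)
        Skip))))
    Skip).

Definition main_loop : cmd :=
  Seq (NSet 3 (NConst 0))
  (for_range 3 1
    (Seq (NSet 4 (NGet 7 (NVar 3)))
    (Seq (While (BAnd (BLt (NConst 0) (NVar 5))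
                      (BEq (NGet 11 (NGet 12 (NSub (NVar 5) (NConst 1))))
                           (NAdd (NVar 4) (NConst 1))))
           (Seq (Seq (NSet 5 (NSub (NVar 5) (NConst 1)))
                     (NSet 6 (NGet 12 (NVar 5))))
                forget))
         push_rows))).

(** * Correctness and cost of the elimination loop *)

Section Main.

Variables (F : fieldType) (n t : nat) (M : 'M[F]_n) (B : 'I_t -> {set 'I_n}).
Variables (bs : 'I_t -> seq 'I_n) (K : nat).
Variables (pos : 'I_t -> nat) (par : 'I_t -> option 'I_t).
Variables (home : 'I_n -> 'I_t) (rank : 'I_n -> nat).
Hypothesis eo : elim_order B pos par home rank.
Hypothesis bs_uniq : forall x, uniq (bs x).
Hypothesis mem_bs : forall x, bs x =i B x.
Hypothesis size_bs : forall x, (size (bs x) <= K)%N.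

Implicit Types (s : state F) (u v w r : 'I_n) (x y z : 'I_t).

Definition memory_mx s : 'M[F]_n := \matrix_(i, j) farr s 2 (i * n + j)%N.

(** What the preprocessing leaves for the main loop, which never writes these cells. Offsets are
    needed up to n + t since array 6 addresses both the rows of the matrix, indexed by vertices, and
    those of the pivot table, indexed by nodes. *)
Record env s : Prop := Env {
  env_t : nvar s 1 = t;
  env_bag : forall x, narr s 2 x.+1 = (narr s 2 x + size (bs x))%N;
  env_bags : forall x i (h : (i < size (bs x))%N),
    narr s 3 (narr s 2 x + i)%N = tnth (in_tuple (bs x)) (Ordinal h);
  env_off : forall i, (i <= n + t)%N -> narr s 6 i = (i * n)%N;
  env_node : forall x, narr s 7 (pos x) = x;
  env_par : forall x, narr s 10 x = oapp (fun y : 'I_t => y.+1) 0%N (par x);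
  env_home : forall v, narr s 11 v = (home v).+1;
  env_ord : forall v, narr s 12 (rank v) = v;
  env_rank : forall v, narr s 13 v = (rank v).+1 }.

Definition keeps_env (c : cmd) : bool :=
  ~~ writes_nvar c 1 && all (fun a => ~~ writes_narr c a) [:: 2; 3; 6; 7; 10; 11; 12; 13].

Lemma env_same c s s' : same c s s' -> keeps_env c -> env s -> env s'.
Proof.
move=> sm /andP[h1 /and5P[h2 h3 h6 h7 /and5P[h10 h11 h12 h13 _]]].
case=> *; split; by rewrite ?(same_nvar sm h1) ?(same_narr sm h2) ?(same_narr sm h3)
  ?(same_narr sm h6) ?(same_narr sm h7) ?(same_narr sm h10) ?(same_narr sm h11)
  ?(same_narr sm h12) ?(same_narr sm h13).
Qed.

Lemma run_same c s : loop_free c -> same c s (run c s).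
Proof. by move=> h; have [k /exec_same] := exec_run s h. Qed.

Lemma env_set_nvar s (a v : nat) : a != 1%N -> env s -> env (set_nvar s a v).
Proof.
move=> h; apply: env_same (_ : keeps_env (NSet a (NConst v))).
  exact: (run_same s (c := NSet a (NConst v))).
by rewrite /keeps_env /= andbT eq_sym.
Qed.

Lemma env_set_narr s (a i v : nat) : a \notin [:: 2; 3; 6; 7; 10; 11; 12; 13] ->
  env s -> env (set_narr s a i v).
Proof.
move=> h; apply: env_same (_ : keeps_env (NPut a (NConst i) (NConst v))).
  exact: (run_same s (c := NPut a (NConst i) (NConst v))).
apply/allP => z hz /=; by apply: contraNneq h => <-.
Qed.

Lemma memory_same c s s' : same c s s' -> ~~ writes_farr c 2 ->
  memory_mx s' = memory_mx s.
Proof. by move=> sm h; apply/matrixP=> i j; rewrite !mxE (same_farr sm h). Qed.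

Lemma offset_inj (a b : nat) (i j : 'I_n) :
  ((a * n + i)%N == (b * n + j)%N) = (a == b) && (i == j).
Proof.
apply/eqP/andP => [h|[/eqP-> /eqP->]] //.
have hn : (0 < n)%N by apply: leq_trans (ltn_ord i).
have : ((a * n + i) %/ n = (b * n + j) %/ n)%N by rewrite h.
rewrite !divnMDl // !divn_small // !addn0 => e; split; first exact/eqP.
by apply/eqP/val_inj/(@addnI (a * n)); rewrite h e.
Qed.

Lemma entryE s a i (u v : 'I_n) : env s -> nvar s a = u -> nvar s i = v ->
  feval s (entry a i) = memory_mx s u v.
Proof.
move=> es h1 h2; rewrite /= h1 h2 mxE env_off // ltnW //.
exact: leq_trans (ltn_ord u) (leq_addr _ _).
Qed.

Lemma put_entryE s a i (u v : 'I_n) f : env s -> nvar s a = u -> nvar s i = v ->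
  memory_mx (run (put_entry a i f) s) =
    \matrix_(k, l) if (k == u) && (l == v) then feval s f else memory_mx s k l.
Proof.
move=> es h1 h2; apply/matrixP=> k l; rewrite !mxE /= /upd /= h1 h2 (env_off es); last first.
  by rewrite ltnW //; exact: leq_trans (ltn_ord u) (leq_addr _ _).
by rewrite offset_inj.
Qed.

Definition bag_ok (x j e w : nat) (body : cmd) : bool :=
  [&& ~~ writes_nvar body j, ~~ writes_nvar body e, ~~ writes_narr body 3,
      e != j, w != j, w != e & x != j].

(** Kept apart from [env] because the bags are scanned already while homes and ranks are still being
    computed. *)
Definition bags_stored s : Prop :=
  (forall x, narr s 2 x.+1 = (narr s 2 x + size (bs x))%N) /\
  (forall x i (h : (i < size (bs x))%N),
    narr s 3 (narr s 2 x + i)%N = tnth (in_tuple (bs x)) (Ordinal h)).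

Lemma wp_stored_bag (a j e w : nat) body (I : seq 'I_n -> state F -> Prop) (d : nat)
   (Q : nat -> state F -> Prop) (m m' : nat) s x :
  bag_ok a j e w body -> bags_stored s -> nvar s a = x ->
  (forall l1 s1 (y v : nat), y \in [:: j; e; w] -> I l1 s1 -> I l1 (set_nvar s1 y v)) ->
  I [::] s ->
  (forall l1 v l2 s1, bs x = l1 ++ v :: l2 -> same (for_bag a j e w body) s s1 ->
     nvar s1 w = v -> I l1 s1 -> wp body (fun _ => I (rcons l1 v)) d s1) ->
  ((d + 10) * K + 23 + m' <= m)%N ->
  (forall s', same (for_bag a j e w body) s s' -> I (bs x) s' -> Q m' s') ->
  wp (for_bag a j e w body) Q m s.
Proof.
move=> /and5P[h1 h2 h3 h4 /and3P[h5 h6 h7]] [es1 es2] ha hst I0 hB hm hQ.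
have hsz : ((d + 10) * size (bs x) <= (d + 10) * K)%N by rewrite leq_mul2l size_bs orbT.
apply: (@wp_for_bag _ _ _ _ _ _ _
  (fun l1 m1 s1 => I l1 s1 /\ (10 + (d + 10) * (size (bs x) - size l1) + 3 + m' <= m1)%N)
  _ _ _ x (bs x)) => //; rewrite ?es1 //.
- by move=> l1 m1 s1 y v hy [hI hm1]; split=> //; apply: hst.
- by lia.
- by split=> //; rewrite /= subn0; lia.
- move=> l1 v l2 m1 s1 E sm hw [hI hm1].
  have e1 : (size (bs x) - size l1 = (size (bs x) - size (rcons l1 v)).+1)%N.
    by rewrite E size_cat size_rcons /=; lia.
  rewrite e1 mulnS in hm1.
  set X := ((d + 10) * (size (bs x) - _))%N in hm1 *.
  have -> : m1 = (d + (m1 - d))%N by lia.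
  apply: (wp_conseq (hB _ _ _ _ E sm hw hI)) => m2 s2 _ hI2; split=> //; lia.
- by move=> l1 m1 s1 [_ h]; apply: leq_trans h; rewrite -!addnA leq_addr.
- move=> m1 s1 sm [hI hm1]; exists m'; first by rewrite subnn muln0 in hm1; lia.
  exact: hQ.
Qed.

Lemma wp_bag (a j e w : nat) body (I : seq 'I_n -> state F -> Prop) (d : nat)
   (Q : nat -> state F -> Prop) (m m' : nat) s x :
  bag_ok a j e w body -> env s -> nvar s a = x ->
  (forall l1 s1 (y v : nat), y \in [:: j; e; w] -> I l1 s1 -> I l1 (set_nvar s1 y v)) ->
  I [::] s ->
  (forall l1 v l2 s1, bs x = l1 ++ v :: l2 -> same (for_bag a j e w body) s s1 ->
     nvar s1 w = v -> I l1 s1 -> wp body (fun _ => I (rcons l1 v)) d s1) ->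
  ((d + 10) * K + 23 + m' <= m)%N ->
  (forall s', same (for_bag a j e w body) s s' -> I (bs x) s' -> Q m' s') ->
  wp (for_bag a j e w body) Q m s.
Proof.
move=> hok es; apply: (@wp_stored_bag _ _ _ _ _ _ _ _ _ _ _ x hok).
by split; [exact: env_bag es|exact: (env_bags es)].
Qed.

Lemma wp_find_leading (Q : nat -> state F -> Prop) m m' s y r :
  env s -> nvar s 8 = y -> nvar s 7 = r ->
  (forall j, memory_mx s r j != 0 -> j \in B y) ->
  (40 * K + 40 + m' <= m)%N ->
  (forall s' o, same find_leading s s' -> leading rank r o (memory_mx s) ->
     nvar s' 10 = oapp (fun p => (rank p).+1) 0%N o ->
     (forall p, o = Some p -> nvar s' 9 = p) -> Q m' s') ->
  wp find_leading Q m s.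
Proof.
move=> es hy hr hsup hm hQ; set S := memory_mx s in hsup hQ.
apply: wp_seq; apply: (@wp_run _ _ _ _ _ (30 * K + 23 + m')) => //=; first by lia.
set s1 := set_nvar _ _ _.
have sm1 : same find_leading s s1 by apply: same_sub (run_same s (c := NSet 10 (NConst 0)) isT) => z //= ->.
have es1 := env_same sm1 isT es.
pose part (l : seq 'I_n) (o : option 'I_n) := if o is Some p then S r p != 0 /\
     (forall j, j \in l -> S r j != 0 -> (rank j <= rank p)%N)
  else forall j, j \in l -> S r j = 0.
apply: (@wp_bag _ _ _ _ _ (fun l1 s2 => exists o, [/\ part l1 o,
     nvar s2 10 = oapp (fun p => (rank p).+1) 0%N o &
     (forall p, o = Some p -> nvar s2 9 = p)]) 20 _ _ m' _ y) => //.
- by move=> l1 s2 z v; rewrite !inE => /or3P[]/eqP->.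
- by exists None; split.
- move=> l1 v l2 s2 E sm hv [o [h1 h2 h3]].
  have es2 := env_same sm isT es1.
  have h7 : nvar s2 7 = r by rewrite (same_nvar sm).
  have hS : memory_mx s2 = S by rewrite (memory_same sm).
  apply: (@wp_run _ _ _ _ _ 0) => //.
  have Eb : beval s2 (BAnd (BNot (BFZero (entry 7 13))) (BLt (NVar 10) (NGet 13 (NVar 13))))
     = (S r v != 0) && (nvar s2 10 < (rank v).+1)%N.
    rewrite -hS -(entryE es2 h7 hv) /= hv (env_rank es2); by [].
  rewrite [run _ _]/= -/(beval _ _) -/(neval _ _); move: Eb => /= ->.
  case: ifP => [/andP[c1 c2]|/negbT]; last first.
    rewrite negb_and negbK -leqNgt => c; exists o; split=> //.
    case: o h1 h2 h3 => [p|] /= h1 h2 h3.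
      case: h1 => h1 h1'; split=> // j; rewrite mem_rcons inE => /orP[/eqP->|/h1' //].
      by case/orP: c => [/eqP->|]; rewrite ?eqxx // h2.
    move=> j; rewrite mem_rcons inE => /orP[/eqP->|/h1 //].
    by case/orP: c => [/eqP//|]; rewrite h2.
  exists (Some v); split; last by move=> p [<-] /=; rewrite /upd /= hv.
    split=> // j; rewrite mem_rcons inE => /orP[/eqP->|hj] // nz.
    case: o h1 h2 {h3} => [p [_ h1] h2|h1 _]; last by rewrite h1 ?eqxx in nz.
    by apply: leq_trans (h1 _ hj nz) _; move: c2; rewrite h2 /= ltnS; apply: ltnW.
  by rewrite /= /upd /= hv (env_rank es2).
- move=> s' sm [o [h1 h2 h3]]; apply: (hQ _ o) => //.
    apply: same_trans sm1 _; apply: same_sub sm => z //= ->; by rewrite ?orbT.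
  case: o h1 {h2 h3} => [p [h1 h2]|h1] /=.
    by split=> // j nz; apply: h2 => //; rewrite mem_bs hsup.
  move=> j; apply/eqP/negPn/negP => nz.
  have hj : j \in bs y by rewrite mem_bs hsup.
  by rewrite (h1 _ hj) eqxx in nz.
Qed.

Lemma wp_reduce_row (Q : nat -> state F -> Prop) m m' s y r r' (p : 'I_n) :
  env s -> nvar s 8 = y -> nvar s 7 = r -> nvar s 17 = r' -> nvar s 9 = p -> r != r' ->
  let S := memory_mx s in
  symm S -> S r r = 0 -> S r r' = 0 -> S r' r = 0 -> S r' r' = 0 ->
  (forall j, S r j != 0 -> j \in B y) -> (forall j, S r' j != 0 -> j \in B y) ->
  (40 * K + 40 + m' <= m)%N ->
  (forall s', same reduce_row s s' ->
     memory_mx s' = reduce_mx S r r' (S r p / S r' p) -> Q m' s') ->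
  wp reduce_row Q m s.
Proof.
move=> es hy hr hr' hp nrr S sS z1 z2 z3 z4 sup sup' hm hQ; pose a := S r p / S r' p.
apply: wp_seq; apply: (@wp_run _ _ _ _ _ (40 * K + 23 + m')) => //; first by rewrite /=; lia.
have Ea : feval s (FDiv (entry 7 9) (entry 17 9)) = a.
  by rewrite /a -(entryE es hr hp) -(entryE es hr' hp).
rewrite [run _ _]/= -/(feval _ (FDiv (entry 7 9) (entry 17 9))).
set s1 := set_fvar _ _ _.
have f0 : fvar s1 0 = a by [].
have sm1 : same reduce_row s s1.
  by apply: same_sub (run_same s (c := FSet 0 (FDiv (entry 7 9) (entry 17 9))) isT) => z //= ->.
have es1 : env s1 := env_same sm1 isT es.
pose part (l : seq 'I_n) : 'M[F]_n := \matrix_(i, j) if (i == r) && (j \in l) then S r j - a * S r' j else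
    if (j == r) && (i \in l) then S r i - a * S r' i else S i j.
apply: (@wp_bag _ _ _ _ _ (fun l1 s2 => memory_mx s2 = part l1) 30 _ _ m' _ y) => //.
- by apply/matrixP=> i j; rewrite !mxE !in_nil !andbF.
- move=> l1 v l2 s2 E sm hv hS.
  have es2 := env_same sm isT es1.
  have h7 : nvar s2 7 = r by rewrite (same_nvar sm).
  have h17 : nvar s2 17 = r' by rewrite (same_nvar sm).
  have hf : fvar s2 0 = a by rewrite (same_fvar sm).
  have nv : v \notin l1.
    have := bs_uniq y; rewrite E cat_uniq /= negb_or => /and3P[_ /andP[] //].
  have nrr' : (r' == r) = false by rewrite eq_sym (negPf nrr).
  have Rv : memory_mx s2 r v = S r v.
    rewrite hS mxE eqxx (negPf nv) /=; case: (eqVneq v r) => //= e.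
    by rewrite -e (negPf nv).
  (* An eliminated vertex may still lie in the bag, so v can be r or r'. The in-place update is safe
     then because the entries among r and r' are all 0. *)
  have Rv' : memory_mx s2 r' v = S r' v.
    rewrite hS mxE nrr' /=; case: (eqVneq v r) => [->|] //=.
    by case: ifP; rewrite // z2 z3 z4 mulr0 subr0.
  apply: (@wp_run _ _ _ _ _ 0) => //.
  pose c1 := put_entry 7 13 (FSub (entry 7 13) (FMul (FVar 0) (entry 17 13))).
  have sm3 : same c1 s2 (run c1 s2) by apply: run_same.
  have es3 := env_same sm3 isT es2.
  have E3 : memory_mx (run c1 s2) = \matrix_(k, l) if (k == r) && (l == v)
      then S r v - a * S r' v else memory_mx s2 k l.
    rewrite (put_entryE _ es2 h7 hv) -Rv -Rv' -hf.
    by rewrite -(entryE es2 h7 hv) -(entryE es2 h17 hv).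
  change (memory_mx (run (put_entry 13 7 (entry 7 13)) (run c1 s2)) = part (rcons l1 v)).
  have h7' : nvar (run c1 s2) 7 = r by rewrite (same_nvar sm3).
  have hv' : nvar (run c1 s2) 13 = v by rewrite (same_nvar sm3).
  rewrite (put_entryE _ es3 hv' h7') (entryE es3 h7' hv') E3 hS.
  apply/matrixP=> i j; rewrite !mxE !mem_rcons !inE !eqxx /=.
  case: (eqVneq i v) => [->|iv]; case: (eqVneq j r) => [->|jr];
  rewrite ?andbT ?andbF ?eqxx //=.
  + by case: (eqVneq v r) => [->|]; rewrite ?eqxx.
  + case: (eqVneq v r) => [evr|] //=; by rewrite evr; case: (eqVneq j r) jr.
  + case: (eqVneq i r) => [eir|] //=; case: (eqVneq r v) => [erv|] //=.
    by move: iv; rewrite eir erv eqxx.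
  + by case: (eqVneq i r) => [eir|] //=; case: (eqVneq j v) => [ejv|]; rewrite ?ejv.
- move=> s' sm hS; apply: hQ.
    apply: same_trans sm1 _; apply: same_sub sm => z //= ->; by rewrite ?orbT.
  rewrite hS; clearbody S; apply/matrixP=> i j; rewrite !mxE !mem_bs.
  have far k : k \notin B y -> S r k - a * S r' k = S r k.
    move=> hk; have -> : S r' k = 0 by apply/eqP; apply: contraNT hk => /sup'.
    by rewrite mulr0 subr0.
  have far' k : k \notin B y -> S r k = 0.
    by move=> hk; apply/eqP; apply: contraNT hk => /sup.
  case: (eqVneq i r) => [->|ir] /=.
    case: ifP => // /negbT => jB; rewrite (far _ jB).
    case: ifP => [/andP[/eqP-> _]|_] //.
    by rewrite z1 z3 mulr0 subr0.
  case: (eqVneq j r) => [->|] //=; case: ifP => // /negbT => iB.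
  by rewrite (far _ iB) sS.
Qed.

Lemma beval_off_pair s a v u r : nvar s a = v -> nvar s 6 = u -> nvar s 7 = r ->
  beval s (off_pair a) = (v \notin [:: r; u]).
Proof. by move=> h1 h2 h3; rewrite /= h1 h2 h3 !inE negb_or andbC. Qed.

(** The update can be done in place: new values are computed from the rows and columns of r and u,
    which [off_pair] leaves alone, and every other position is visited once because bags have no
    repetitions. *)
Lemma wp_update_pairs (Q : nat -> state F -> Prop) m m' s x u r :
  env s -> nvar s 4 = x -> nvar s 6 = u -> nvar s 7 = r ->
  let S := memory_mx s in
  let body := for_bag 4 11 12 13 (If (off_pair 13)
    (for_bag 4 14 15 16 (If (off_pair 16)
      (put_entry 13 16 (FAdd (FAdd (entry 13 16)
        (FMul (FVar 0) (FMul (entry 13 7) (entry 7 16))))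
        (FMul (FVar 1) (FAdd (FMul (entry 13 7) (entry 6 16))
                             (FMul (entry 13 6) (entry 7 16))))))
      Skip)) Skip) in
  (80 * (K * K) + 50 * K + 23 + m' <= m)%N ->
  (forall s', same body s s' -> memory_mx s' = \matrix_(i, j)
     (if [&& i \notin [:: r; u], j \notin [:: r; u], i \in bs x & j \in bs x]
      then S i j + fvar s 0 * (S i r * S r j) + fvar s 1 * (S i r * S u j + S i u * S r j)
      else S i j) -> Q m' s') ->
  wp body Q m s.
Proof.
move=> es hx hu hr S body hm hQ.
pose new i j := S i j + fvar s 0 * (S i r * S r j)
                + fvar s 1 * (S i r * S u j + S i u * S r j).
pose part (P : rel 'I_n) : 'M[F]_n := \matrix_(i, j)
   if [&& i \notin [:: r; u], j \notin [:: r; u] & P i j] then new i j else S i j.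
have eq_part P P' : P =2 P' -> part P = part P'.
  by move=> h; apply/matrixP=> i j; rewrite !mxE h.
apply: (@wp_bag _ _ _ _ _ (fun l1 s1 => memory_mx s1 =
  part (fun i j => (i \in l1) && (j \in bs x))) (80 * K + 40)%N _ _ m' _ x) => //.
- by apply/matrixP=> i j; rewrite !mxE in_nil !andbF.
- move=> l1 v l2 s1 E sm hv hS.
  have es1 := env_same sm isT es.
  have h6 : nvar s1 6 = u by rewrite (same_nvar sm).
  have h7 : nvar s1 7 = r by rewrite (same_nvar sm).
  have f0 : fvar s1 0 = fvar s 0 by rewrite (same_fvar sm).
  have f1 : fvar s1 1 = fvar s 1 by rewrite (same_fvar sm).
  have nv : v \notin l1.
    have := bs_uniq x; rewrite E cat_uniq /= negb_or => /and3P[_ /andP[] //].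
  apply: (@wp_if _ _ _ _ _ _ _ (80 * K + 25)%N); first by rewrite /=; lia.
    rewrite (beval_off_pair hv h6 h7) => offv.
    apply: (@wp_bag _ _ _ _ _ (fun l3 s2 => memory_mx s2 =
       part (fun i j => ((i \in l1) && (j \in bs x)) || ((i == v) && (j \in l3))))
       70 _ _ 2 _ x) => //.
    + by rewrite (same_nvar sm).
    + rewrite hS; apply: eq_part => i j; by rewrite andbF orbF.
    + move=> l3 w l4 s2 E' sm' hw hS'.
      have es2 := env_same sm' isT es1.
      have h6' : nvar s2 6 = u by rewrite (same_nvar sm').
      have h7' : nvar s2 7 = r by rewrite (same_nvar sm').
      have hv' : nvar s2 13 = v by rewrite (same_nvar sm').
      have f0' : fvar s2 0 = fvar s 0 by rewrite (same_fvar sm').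
      have f1' : fvar s2 1 = fvar s 1 by rewrite (same_fvar sm').
      have nw : w \notin l3.
        have := bs_uniq x; rewrite E' cat_uniq /= negb_or => /and3P[_ /andP[] //].
      apply: (@wp_run _ _ _ _ _ 0) => //.
      have -> : forall b c, run (If b c Skip) s2 = if beval s2 b then run c s2 else s2 by [].
      rewrite (beval_off_pair hw h6' h7'); case: ifP => offw; last first.
        rewrite hS'; apply/matrixP=> i j; rewrite !mxE mem_rcons inE.
        case: (eqVneq j w) => [->|//]; by rewrite offw !andbF.
      rewrite (put_entryE _ es2 hv' hw).
      have -> : feval s2 (FAdd (FAdd (entry 13 16)
        (FMul (FVar 0) (FMul (entry 13 7) (entry 7 16))))
        (FMul (FVar 1) (FAdd (FMul (entry 13 7) (entry 6 16))
                             (FMul (entry 13 6) (entry 7 16))))) = new v w.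
        transitivity (memory_mx s2 v w + fvar s2 0 * (memory_mx s2 v r * memory_mx s2 r w)
           + fvar s2 1 * (memory_mx s2 v r * memory_mx s2 u w
                          + memory_mx s2 v u * memory_mx s2 r w)).
          by rewrite -(entryE es2 hv' hw) -(entryE es2 hv' h7') -(entryE es2 h7' hw)
            -(entryE es2 h6' hw) -(entryE es2 hv' h6').
        rewrite f0' f1' hS' /new !mxE !inE !eqxx ?orbT /= ?andbF /=.
        by rewrite (negPf nv) (negPf nw) /= ?andbF.
      rewrite hS'; apply/matrixP=> i j; rewrite !mxE mem_rcons in_cons.
      case: (eqVneq i v) => [->|iv]; case: (eqVneq j w) => [->|jw] //=.
      by rewrite offv offw orbT.
    + by lia.
    + move=> s2 sm2 hS2; rewrite hS2; apply: eq_part => i j.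
      by rewrite mem_rcons inE -andb_orl orbC.
  rewrite (beval_off_pair hv h6 h7) => offv; apply: (@wp_run _ _ _ _ _ 0); rewrite //=; first by lia.
  rewrite hS; apply/matrixP=> i j; rewrite !mxE mem_rcons inE.
  by case: (eqVneq i v) => [->|//]; rewrite (negPf offv).
- by nia.
Qed.

(** Outside the bag the columns r and u vanish away from the block, so the Schur complement changes
    nothing there and the two loops over the bag produce the whole of [elim_mx]. *)
Lemma wp_eliminate_pair (Q : nat -> state F -> Prop) m m' s x u r :
  env s -> nvar s 4 = x -> nvar s 6 = u -> nvar s 7 = r ->
  let S := memory_mx s in symm S ->
  (forall w, w \notin [:: r; u] -> w \notin B x -> S w r = 0 /\ S w u = 0) ->
  (80 * (K * K) + 100 * K + 50 + m' <= m)%N ->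
  (forall s', same eliminate_pair s s' ->
     memory_mx s' = elim_mx S r u (fvar s 0) (fvar s 1) -> Q m' s') ->
  wp eliminate_pair Q m s.
Proof.
move=> es hx hu hr S sS hsup hm hQ.
apply: wp_seq; apply: (@wp_update_pairs _ _ (50 * K + 23 + m')%N _ x u r) => //.
  by lia.
rewrite -/S => s1 sm1 hS1.
have sm1' : same eliminate_pair s s1 by apply: same_sub sm1 => z //= ->; rewrite ?orbT.
have es1 := env_same sm1' isT es.
set T := \matrix_(i, j) _ in hS1.
pose part (l : seq 'I_n) : 'M[F]_n := \matrix_(i, j)
   if [&& i \notin [:: r; u], j \in [:: r; u] & i \in l] ||
      [&& j \notin [:: r; u], i \in [:: r; u] & j \in l] then 0 else T i j.
apply: (@wp_bag _ _ _ _ _ (fun l1 s2 => memory_mx s2 = part l1) 40 _ _ m' _ x) => //.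
- by rewrite (same_nvar sm1').
- by rewrite hS1; apply/matrixP=> i j; rewrite [RHS]mxE !in_nil !andbF.
- move=> l1 v l2 s2 E sm hv hS.
  have es2 := env_same sm isT es1.
  have h6 : nvar s2 6 = u by rewrite (same_nvar sm) // (same_nvar sm1').
  have h7 : nvar s2 7 = r by rewrite (same_nvar sm) // (same_nvar sm1').
  apply: (@wp_run _ _ _ _ _ 0) => //.
  have -> : forall b c, run (If b c Skip) s2 = if beval s2 b then run c s2 else s2 by [].
  rewrite (beval_off_pair hv h6 h7); case: ifP => offv; last first.
    rewrite hS; apply/matrixP=> i j; rewrite !mxE !mem_rcons ![_ \in v :: _]in_cons.
    case: (eqVneq i v) => [->|_]; case: (eqVneq j v) => [->|_]; rewrite ?offv //=.
  have -> : forall c1 c2 c3 c4, run (Seq (Seq c1 c2) (Seq c3 c4)) s2 =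
    run c4 (run c3 (run c2 (run c1 s2))) by [].
  have smp a b s3 : same (put_entry a b FZero) s3 (run (put_entry a b FZero) s3).
    by apply: run_same.
  have esp a b s3 : env s3 -> env (run (put_entry a b FZero) s3).
    by apply: env_same (smp a b s3) isT.
  have rg a b s3 k : nvar (run (put_entry a b FZero) s3) k = nvar s3 k by [].
  rewrite (put_entryE FZero (esp _ _ _ (esp _ _ _ (esp _ _ _ es2))) h7 hv).
  rewrite (put_entryE FZero (esp _ _ _ (esp _ _ _ es2)) hv h7).
  rewrite (put_entryE FZero (esp _ _ _ es2) h6 hv) (put_entryE FZero es2 hv h6).
  have -> : forall s3, feval s3 FZero = 0 by [].
  rewrite hS; apply/matrixP=> i j; rewrite !mxE !mem_rcons.
  rewrite ![_ \in _ :: _]in_cons !in_nil !orbF.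
  have [/negPf vr /negPf vu] : v != r /\ v != u.
    by move: offv; rewrite !inE negb_or => /andP.
  case: (eqVneq i v) => [->|iv]; case: (eqVneq j v) => [->|jv] /=;
    rewrite ?vr ?vu ?andbF ?andbT ?orbF //=.
  + by case: (j == r); case: (j == u).
  + by case: (i == r); case: (i == u).
- move=> s' sm hS; apply: hQ.
    apply: same_trans sm1' _; apply: same_sub sm => z //= ->; by rewrite ?orbT.
  rewrite hS /part /T; clearbody S; apply/matrixP=> i j; rewrite !mxE !mem_bs.
  case: (boolP (i \in [:: r; u])) => hi; case: (boolP (j \in [:: r; u])) => hj //=.
  + case: ifP => // /negbT h; have [e1 e2] := hsup _ hj h.
    by move: hi; rewrite !inE => /orP[/eqP->|/eqP->]; rewrite sS.
  + rewrite orbF; case: ifP => // /negbT h; have [e1 e2] := hsup _ hi h.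
    by move: hj; rewrite !inE => /orP[/eqP->|/eqP->].
  + case: (boolP (i \in B x)) => hiB /=; last first.
      by have [-> ->] := hsup _ hi hiB; rewrite !(mul0r, mulr0, addr0).
    case: (boolP (j \in B x)) => hjB //=.
    have [e1 e2] := hsup _ hj hjB.
    by rewrite (sS r j) (sS u j) e1 e2 !(mul0r, mulr0, addr0).
Qed.

Implicit Types (loc own : 'I_n -> option ('I_t * 'I_n)) (o : option 'I_n) (p q : 'I_n).

(** A cell holds at most one row, so the table itself enforces the echelon form: distinct rows at a
    node have distinct leading columns. *)
Definition table (T : nat -> nat) loc : Prop :=
  (forall y p, T (y * n + p)%N = 0%N \/
     exists2 r : 'I_n, T (y * n + p)%N = r.+1 & loc r = Some (y, p)) /\
  (forall r y p, loc r = Some (y, p) -> T (y * n + p)%N = r.+1).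

Lemma table_ext T loc loc' : loc =1 loc' -> table T loc -> table T loc'.
Proof.
move=> h [h1 h2]; split=> [y p|r y p]; last by rewrite -h; apply: h2.
by have [|[r e1 e2]] := h1 y p; [left|right; exists r; rewrite -?h].
Qed.

Lemma table_inj T loc r r' y p : table T loc ->
  loc r = Some (y, p) -> loc r' = Some (y, p) -> r = r'.
Proof. by case=> _ h /h e /h; rewrite e => -[] /val_inj. Qed.

Lemma table_put T loc r y p : table T loc -> loc r = None -> T (y * n + p)%N = 0%N ->
  table (upd T (y * n + p) r.+1) (set_own loc r (Some (y, p))).
Proof.
move=> [h1 h2] Er ET; split=> [z q|r' z q]; rewrite /upd offset_inj.
  case: ifP => [/andP[/eqP/val_inj -> /eqP ->]|_].
    by right; exists r; rewrite ?set_own_eq.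
  have [|[r' e1 e2]] := h1 z q; first by left.
  by right; exists r'; rewrite // set_own_neq //; apply/eqP => e; rewrite e Er in e2.
rewrite /set_own; case: (r' =P r) => [-> [<- <-]|_ E]; first by rewrite !eqxx.
case: ifP => [/andP[/eqP/val_inj ez /eqP eq]|_]; last exact: h2.
by move: (h2 _ _ _ E); rewrite ez eq ET.
Qed.

Lemma table_clear T loc r y p : table T loc -> loc r = Some (y, p) ->
  table (upd T (y * n + p) 0) (set_own loc r None).
Proof.
move=> tb Er; have [h1 h2] := tb; split=> [z q|r' z q]; rewrite /upd offset_inj.
  case: ifP => [_|ne]; first by left.
  have [|[r' e1 e2]] := h1 z q; first by left.
  right; exists r'; rewrite // set_own_neq //; apply/eqP => e; move: e2 ne.
  by rewrite e Er => -[-> ->]; rewrite !eqxx.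
rewrite /set_own; case: (r' =P r) => [//|ne E].
case: ifP => [/andP[/eqP/val_inj ez /eqP eq]|_]; last exact: h2.
by case: ne; apply: (table_inj tb) E _; rewrite ez eq.
Qed.

(** There are two owner maps: own is the one of the invariant, loc the one stored in memory. They
    differ while a row has left its cell and waits to be inserted, and while the rows of a node are
    on their way to its parent. *)
Record good s own loc (cnt i : nat) : Prop := Good {
  good_env : env s;
  good_inv : invariant B pos rank own (memory_mx s) cnt (narr s 15) i;
  good_congruent : congruent M (memory_mx s);
  good_table : table (narr s 14) loc }.

Lemma invariant_ext own own' (S : 'M[F]_n) cnt mate i : own =1 own' ->
  invariant B pos rank own S cnt mate i -> invariant B pos rank own' S cnt mate i.
Proof.
move=> h [h1 h2 h3 h4]; split=> // r; first by move=> y p; rewrite -h; apply: h3.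
by move=> hr; rewrite -h; apply: h4.
Qed.

Lemma potential_ext own own' : own =1 own' ->
  potential rank K.+1 own = potential rank K.+1 own'.
Proof.
move=> h; have ep y : pivots own y = pivots own' y.
  by apply/setP => q; rewrite !inE; apply: eq_existsb => r; rewrite h.
apply: eq_bigr => r _; rewrite /weight h; case: (own' r) => [[y p]|] //.
by rewrite /later_pivots ep.
Qed.

Lemma good_ext s own own' loc loc' cnt i : own =1 own' -> loc =1 loc' ->
  good s own loc cnt i -> good s own' loc' cnt i.
Proof.
move=> h1 h2 [g1 g2 g3 g4]; split=> //; first exact: invariant_ext h1 g2.
exact: table_ext h2 g4.
Qed.

Lemma card_bag x : (#|B x| <= K)%N.
Proof.
rewrite -(eq_card (mem_bs x)); have /card_uniqP -> := bs_uniq x; exact: size_bs.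
Qed.

Lemma later_pivots_le own (S : 'M[F]_n) cnt mate i y p :
  invariant B pos rank own S cnt mate i -> (later_pivots rank own y p < K.+1)%N.
Proof.
move=> inv; rewrite ltnS; apply: leq_trans (card_bag y); apply: subset_leq_card.
apply/subsetP => q; rewrite inE => /andP[/pivotsP[r Er] _].
by have [_ _ h1 h2] := inv_own inv Er; have [] := h2 _ h1.
Qed.

(** Leading columns inject the rows deferred at x into its bag. *)
Lemma rows_at_node T own (S : 'M[F]_n) cnt mate i x :
  invariant B pos rank own S cnt mate i -> table T own ->
  (#|[set w | if own w is Some (z, _) then z == x else false]| <= K)%N.
Proof.
move=> inv tb; apply: leq_trans (card_bag x).
pose f w := if own w is Some (_, p) then p else w.
rewrite -(card_in_imset (f := f)).
  apply: subset_leq_card; apply/subsetP => q /imsetP[w]; rewrite inE /f.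
  case E: (own w) => [[z p]|] // /eqP zx ->; rewrite -zx.
  by have [_ _ h1 h2] := inv_own inv E; have [] := h2 _ h1.
move=> w w'; rewrite !inE /f; case E: (own w) => [[z p]|] // /eqP zx.
case E': (own w') => [[z' p']|] // /eqP zx' pp'; apply: (table_inj tb) E _.
by rewrite E' zx zx' pp'.
Qed.

(** The price of one unit of potential, that is of one pass of [insert_row]: [reduce_row] and
    [find_leading] take at most 40K + 40 steps each, and the rest covers tests and register
    moves. *)
Definition row_cost : nat := (80 * K + 120)%N.

Definition funds own : nat := (row_cost * potential rank K.+1 own)%N.

Lemma pivot_atE s a i y p : env s -> nvar s a = y -> nvar s i = p ->
  neval s (pivot_at a i) = narr s 14 (y * n + p)%N.
Proof.
move=> es /= -> ->; rewrite (env_off es) //; apply: ltnW.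
exact: leq_trans (ltn_ord y) (leq_addl _ _).
Qed.

Lemma run_put_pivot s a i e y p : env s -> nvar s a = y -> nvar s i = p ->
  run (put_pivot a i e) s = set_narr s 14 (y * n + p) (neval s e).
Proof.
move=> es /= -> ->; rewrite (env_off es) //; apply: ltnW.
exact: leq_trans (ltn_ord y) (leq_addl _ _).
Qed.

Lemma switch_set x y loc r o :
  switch x y (set_own loc r (omap (pair y) o)) =1
  set_own (switch x y loc) r (omap (pair y) o).
Proof.
move=> q; rewrite /switch /set_own; case: (q == r) => //.
by case: o => //= p; rewrite if_same.
Qed.

(** Serves both callers: when a row is deferred, y is x and [switch] is the identity; when rows are
    pushed up, those still in the cells of x already count as owned by the parent y. *)
Lemma wp_insert_row (Q : nat -> state F -> Prop) m m' s x y r o loc cnt i :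
  good s (set_own (switch x y loc) r (omap (pair y) o)) loc cnt i ->
  loc r = None -> nvar s 7 = r -> nvar s 8 = y ->
  (nvar s 10 == 0%N) = ~~ isSome o -> (forall p, o = Some p -> nvar s 9 = p) ->
  (funds (set_own (switch x y loc) r (omap (pair y) o)) + 40 + m' <= m)%N ->
  (forall s' o' m2, same insert_row s s' ->
     good s' (set_own (switch x y loc) r (omap (pair y) o'))
             (set_own loc r (omap (pair y) o')) cnt i ->
     (funds (set_own (switch x y loc) r (omap (pair y) o')) + m' <= m2)%N -> Q m2 s') ->
  wp insert_row Q m s.
Proof.
move=> g0 Er h7 h8 h10 h9 hm hQ.
pose own o1 := set_own (switch x y loc) r (omap (pair y) o1).
rewrite -/(own o) in g0 hm.
(* While register 10 is nonzero the row is in no cell of the table. Of the credits, 3 pay for the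
   failing test, 40 for the pass that stores the row and the tests around it; reductions are paid by
   [funds]. *)
apply: (@wp_while _ _ _ (fun m1 s1 => exists o1,
  [/\ good s1 (own o1) (if nvar s1 10 == 0%N then set_own loc r (omap (pair y) o1) else loc) cnt i,
      nvar s1 10 == 0%N \/ (exists2 p, o1 = Some p & nvar s1 9 = p)
    & (funds (own o1) + (if nvar s1 10 == 0%N then 3 else 40) + m' <= m1)%N])).
- exists o; split; last by case: ifP; lia.
    rewrite h10; case: o g0 {h10 h9 hm} => //= g0; apply: good_ext g0 => // q.
    by rewrite /set_own; case: eqP => // ->.
  rewrite h10; case: o h9 {h10 hm g0} => [p|] h9 /=; last by left.
  by right; exists p => //; apply: h9.
- move=> m1 s1 sm [o1 [g hp hm1]] /=; rewrite lt0n => nz.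
  rewrite (negPf nz) in g hm1; case: hp => [hp|[p Eo h9']]; first by rewrite hp in nz.
  have [es inv cg tb] := g.
  have s7 : nvar s1 7 = r by rewrite (same_nvar sm).
  have s8 : nvar s1 8 = y by rewrite (same_nvar sm).
  exists (m1 - 3)%N; first by lia.
  have own_r : own o1 r = Some (y, p) by rewrite /own set_own_eq Eo.
  have ep := pivot_atE es s8 h9'.
  have eb : beval s1 (BEq (pivot_at 8 9) (NConst 0)) = (narr s1 14 (y * n + p) == 0)%N.
    by rewrite -ep.
  apply: (@wp_if _ _ _ _ _ _ _ (m1 - 10)%N); first by rewrite /=; lia.
    rewrite eb => /eqP ET.
    apply: (@wp_run _ _ _ _ _ (funds (own o1) + 3 + m')%N) => //; first by rewrite /=; lia.
    exists o1; split=> //; last by left.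
    have -> : run (Seq (put_pivot 8 9 (NAdd (NVar 7) (NConst 1))) (NSet 10 (NConst 0))) s1 =
      set_nvar (set_narr s1 14 (y * n + p) r.+1) 10 0.
      have e1 := run_put_pivot (NAdd (NVar 7) (NConst 1)) es s8 h9'.
      have e2 : neval s1 (NAdd (NVar 7) (NConst 1)) = r.+1 by rewrite /= s7 addn1.
      by rewrite -e2 -e1.
    rewrite [nvar _ _]/= {1}/upd /= Eo; split=> //.
    + by apply: env_same es; [|exact: (erefl true : keeps_env
        (Seq (NPut 14 (NConst 0) (NConst 0)) (NSet 10 (NConst 0))))];
      split=> z //=; rewrite /upd; case: (z == _).
    + by rewrite -Eo.
    + by rewrite /= /upd /=; apply: table_put.
  rewrite eb => NT.
  have [ET|[r' ET Er']] := tb.1 y p; first by rewrite ET in NT.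
  have rr' : r != r' by apply/eqP => e; rewrite -e Er in Er'.
  have own_r' : own o1 r' = Some (y, p).
    rewrite /own set_own_neq 1?eq_sym // /switch Er' /=; by case: ifP.
  apply: wp_seq; apply: (@wp_run _ _ _ _ _ (m1 - 18)%N) => //; first by rewrite /=; lia.
  have -> : run (NSet 17 (NSub (pivot_at 8 9) (NConst 1))) s1 = set_nvar s1 17 r'.
    have -> : nat_of_ord r' = (neval s1 (pivot_at 8 9) - 1)%N by rewrite ep ET subn1.
    by [].
  set s2 := set_nvar _ _ _.
  have sm2 : same insert_row s1 s2 by split=> //= z; rewrite /upd; case: (z =P 17%N) => // ->.
  have es2 := env_same sm2 isT es.
  have mem2 : memory_mx s2 = memory_mx s1 by [].
  have [dr _ hrp hr] := inv_own inv own_r; have [dr' _ hrp' hr'] := inv_own inv own_r'.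
  have z1 := inv_own_dead inv own_r dr; have z2 := inv_own_dead inv own_r dr'.
  have z3 := inv_own_dead inv own_r' dr; have z4 := inv_own_dead inv own_r' dr'.
  (* The row r is deferred and so has positive weight: the funds contain the price of this pass. *)
  have hdec : (potential rank K.+1 (own o1) > 0)%N.
    rewrite /potential (bigD1 r) //= ltn_addr // /weight own_r subn_gt0.
    exact: later_pivots_le inv.
  have hm2 : (row_cost + 40 + m' <= m1)%N.
    apply: leq_trans hm1; rewrite !leq_add2r /funds leq_pmulr //.
  apply: wp_seq; apply: (@wp_reduce_row _ _ (m1 - (40 * K + 58))%N _ y r r' p) => //.
  + exact: inv_symm inv.
  + by move=> j; rewrite mem2 => /hr [].
  + by move=> j; rewrite mem2 => /hr' [].
  + by rewrite /row_cost in hm2; lia.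
  rewrite mem2 => s3 sm3 hS3; have es3 := env_same sm3 isT es2.
  have hS3' j : memory_mx s3 r j != 0 -> j \in B y.
    rewrite hS3 mxE eqxx => nz'; have [e|/hr[]//] := eqVneq (memory_mx s1 r j) 0.
    have [e'|/hr'[]//] := eqVneq (memory_mx s1 r' j) 0.
    by rewrite e e' mulr0 subr0 eqxx in nz'.
  apply: (@wp_find_leading _ _ (m1 - row_cost)%N _ y r) => //.
  + by rewrite (same_nvar sm3).
  + by rewrite (same_nvar sm3).
  + by rewrite /row_cost in hm2 *; lia.
  move=> s4 o2 sm4 hl h10' h9''.
  have es4 := env_same sm4 isT es3.
  have mem4 : memory_mx s4 = memory_mx s3 by rewrite (memory_same sm4).
  rewrite hS3 in hl.
  have [inv4 hlt] := inv_reduce eo inv rr' own_r own_r' hl.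
  have hpot := potential_reduce rr' own_r own_r' (later_pivots_le y p inv) hlt.
  have eown : set_own (own o1) r (omap (pair y) o2) =1 own o2.
    by move=> q; rewrite /own /set_own; case: eqP.
  have n14 : narr s4 14 = narr s1 14 by rewrite (same_narr sm4) // (same_narr sm3).
  have n15 : narr s4 15 = narr s1 15 by rewrite (same_narr sm4) // (same_narr sm3).
  exists o2; split.
  + split=> //.
    * by apply: invariant_ext eown _; rewrite mem4 hS3 n15.
    * rewrite mem4 hS3; apply: congruent_trans cg _.
      exact: reduce_mx_congruent inv rr' own_r own_r'.
    rewrite n14 h10'; case: o2 {hl inv4 hlt hpot eown h9'' h10'} => //=.
    by apply: table_ext tb => q; rewrite /set_own; case: eqP => // ->.
  + case: o2 h9'' h10' {hl inv4 hlt hpot eown} => [q|] h h10'; last by left; rewrite h10'.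
    by right; exists q => //; apply: h.
  + rewrite (potential_ext eown) in hpot.
    have : (funds (own o2) + row_cost <= funds (own o1))%N.
      by rewrite /funds addnC -mulnS leq_mul2l hpot orbT.
    case: ifP; lia.
- move=> m1 s1 sm [o1 [g hp hm1]] /=; rewrite -eqn0Ngt => z.
  rewrite z in g hm1; exists (m1 - 3)%N; first by lia.
  by apply: (hQ _ o1) => //; rewrite -/(own o1); lia.
Qed.

(** The last term buys the rise of the potential, at most K + 1 units when a row is deferred and at
    most K when a pair is eliminated; the other terms are the elimination itself. *)
Definition forget_cost : nat := (80 * (K * K) + 150 * K + 300 + row_cost * K.+1)%N.

Lemma funds_le own own' d : (potential rank K.+1 own' <= potential rank K.+1 own + d)%N ->
  (funds own' <= funds own + row_cost * d)%N.
Proof. by move=> h; rewrite /funds -mulnDr leq_mul2l h orbT. Qed.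

Lemma memory_split_at s a b r u : env s -> nvar s a = r -> nvar s b = u -> r != u ->
  memory_mx (run (split_at a b) s) = split_pair (memory_mx s) r u.
Proof.
move=> es ha hb nru; pose f := FSub FZero (FDiv (FMul (entry a b) (entry a b)) (entry b b)).
have -> : run (split_at a b) s =
  run (put_entry b a FZero) (run (put_entry a b FZero) (run (put_entry a a f) s)) by [].
have es' i j g s' : env s' -> env (run (put_entry i j g) s').
  by apply: (env_same (run_same s' (c := put_entry i j g) isT)).
rewrite (@put_entryE _ _ _ u r FZero (es' _ _ _ _ (es' _ _ _ _ es))) //.
rewrite (@put_entryE _ _ _ r u FZero (es' _ _ _ _ es)) //.
rewrite (@put_entryE _ _ _ r r f es) //.
have -> : feval s f = 0 - memory_mx s r u * memory_mx s r u / memory_mx s u u.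
  by rewrite -(entryE es ha hb) -(entryE es hb hb).
have e0 s' : feval s' FZero = 0 by [].
rewrite !e0; move: (memory_mx s) => S; apply/matrixP=> i j; rewrite !mxE.
case: (eqVneq i r) => [->|ir]; case: (eqVneq j r) => [->|jr];
  rewrite ?eqxx ?(negPf nru) ?andbF ?andbT /= ?orbF //.
Qed.

Lemma wp_forget_pair (Q : nat -> state F -> Prop) m m' s x u r own cnt :
  good s own own cnt.+1 (pos x) -> nvar s 4 = x -> nvar s 6 = u -> nvar s 7 = r.+1 ->
  rank u = cnt -> home u = x -> own r = Some (x, u) ->
  (funds own + row_cost * K + (80 * (K * K) + 100 * K + 200) + m' <= m)%N ->
  (forall s' own' m2, good s' own' own' cnt (pos x) ->
     (funds own' + m' <= m2)%N -> Q m2 s') ->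
  wp (Seq prepare_pair (Seq eliminate_pair
      (If (BFZero (entry 6 6)) record_mates (split_at 7 6)))) Q m s.
Proof.
move=> [es inv cg tb] h4 h6 h7 ru hu Er hm hQ.
have px : pos (home u) = pos x by rewrite hu.
have Er' : own r = Some (home u, u) by rewrite hu.
have uniq_r w : own w = Some (home u, u) -> w = r.
  by move=> E; apply: (table_inj tb E Er').
have sS := inv_symm inv.
have nru : r != u := pair_neq inv ru px Er'.
apply: wp_seq; apply: (@wp_run _ _ _ _ _ (m - 60)%N) => //; first by rewrite /=; lia.
have sm1 := run_same s (c := prepare_pair) isT.
set s1 := run _ s in sm1 *.
have es1 := env_same sm1 isT es.
have s14 : narr s1 14 = upd (narr s 14) (x * n + u) 0%N.
  have -> : narr s1 14 = upd (narr s 14) (narr s 6 (nvar s 4) + nvar s 6)%N 0%N by [].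
  rewrite h4 h6 (env_off es) //; apply: ltnW.
  exact: leq_trans (ltn_ord x) (leq_addl _ _).
have s17 : nvar s1 7 = r by rewrite /= /upd /= h7 subn1.
have s16 : nvar s1 6 = u by [].
have s1x : nvar s1 4 = x by [].
have mem1 : memory_mx s1 = memory_mx s by [].
move: mem1; move eS: (memory_mx s) inv cg sS => S inv cg sS mem1.
have f0 : fvar s1 0 = S u u / (S r u * S r u).
  by rewrite -mem1 -(entryE es1 s16 s16) -(entryE es1 s17 s16).
have f1 : fvar s1 1 = - 1 / S r u.
  by rewrite -mem1 -(entryE es1 s17 s16) -[- 1]sub0r.
have [dr iy nz hr] := inv_own inv Er.
have rr : S r r = 0 := inv_own_diag inv Er.
apply: wp_seq; apply: (@wp_eliminate_pair _ _ (funds own + row_cost * K + 70 + m')%N _ x u r) => //.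
- by rewrite mem1.
- move=> w; rewrite inE negb_or mem_seq1 => /andP[wr wu] wB.
  split; apply/eqP; apply: contraNT wB => h; rewrite mem1 sS in h.
    by have [] := hr _ h.
  rewrite -hu; have [[_ //]|E] := forget_support eo inv ru px wu h.
  by rewrite (uniq_r _ E) eqxx in wr.
- by lia.
rewrite mem1 f0 f1 => s2 sm2 mem2.
have es2 := env_same sm2 isT es1.
have s27 : nvar s2 7 = r by rewrite (same_nvar sm2).
have s26 : nvar s2 6 = u by rewrite (same_nvar sm2).
have n14 : narr s2 14 = upd (narr s 14) (x * n + u) 0%N by rewrite (same_narr sm2).
have n15 : narr s2 15 = narr s 15 by rewrite (same_narr sm2).
have cg2 : congruent M (memory_mx s2).
  by rewrite mem2; apply: congruent_trans cg _; apply: elim_mx_congruent2.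
have tb2 : table (narr s2 14) (set_own own r None) by rewrite n14; apply: table_clear.
have fu : (funds (set_own own r None) <= funds own + row_cost * K)%N.
  apply: funds_le; apply: (potential_del rank K.+1 Er).
  exact: (rows_at_node x inv tb).
have [e1 [e2 e3]] := pair_diag inv (S u u / (S r u * S r u)) (- 1 / S r u) Er'.
have Ec : feval s2 (entry 6 6) = S u u by rewrite (entryE es2 s26 s26) mem2.
apply: (@wp_if _ _ _ _ _ _ _ (funds own + row_cost * K + 60 + m')%N) => //; first by rewrite /=; lia.
  have -> : beval s2 (BFZero (entry 6 6)) = (S u u == 0) by rewrite -Ec.
  move=> /eqP uu; apply: (@wp_run _ _ _ _ _ (funds own + row_cost * K + m')%N) => //.
    by rewrite /=; lia.
  have sm3 := run_same s2 (c := record_mates) isT.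
  have m15 : narr (run record_mates s2) 15 =
      upd (upd (narr s 15) u r.+1) r u.+1.
    by rewrite /= /upd /= s26 s27 n15 !addn1.
  set s3 := run _ _ in sm3 m15 *.
  have mem3 : memory_mx s3 = memory_mx s2 by [].
  apply: (hQ _ (set_own own r None)); last by lia.
  split; rewrite ?mem3 //; first exact: env_same sm3 isT es2.
  rewrite m15 mem2; apply: (inv_keep_pair eo inv ru px _ _ Er' uniq_r uu).
  - by rewrite /upd eqxx.
  - by rewrite /upd eq_sym (inj_eq val_inj) (negPf nru) eqxx.
  - move=> q; rewrite !inE negb_or => /andP[q1 q2].
    by rewrite /upd !(inj_eq val_inj) (negPf q1) (negPf q2).
have -> : beval s2 (BFZero (entry 6 6)) = (S u u == 0) by rewrite -Ec.
move=> uu; apply: (@wp_run _ _ _ _ _ (funds own + row_cost * K + m')%N) => //.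
  by rewrite /=; lia.
have sm3 := run_same s2 (c := split_at 7 6) isT.
have mem3 := memory_split_at es2 s27 s26 nru.
set s3 := run _ _ in sm3 mem3 *.
have uu2 : memory_mx s2 u u != 0 by rewrite mem2 e2.
apply: (hQ _ (set_own own r None)); last by lia.
split.
- exact: env_same sm3 isT es2.
- rewrite mem3 mem2 (same_narr sm3) // n15.
  by apply: (inv_split_pair eo inv ru px Er' uniq_r); rewrite e2.
- rewrite mem3; apply: congruent_trans cg2 _; rewrite mem2.
  apply: split_pair_congruent => //; first exact: symm_elim_mx.
    by rewrite e2.
  exact: pair_block.
- by rewrite (same_narr sm3).
Qed.

Lemma wp_forget (Q : nat -> state F -> Prop) m m' s x u own cnt :
  good s own own cnt.+1 (pos x) -> nvar s 4 = x -> nvar s 6 = u ->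
  rank u = cnt -> home u = x ->
  (funds own + forget_cost + m' <= m)%N ->
  (forall s' own' m2, good s' own' own' cnt (pos x) ->
     (funds own' + m' <= m2)%N -> Q m2 s') ->
  wp forget Q m s.
Proof.
move=> g h4 h6 ru hu hm hQ; have [es inv cg tb] := g; rewrite /forget_cost in hm.
have px : pos (home u) = pos x by rewrite hu.
have rc : (row_cost * K <= row_cost * K.+1)%N by rewrite leq_mul2l leqnSn orbT.
apply: wp_seq; apply: (@wp_run _ _ _ _ _ (m - 7)%N) => //; first by rewrite /=; lia.
have -> : run (NSet 7 (pivot_at 4 6)) s = set_nvar s 7 (narr s 14 (x * n + u)).
  by rewrite -(pivot_atE es h4 h6).
set s1 := set_nvar _ _ _.
have g1 : good s1 own own cnt.+1 (pos x).
  split=> //; exact: env_set_nvar.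
have [es1 _ _ _] := g1.
have s17 : nvar s1 7 = narr s 14 (x * n + u)%N by [].
have eb : beval s1 (BLt (NConst 0) (NVar 7)) = (0 < narr s 14 (x * n + u))%N by [].
apply: (@wp_if _ _ _ _ _ _ _ (m - 10)%N); first by rewrite /=; lia.
  rewrite eb => nz.
  have [E|[r E1 E2]] := tb.1 x u; first by rewrite E in nz.
  apply: (@wp_forget_pair _ _ m' _ x u r own cnt) => //; by lia.
rewrite eb -eqn0Ngt => /eqP z.
(* An empty cell for u at its home means that no deferred row meets column u. *)
have hno w : own w != Some (home u, u).
  by rewrite hu; apply/eqP => E; move: z; rewrite (tb.2 _ _ _ E).
apply: wp_seq; apply: (@wp_run _ _ _ _ _ (m - 12)%N) => //; first by rewrite /=; lia.
have -> : run (NSet 7 (NVar 6)) s1 = set_nvar s1 7 u by rewrite /= /upd /= h6.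
set s2 := set_nvar _ _ _.
have es2 : env s2.
  exact: env_set_nvar.
have mem2 : memory_mx s2 = memory_mx s by [].
have s27 : nvar s2 7 = u by [].
have s26 : nvar s2 6 = u by [].
have s24 : nvar s2 4 = x by [].
have Ec : feval s2 (entry 6 6) = memory_mx s u u by rewrite (entryE es2 s26 s26).
move eS: (memory_mx s) inv cg Ec mem2 => S inv cg Ec mem2.
apply: (@wp_if _ _ _ _ _ _ _ (m - 20)%N); first by rewrite /=; lia.
  have -> : beval s2 (BFZero (entry 6 6)) = (S u u == 0) by rewrite -Ec.
  move=> /eqP uu.
  apply: wp_seq; apply: (@wp_run _ _ _ _ _ (m - 30)%N) => //; first by rewrite /=; lia.
  have -> : run (NSet 8 (NVar 4)) s2 = set_nvar s2 8 x by rewrite /= /upd /= h4.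
  set s3 := set_nvar _ _ _.
  have es3 : env s3.
    exact: env_set_nvar.
  apply: wp_seq; apply: (@wp_find_leading _ _ (m - 40 * K - 80)%N _ x u) => //.
  - move=> j; rewrite -/(memory_mx s3) (_ : memory_mx s3 = S) // => nz.
    have ju : j != u by apply: contraNneq nz => ->; rewrite uu.
    rewrite -hu; have [[_ //]|E] := forget_support eo inv ru px ju nz.
    by have := hno j; rewrite E eqxx.
  - by lia.
  rewrite (_ : memory_mx s3 = S) // => s4 o sm4 hl h10 h9.
  have es4 := env_same sm4 isT es3.
  have mem4 : memory_mx s4 = S by rewrite (memory_same sm4).
  have n14 : narr s4 14 = narr s 14 by rewrite (same_narr sm4).
  have n15 : narr s4 15 = narr s 15 by rewrite (same_narr sm4).
  have Eu : own u = None := own_live inv ru px.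
  have sw : switch x x own =1 own.
    move=> q; rewrite /switch; case: (own q) => [[z' p]|] //=; by case: eqP => [->|].
  have eown (o' : option ('I_t * 'I_n)) : set_own (switch x x own) u o' =1 set_own own u o'.
    by move=> q; rewrite /set_own; case: eqP.
  have inv4 := inv_defer eo inv ru px uu hno hl; rewrite hu in inv4.
  have fu : (funds (set_own own u (omap (pair x) o)) <= funds own + row_cost * K.+1)%N.
    exact/funds_le/potential_add.
  have fe (o' : option ('I_t * 'I_n)) : funds (set_own (switch x x own) u o') = funds (set_own own u o').
    by rewrite /funds (potential_ext (eown o')).
  apply: (@wp_insert_row _ _ m' _ x x u o own cnt (pos x)) => //.
  - apply: good_ext (fun q => esym (eown _ q)) (frefl own) _.
    by split; rewrite ?mem4 ?n14 ?n15.
  - by rewrite (same_nvar sm4).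
  - by rewrite (same_nvar sm4).
  - by rewrite h10; case: (o).
  - by rewrite fe; lia.
  move=> s5 o' m2 sm5 g5; rewrite fe => hm2; apply: (hQ _ (set_own own u (omap (pair x) o'))) => //.
  exact: good_ext (eown _) (frefl _) g5.
have -> : beval s2 (BFZero (entry 6 6)) = (S u u == 0) by rewrite -Ec.
move=> uu; apply: wp_seq; apply: (@wp_run _ _ _ _ _ (m - 40)%N) => //; first by rewrite /=; lia.
set c0 := Seq _ _; have sm3 := run_same s2 (c := c0) isT.
have f0 : fvar (run c0 s2) 0 = - 1 / S u u by rewrite -Ec -[- 1]sub0r.
have f1 : fvar (run c0 s2) 1 = 0 by [].
set s3 := run c0 s2 in sm3 f0 f1 *.
have es3 := env_same sm3 isT es2.
have mem3 : memory_mx s3 = S by [].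
apply: (@wp_eliminate_pair _ _ (funds own + m')%N _ x u u) => //.
- by rewrite mem3; exact: inv_symm inv.
- move=> w; rewrite mem3 !inE orbb => wu wB; rewrite (inv_symm inv).
  suff -> : S u w = 0 by [].
  apply/eqP; apply: contraNT wB => nz.
  rewrite -hu; have [[_ //]|E] := forget_support eo inv ru px wu nz.
  by have := hno w; rewrite E eqxx.
- by lia.
rewrite mem3 f0 f1 => s4 sm4 mem4.
apply: (hQ _ own) => //; split.
- exact: env_same sm4 isT es3.
- rewrite mem4 (same_narr sm4) //; exact: (inv_elim1 eo inv ru px _ uu hno).
- rewrite mem4; apply: congruent_trans cg _; apply: elim_mx_congruent1 => //.
  exact: inv_symm inv.
- by rewrite (same_narr sm4).
Qed.

(** Only the loop over the bag; the reductions come out of the funds of the deferred rows. *)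
Definition push_cost : nat := (90 * K + 100)%N.

Lemma good_set_nvar s (a v : nat) own loc cnt i : a != 1%N ->
  good s own loc cnt i -> good (set_nvar s a v) own loc cnt i.
Proof. by move=> h [g1 g2 g3 g4]; split=> //; apply: env_set_nvar. Qed.

Lemma wp_push_rows (Q : nat -> state F -> Prop) m m' s x own cnt :
  good s own own cnt (pos x) -> nvar s 4 = x ->
  (forall v, (rank v < cnt)%N -> (pos x < pos (home v))%N) ->
  (funds own + push_cost + m' <= m)%N ->
  (forall s' own' m2, good s' own' own' cnt (pos x).+1 ->
     (funds own' + m' <= m2)%N -> Q m2 s') ->
  wp push_rows Q m s.
Proof.
move=> [es inv cg tb] h4 hl hm hQ; rewrite /push_cost in hm.
apply: wp_seq; apply: (@wp_run _ _ _ _ _ (m - 3)%N) => //; first by rewrite /=; lia.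
have -> : run (NSet 8 (NGet 10 (NVar 4))) s = set_nvar s 8 (oapp (fun y : 'I_t => y.+1) 0%N (par x)).
  by rewrite /= h4 (env_par es).
(* At a root the dummy target y = x makes [switch] the identity. *)
have [y hy] : exists y, par x = Some y \/ par x = None /\ y = x.
  by case E: (par x) => [y|]; [exists y; left | exists x; right].
have inv' : invariant B pos rank (switch x y own) (memory_mx s) cnt (narr s 15) (pos x).+1.
  by apply: (inv_switch (y := y) eo inv hl); case: hy => [|[]]; [left|right].
have fu : (funds (switch x y own) <= funds own)%N.
  by rewrite /funds leq_mul2l potential_switch orbT.
set s0 := set_nvar s 8 _.
have eb0 : beval s0 (BLt (NConst 0) (NVar 8)) = isSome (par x).
  by rewrite -[beval _ _]/(0 < oapp (fun y : 'I_t => y.+1) 0 (par x))%N; case: (par x).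
apply: (@wp_if _ _ _ _ _ _ _ (m - 6)%N); first by rewrite /=; lia.
all: rewrite eb0 /s0; case: hy => [py|[py yx]]; rewrite py //= => _.
all: swap 1 2.
  apply: (@wp_run _ _ _ _ _ (funds own + m')%N) => //; first by rewrite /=; lia.
  have sw : switch x y own =1 own.
    move=> q; rewrite /switch yx; case: (own q) => [[z' p]|] //=; by case: eqP => [->|].
  apply: (hQ _ own) => //; apply: good_set_nvar => //.
  by split=> //; apply: invariant_ext sw inv'.
have pxy := eo_up eo py.
have nyx : y != x by apply: contraTneq pxy => ->; rewrite ltnn.
apply: wp_seq; apply: (@wp_run _ _ _ _ _ (m - 10)%N) => //; first by rewrite /=; lia.
rewrite [run _ _]/= {1}/upd eqxx subn1 /=.
set s1 := set_nvar _ _ _.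
have g1 : good s1 (switch x y own) own cnt (pos x).+1.
  by do 2 apply: good_set_nvar => //.
have hsz : (80 * size (bs x) <= 80 * K)%N by rewrite leq_mul2l size_bs.
have [es1 _ _ _] := g1.
(* The cells of x for the visited columns l1 are empty, while the invariant attributes all remaining
   rows of x to y. After the whole bag no row is left at x, and the two owner maps agree again. *)
apply: (@wp_for_bag _ _ _ _ _ _ _ (fun l1 m1 s2 => exists loc,
   [/\ good s2 (switch x y loc) loc cnt (pos x).+1,
       (forall q p, loc q = Some (x, p) -> p \in B x /\ p \notin l1),
       nvar s2 8 = y
     & (10 + funds (switch x y loc) + 80 * (size (bs x) - size l1) + 3 + m' <= m1)%N])
  _ _ _ x (bs x)) => //; rewrite ?(env_bag es1) //.
- exact: (env_bags es1).
- move=> l1 m1 s2 z v hz [loc [g2 h1 h2 h3]]; exists loc; split=> //.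
    by apply: good_set_nvar g2; move: hz; rewrite !inE => /or3P[]/eqP->.
  by move: hz; rewrite /= /upd !inE => /or3P[]/eqP->.
- by lia.
- exists own; split=> //; last by rewrite /= subn0; lia.
  move=> q p /(inv_own inv) [_ _ h1 h2]; split=> //.
  by have [] := h2 _ h1.
- move=> l1 v l2 m1 s2 E sm h9 [loc [g2 h1 h2 h3]].
  have es2 := good_env g2; have tb2 := good_table g2.
  have h4' : nvar s2 4 = x by rewrite (same_nvar sm).
  have e1 : (size (bs x) - size l1 = (size (bs x) - size (rcons l1 v)).+1)%N.
    by rewrite E size_cat size_rcons /=; lia.
  rewrite e1 mulnS in h3.
  set X := (80 * (size (bs x) - size (rcons l1 v)))%N in h3 *.
  apply: wp_seq; apply: (@wp_run _ _ _ _ _ (m1 - 6)%N) => //; first by rewrite /=; lia.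
  have -> : run (NSet 7 (pivot_at 4 9)) s2 = set_nvar s2 7 (narr s2 14 (x * n + v)).
    by rewrite -(pivot_atE es2 h4' h9).
  set s3 := set_nvar _ _ _.
  have g3 : good s3 (switch x y loc) loc cnt (pos x).+1 by apply: good_set_nvar.
  have eb : beval s3 (BLt (NConst 0) (NVar 7)) = (0 < narr s2 14 (x * n + v))%N by [].
  apply: (@wp_if _ _ _ _ _ _ _ (m1 - 9)%N); first by rewrite /=; lia.
    rewrite eb => nz; have [E0|[r E1 E2]] := tb2.1 x v; first by rewrite E0 in nz.
    set c0 := Seq (NSet 7 _) _.
    apply: wp_seq; apply: (@wp_run _ _ _ _ _ (m1 - 30)%N) => //; first by rewrite /=; lia.
    have -> : run c0 s3 = set_nvar (set_narr (set_nvar s3 7 r) 14 (x * n + v) 0) 10 1.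
      have e0 : (neval s3 (NSub (NVar 7) (NConst 1)) = r)%N.
        by rewrite /= {1}/upd /= E1 subn1.
      rewrite /c0 -e0; set s3' := set_nvar s3 7 _.
      have es3 : env s3' by apply: env_set_nvar => //; apply: good_env g3.
      have e2 := run_put_pivot (NConst 0) es3 (h4' : nvar s3' 4 = x) (h9 : nvar s3' 9 = v).
      by rewrite -[run _ _]/(set_nvar (run (put_pivot 4 9 (NConst 0)) s3') 10 1) e2.
    set s4 := set_nvar _ _ _.
    pose loc1 := set_own loc r None.
    have eown : set_own (switch x y loc1) r (omap (pair y) (Some v)) =1 switch x y loc.
      move=> q; rewrite /loc1 /switch /set_own; case: (eqVneq q r) => [->|] //=.
      by rewrite E2 /= eqxx.
    have g4 : good s4 (switch x y loc) loc1 cnt (pos x).+1.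
      have [f1 f2 f3 f4] := g3; split=> //.
        by apply: env_set_nvar => //; apply: env_set_narr => //; apply: env_set_nvar.
      exact: table_clear.
    apply: (@wp_insert_row _ _ (10 + X + 3 + m')%N _ x y r (Some v) loc1 cnt (pos x).+1) => //.
    + exact: good_ext (fsym eown) (frefl _) g4.
    + by rewrite /loc1 set_own_eq.
    + by move=> p [<-].
    + by rewrite /funds (potential_ext eown) -/(funds _); lia.
    move=> s5 o' m2 sm5 g5 hm2; exists (set_own loc1 r (omap (pair y) o')); split.
    + exact: good_ext (fsym (switch_set _ _ _ _ _)) (frefl _) g5.
    + move=> q p; rewrite /loc1 /set_own; case: (eqVneq q r) => [_|qr].
        by case: o' {g5 hm2} => [p'|] //= [e _]; rewrite e eqxx in nyx.
      move=> Eq; have [i1 i2] := h1 _ _ Eq; split=> //; rewrite mem_rcons inE negb_or i2 andbT.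
      apply: contra qr => /eqP ep; apply/eqP/(table_inj tb2 Eq); by rewrite ep.
    + by rewrite (same_nvar sm5).
    + rewrite /funds (potential_ext (switch_set _ _ _ _ _)) -/(funds _); lia.
  rewrite eb -eqn0Ngt => /eqP z.
  apply: (@wp_run _ _ _ _ _ (m1 - 10)%N) => //; first by rewrite /=; lia.
  exists loc; split=> //; last by lia.
  move=> q p Eq; have [i1 i2] := h1 _ _ Eq; split=> //; rewrite mem_rcons inE negb_or i2 andbT.
  by apply/eqP => ep; move: z; rewrite (tb2.2 _ _ _ (_ : loc q = Some (x, v))) // -ep.
- by move=> l1 m1 s2 [loc [_ _ _ h]]; apply: leq_trans h; rewrite -!addnA leq_addr.
- move=> m1 s2 sm [loc [g2 h1 h2 h3]]; exists (m1 - 3)%N; first by lia.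
  have sw : switch x y loc =1 loc.
    move=> q; rewrite /switch; case Eq: (loc q) => [[z p]|] //=.
    case: eqP => // ez; rewrite ez in Eq; have [i1 i2] := h1 _ _ Eq.
    by rewrite mem_bs i1 in i2.
  apply: (hQ _ loc); first exact: good_ext sw (frefl _) g2.
  have e0 : funds (switch x y loc) = funds loc by rewrite /funds (potential_ext sw).
  by rewrite e0 in h3; lia.
Qed.

Hypothesis pos_lt : forall x, (pos x < t)%N.
Hypothesis node_at : forall i, (i < t)%N -> exists x, pos x = i.
Hypothesis rank_lt : forall v, (rank v < n)%N.
Hypothesis vertex_at : forall c, (c < n)%N -> exists u, rank u = c.

Lemma wp_main_loop (Q : nat -> state F -> Prop) m m' s :
  env s -> nvar s 5 = n -> memory_mx s = M -> symm M -> narr s 14 =1 (fun=> 0%N) ->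
  (forall u w, u != w -> M u w != 0 -> exists z, (u \in B z) && (w \in B z)) ->
  ((forget_cost + 60) * n + (push_cost + 60) * t + 100 + m' <= m)%N ->
  (forall s', env s' -> congruent M (memory_mx s') -> symm (memory_mx s') ->
     (forall r j, j != r -> memory_mx s' r j != 0 ->
        narr s' 15 r = j.+1 /\ memory_mx s' r r = 0) -> Q m' s') ->
  wp main_loop Q m s.
Proof.
move=> es h5 hM sM h14 hedge hm hQ.
pose fc := (forget_cost + 60)%N; pose pc := (push_cost + 60)%N.
rewrite -/fc -/pc in hm.
apply: wp_seq; apply: (@wp_run _ _ _ _ _ (m - 2)%N) => //; first by rewrite /=; lia.
have -> : run (NSet 3 (NConst 0)) s = set_nvar s 3 0 by [].
set s1 := set_nvar _ _ _.
have es1 : env s1 by apply: env_set_nvar.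
have fund0 : funds (fun=> None) = 0%N by rewrite /funds /potential big1 ?muln0.
apply: (@wp_for_range _ _ _ _ (fun i m1 s2 => exists own cnt,
   [/\ good s2 own own cnt i, nvar s2 5 = cnt,
       (forall v, (rank v < cnt)%N -> (i <= pos (home v))%N), (cnt <= n)%N
     & (funds own + fc * cnt + pc * (t - i) + 10 + m' <= m1)%N]) _ _ _ 0%N t) => //.
- exact: env_t.
- exists (fun=> None), n; split=> //; last by rewrite fund0 subn0; lia.
  have mem1 : memory_mx s1 = M by [].
  split; rewrite ?mem1.
  + exact: es1.
  + split=> //; first by move=> u w _ _; apply: hedge.
    by move=> r hr; have := rank_lt r; rewrite ltnNge hr.
  + exact: congruent_refl.
  + by split=> // y p; left; apply: h14.
- move=> i m1 s2 sm /andP[_ lti] h3 [own [cnt [g e5 hl hc hm1]]].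
  have [x px] := node_at lti.
  have es2 := good_env g.
  have e1 : (t - i = (t - i.+1).+1)%N by lia.
  rewrite e1 mulnS in hm1; set X := (pc * (t - i.+1))%N in hm1 *.
  exists (m1 - 7)%N; first by rewrite /pc /push_cost in hm1; lia.
  apply: wp_seq; apply: (@wp_run _ _ _ _ _ (m1 - 10)%N) => //.
    by rewrite /= /pc /push_cost in hm1 *; lia.
  have -> : run (NSet 4 (NGet 7 (NVar 3))) s2 = set_nvar s2 4 x.
    by rewrite /= h3 -px (env_node es2).
  set s3 := set_nvar _ _ _.
  apply: wp_seq.
  apply: (@wp_while _ _ _ (fun m2 s4 => exists own cnt,
   [/\ good s4 own own cnt (pos x), nvar s4 5 = cnt,
       (forall v, (rank v < cnt)%N -> (i <= pos (home v))%N), (cnt <= n)%N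
     & (funds own + fc * cnt + (push_cost + X + 40 + m') <= m2)%N])).
  + exists own, cnt; split=> //; first by apply: good_set_nvar; rewrite // px.
    by rewrite /pc in hm1; lia.
  + move=> m2 s4 sm4 [own4 [cnt4 [g4 e4 hl4 hc4 hm4]]].
    have es4 := good_env g4; have n4 : nvar s4 4 = x by rewrite (same_nvar sm4).
    rewrite [beval _ _]/= e4 n4 => /andP[]; case: cnt4 e4 g4 hl4 hc4 hm4 => // c e4 g4 hl4 hc4 hm4 _.
    have [u ru] := vertex_at hc4.
    rewrite subn1 /= -ru (env_ord es4) (env_home es4) addn1 eqSS => /eqP/val_inj hu.
    rewrite mulnS in hm4; set Y := (fc * c)%N in hm4.
    have hfc : fc = (forget_cost + 60)%N by [].
    exists (m2 - 13)%N; first by rewrite /=; lia.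
    apply: wp_seq; apply: (@wp_run _ _ _ _ _ (m2 - 22)%N) => //.
      by rewrite /=; lia.
    set c0 := Seq _ _; have -> : run c0 s4 = set_nvar (set_nvar s4 5 c) 6 u.
      have ev : narr s4 12 c = u by rewrite -ru (env_ord es4).
      by rewrite /c0 /= /upd /= e4 subn1 /= ev.
    set s5 := set_nvar _ _ _.
    have g5 : good s5 own4 own4 c.+1 (pos x) by do 2 apply: good_set_nvar => //.
    apply: (@wp_mono _ _ (fun m3 s6 => exists2 own6, good s6 own6 own6 c (pos x) &
      (funds own6 + (Y + (push_cost + X + 40 + m')) <= m3)%N) _ (m2 - 22)%N _ s5) => //.
      apply: (@wp_forget _ _ (Y + (push_cost + X + 40 + m'))%N s5 x u own4 c g5 n4) => //.
        by lia.
      by move=> s6 own6 m3 g6 hm6; exists own6.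
    move=> m3 s6 sm6 [own6 g6 hm6]; exists own6, c; split=> //.
    * by rewrite (same_nvar sm6).
    * by move=> v hv; apply: hl4; apply: ltnW.
    * exact: ltnW.
    * by rewrite /Y in hm6; lia.
  + move=> m2 s4 sm4 [own4 [cnt4 [g4 e4 hl4 hc4 hm4]]] nb.
    have es4 := good_env g4; have n4 : nvar s4 4 = x by rewrite (same_nvar sm4).
    exists (m2 - 13)%N; first by rewrite /=; lia.
    (* The inner loop has stopped, so the next vertex u does not have home x. Its home is further
       up, and by [eo_mono] so are the homes of all vertices of smaller rank. *)
    have hl5 v : (rank v < cnt4)%N -> (pos x < pos (home v))%N.
      move=> hv; rewrite ltn_neqAle px hl4 // andbT -px.
      case: cnt4 e4 g4 hl4 hc4 hm4 hv nb => // c e4 g4 hl4 hc4 hm4 hv.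
      have [u ru] := vertex_at hc4; have ev : narr s4 12 c = u by rewrite -ru (env_ord es4).
      rewrite /= e4 n4 subn1 /= ev (env_home es4) addn1 eqSS => nb.
      have hu : (pos x < pos (home u))%N.
        rewrite ltn_neqAle px hl4 ?ru // andbT -px.
        by apply: contra nb => /eqP/(eo_pos eo) ->.
      have [vu|uv] := leqP (rank u) (rank v).
        have -> : v = u by apply: (eo_rank eo); move: hv; rewrite ru in vu *; lia.
        by rewrite neq_ltn hu.
      by rewrite neq_ltn (leq_trans hu (eo_mono eo uv)).
    apply: (@wp_mono _ _ (fun m3 s6 => exists2 own6, good s6 own6 own6 cnt4 (pos x).+1 &
      (funds own6 + (fc * cnt4 + X + 20 + m') <= m3)%N) _ (m2 - 13)%N _ s4) => //.
      apply: (@wp_push_rows _ _ (fc * cnt4 + X + 20 + m')%N s4 x own4 cnt4 g4 n4 hl5).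
        by lia.
      by move=> s6 own6 m3 g6 hm6; exists own6.
    move=> m3 s6 sm6 [own6 g6 hm6]; exists own6, cnt4; split=> //.
    * by apply: good_set_nvar => //; rewrite -px.
    * by rewrite /= /upd /= (same_nvar sm6).
    * by move=> v hv; rewrite -px; apply: hl5.
    * by lia.
- move=> m1 s2 sm [own [cnt [g e5 hl hc hm1]]].
  (* A live vertex would have its home at a position beyond the last node. *)
  have cnt0 : cnt = 0%N.
    case: cnt g e5 hl hc hm1 => // c g e5 hl hc hm1; have [u ru] := vertex_at hc.
    by have := hl u; rewrite ru ltnS leqnn leqNgt pos_lt => /(_ isT).
  rewrite cnt0 in g; have [es2 inv cg _] := g.
  (* A deferred row has a live leading column, and no vertex is live any more. *)
  have own0 r : own r = None.
    by case E: (own r) => [[y p]|] //; have [_ _ h1 h2] := inv_own inv E; have [] := h2 _ h1.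
  exists m'; first by lia.
  apply: hQ => //; first exact: inv_symm inv.
  by move=> r j jr nz; have [] := inv_fin inv (leq0n _) (own0 r) jr nz.
Qed.

End Main.

(** * Splitting the hyperbolic pairs *)

(** The default 1 remains when the diagonal is 0. Any nonzero value serves if 2 is invertible;
    otherwise a diagonalizable matrix with zero diagonal is 0 and there is nothing to split. *)
Definition choose_diagonal : cmd :=
  Seq (Seq (FSet 3 FOne) (NSet 3 (NConst 0)))
  (for_range 3 0 (If (BFZero (entry 3 3)) Skip (FSet 3 (entry 3 3)))).

(** A missing partner, stored as 0, is truncated to vertex 0 and then rejected by the tests on the
    entries. The second vertex of a split pair is rejected too, since its diagonal entry is no
    longer 0. *)
Definition split_pairs : cmd :=
  Seq (NSet 3 (NConst 0))
  (for_range 3 0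
    (Seq (NSet 7 (NSub (NGet 15 (NVar 3)) (NConst 1)))
    (If (BAnd (BLt (NVar 7) (NVar 0))
              (BAnd (BFZero (entry 3 3)) (BNot (BFZero (entry 3 7)))))
      (Seq (put_entry 3 3 (FVar 3)) (split_at 7 3))
      Skip))).

Definition write_output : cmd :=
  Seq (NSet 3 (NConst 0))
  (for_range 3 0 (FPut 1 (NVar 3) (entry 3 3))).

Definition finish : cmd := Seq choose_diagonal (Seq split_pairs write_output).

(** * Alternating matrices in characteristic 2 *)

Section Alternating.

Variables (F : fieldType) (n : nat).
Implicit Types (S N : 'M[F]_n).

Lemma alternating_sum (f : 'I_n -> 'I_n -> F) : (2%:R : F) = 0 ->
  (forall i j, f i j = f j i) -> (forall i, f i i = 0) ->
  \sum_i \sum_j f i j = 0.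
Proof.
move=> two sf df.
have -> : \sum_i \sum_j f i j =
    \sum_(i : 'I_n) \sum_(j : 'I_n | (i < j)%N) f i j + \sum_(i : 'I_n) \sum_(j : 'I_n | (j < i)%N) f i j.
  rewrite -big_split /=; apply: eq_bigr => i _.
  rewrite !(big_mkcond (fun j : 'I_n => (_ < _)%N)) /= -big_split /=.
  apply: eq_bigr => j _; case: ltngtP => h; rewrite ?addr0 ?add0r //.
  by rewrite (val_inj h) df.
have -> : \sum_(i : 'I_n) \sum_(j : 'I_n | (j < i)%N) f i j = \sum_(i : 'I_n) \sum_(j : 'I_n | (i < j)%N) f i j.
  rewrite (exchange_big_dep xpredT) //=.
  by apply: eq_bigr => i _; apply: eq_bigr => j _.
by rewrite -mulr2n -mulr_natl two mul0r.
Qed.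

Lemma congruent_alternating S N : (2%:R : F) = 0 -> symm S ->
  (forall i, S i i = 0) -> congruent S N -> forall i, N i i = 0.
Proof.
move=> two sS dS [P _ ->] i; rewrite mxE.
under eq_bigr do rewrite mxE big_distrl /=.
apply: (alternating_sum two) => [j k|j]; rewrite !mxE.
  by rewrite (sS k j); ring.
by rewrite dS mulr0 mul0r.
Qed.

Lemma alternating_diagonalizable S (d : 'rV[F]_n) : (2%:R : F) = 0 -> symm S ->
  (forall i, S i i = 0) -> congruent S (diag_mx d) -> S = 0.
Proof.
move=> two sS dS h; have d0 := congruent_alternating two sS dS h.
have {}d0 : diag_mx d = 0.
  apply/matrixP=> i j; have := d0 i; rewrite !mxE eqxx mulr1n => ->.
  by rewrite mul0rn.
move: (congruent_sym h); rewrite d0 => -[P _ ->].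
by rewrite mulmx0 mul0mx.
Qed.

End Alternating.

Section Finish.

Variables (F : fieldType) (n t : nat) (M : 'M[F]_n) (bs : 'I_t -> seq 'I_n).
Variables (pos : 'I_t -> nat) (par : 'I_t -> option 'I_t).
Variables (home : 'I_n -> 'I_t) (rank : 'I_n -> nat).

Let envs := @env F n t bs pos par home rank.

Definition quasi_diagonal (S : 'M[F]_n) (mate : nat -> nat) : Prop :=
  forall r j : 'I_n, j != r -> S r j != 0 -> mate r = j.+1 /\ S r r = 0.

Definition diagonalizable : Prop :=
  (2%N \notin [pchar F]) \/ (exists d : 'rV[F]_n, congruent M (diag_mx d)).

(** Each alternative survives a splitting: the first depends on the field alone; a vertex with
    diagonal entry d belongs to no pair and keeps its entry; a zero matrix has no pair. *)
Definition splittable (S : 'M[F]_n) (d : F) : Prop :=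
  [/\ congruent M S, d != 0 & [\/ (2%:R : F) != 0, exists i, S i i = d | S = 0]].

Lemma memory_hyper_split s (i r : 'I_n) d : envs s -> nvar s 3 = i -> nvar s 7 = r ->
  fvar s 3 = d -> i != r -> symm (memory_mx n s) ->
  memory_mx n (run (Seq (put_entry 3 3 (FVar 3)) (split_at 7 3)) s) =
  hyper_split (memory_mx n s) i r d.
Proof.
move=> es h3 h7 hd ir sS.
have -> : run (Seq (put_entry 3 3 (FVar 3)) (split_at 7 3)) s =
  run (split_at 7 3) (run (put_entry 3 3 (FVar 3)) s) by [].
have es1 := env_same (run_same s (c := put_entry 3 3 (FVar 3)) isT) isT es.
rewrite (@memory_split_at _ _ _ _ _ _ _ _ _ _ _ r i es1) //; last by rewrite eq_sym.
rewrite (put_entryE _ es h3 h3).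
rewrite -[feval _ _]/(fvar s 3) hd; move: (memory_mx n s) sS => S sS.
apply/matrixP=> k l; rewrite !mxE !eqxx (sS r i) (eq_sym r i) (negPf ir) /=.
case: (eqVneq k r) => [->|kr]; case: (eqVneq l r) => [->|lr];
  rewrite ?eqxx ?(eq_sym r i) ?(negPf ir) ?andbF ?andbT /= ?orbF //.
Qed.

Section Split.

Variables (S : 'M[F]_n) (mate : nat -> nat) (i r : 'I_n) (d : F).
Hypotheses (sS : symm S) (qS : quasi_diagonal S mate).
Hypotheses (ii : S i i = 0) (nz : S i r != 0).

Lemma split_neq : i != r.
Proof. by apply: contraNneq nz => <-; rewrite ii. Qed.

Lemma split_row j : j != i -> j != r -> S i j = 0.
Proof.
move=> ji jr; apply/eqP/negPn/negP => h; have [e _] := qS ji h.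
have ri : r != i by rewrite eq_sym split_neq.
have [e' _] := qS ri nz; move: e' jr; rewrite e => -[/val_inj ->].
by rewrite eqxx.
Qed.

Lemma split_row2 j : j != i -> j != r -> S r j = 0.
Proof.
move=> ji jr; apply/eqP/negPn/negP => h; have [e _] := qS jr h.
have nz' : S r i != 0 by rewrite sS.
have [e' _] := qS split_neq nz'; move: e' ji; rewrite e => -[/val_inj ->].
by rewrite eqxx.
Qed.

Lemma split_diag : S r r = 0.
Proof. by have nz' : S r i != 0 by [rewrite sS]; have [] := qS split_neq nz'. Qed.

Lemma split_other k l : k != i -> k != r -> hyper_split S i r d k l = S k l.
Proof. by move=> /negPf ki /negPf kr; rewrite mxE ki kr. Qed.

Lemma split_self k l : k \in [:: i; r] -> k != l -> hyper_split S i r d k l = 0.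
Proof.
rewrite !inE mxE => hk kl; have ir := split_neq.
case/orP: hk kl => /eqP-> kl; rewrite !eqxx ?(eq_sym r i) (negPf ir) /=.
  rewrite (eq_sym l i) (negPf kl); case: (eqVneq l r) => //= lr.
  by rewrite split_row // eq_sym.
rewrite (eq_sym l r) (negPf kl) orbF; case: (eqVneq l i) => //= li.
by rewrite split_row2 // eq_sym.
Qed.

Lemma symm_hyper_split : symm (hyper_split S i r d).
Proof.
move=> k l; rewrite !mxE (andbC (l == i)) (andbC (l == r)) (sS k l).
by rewrite (andbC (l == r)) (andbC (l == i)) orbC.
Qed.

Lemma quasi_hyper_split : quasi_diagonal (hyper_split S i r d) mate.
Proof.
move=> k l lk; have [hk|] := boolP (k \in [:: i; r]).
  by rewrite split_self // ?eqxx // eq_sym.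
rewrite !inE negb_or => /andP[ki kr]; rewrite !split_other //; exact: qS.
Qed.

Lemma splittable_hyper_split : splittable S d -> splittable (hyper_split S i r d) d.
Proof.
have ir := split_neq.
have blk : block2 S i r by move=> j ji jr; rewrite split_row // split_row2.
case=> cg d0 [two|[k dk]|S0]; last by have := nz; rewrite S0 mxE eqxx.
  split; [|by []|by constructor 1].
  by apply: (congruent_trans cg); apply: hyper_split_odd => //; exact: split_diag.
have ki : k != i by apply: contraNneq d0 => e; rewrite -dk e ii.
have kr : k != r by apply: contraNneq d0 => e; rewrite -dk e split_diag.
split=> //; last by constructor 2; exists k; rewrite split_other.
apply: (congruent_trans cg); rewrite -dk; apply: hyper_split_diag => //.
- exact: split_diag.
- by rewrite dk.
- move=> j jk; apply/eqP/negPn/negP => h; have [_ e] := qS jk h.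
  by move: d0; rewrite -dk e eqxx.
Qed.

End Split.

(** This is where diagonalizability enters: if 2 = 0 and the diagonal vanishes, S is alternating, a
    diagonal matrix congruent to it is alternating and thus 0, and so S = 0. *)
Lemma splittable_start S mate d : symm S -> quasi_diagonal S mate -> congruent M S ->
  d != 0 -> (forall i, S i i = 0) \/ (exists i, S i i = d) -> diagonalizable ->
  splittable S d.
Proof.
move=> sS qS cg d0 hd hM; split=> //.
case: hd => [dS|h]; last by constructor 2.
have [two|two] := eqVneq (2%:R : F) 0; last by constructor 1.
constructor 3; case: hM => [|[d' hd']]; first by rewrite inE /= two eqxx.
apply: (alternating_diagonalizable two sS dS).
exact: congruent_trans (congruent_sym cg) hd'.
Qed.

Lemma wp_finish (Q : nat -> state F -> Prop) m m' s mate :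
  envs s -> nvar s 0 = n -> symm (memory_mx n s) -> congruent M (memory_mx n s) ->
  narr s 15 = mate -> quasi_diagonal (memory_mx n s) mate ->
  (200 * n + 50 + m' <= m)%N ->
  (forall s', (diagonalizable -> congruent M (diag_mx (output n s'))) -> Q m' s') ->
  wp finish Q m s.
Proof.
move=> es h0 sS cg h15 qS hm hQ; set S := memory_mx n s in sS cg qS.
apply: wp_seq; apply: wp_seq.
apply: (@wp_run _ _ _ _ _ (m - 5)%N) => //; first by rewrite /=; lia.
set s1 := run _ s.
have es1 : envs s1 := env_same (run_same s (c := Seq (FSet 3 FOne) (NSet 3 (NConst 0))) isT) isT es.
have mem1 : memory_mx n s1 = S by [].
apply: (@wp_for_bounded F _ _ _ (fun i s2 => memory_mx n s2 = S /\
  (fvar s2 3 != 0 /\ ((forall k : 'I_n, (k < i)%N -> S k k = 0) \/ exists k, S k k = fvar s2 3)))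
  20 _ _ (110 * n + 20 + m')%N _ n) => //.
- split=> //; split; first exact: oner_neq0.
  by left.
- move=> i s2 sm lti h3 [mem2 [d0 hd]]; pose k := Ordinal lti.
  have es2 := env_same sm isT es1.
  have h3' : nvar s2 3 = k by [].
  apply: (@wp_run _ _ _ _ _ 0%N) => //.
  have -> : run (If (BFZero (entry 3 3)) Skip (FSet 3 (entry 3 3))) s2 =
     if S k k == 0 then s2 else set_fvar s2 3 (S k k).
    by rewrite -mem2 -(entryE es2 h3' h3').
  case: ifP => [/eqP z|/negbT nz]; last first.
    by split=> //; split=> //; right; exists k.
  split=> //; split=> //; case: hd => [hd|]; [left|by right].
  move=> k' hk'; have [e|ne] := eqVneq k' k; first by rewrite e.
  apply: hd; move: ne; rewrite -(inj_eq val_inj) /=; move: hk'; rewrite ltnS; lia.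
- by lia.
move=> s2 sm2 [mem2 [d0 hd]].
have es2 := env_same sm2 isT es1.
have {}hd : (forall k, S k k = 0) \/ exists k, S k k = fvar s2 3.
  by case: hd => [hd|]; [left=> k; apply: hd|right].
move ed: (fvar s2 3) d0 hd => d d0 hd.
apply: wp_seq; apply: wp_seq.
apply: (@wp_run _ _ _ _ _ (110 * n + 18 + m')%N) => //; first by rewrite /=; lia.
have -> : run (NSet 3 (NConst 0)) s2 = set_nvar s2 3 0 by [].
set s3 := set_nvar _ _ _.
have es3 : envs s3 by apply: env_set_nvar.
have h03 : nvar s3 0 = n by rewrite -h0 -[RHS]/(nvar s1 0) -(same_nvar sm2).
have h153 : narr s3 15 = mate by rewrite -h15 -[RHS]/(narr s1 15) -(same_narr sm2).
apply: (@wp_for_bounded F _ _ _ (fun i s4 => [/\ symm (memory_mx n s4),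
   quasi_diagonal (memory_mx n s4) mate,
   (diagonalizable -> splittable (memory_mx n s4) d) &
   forall k l : 'I_n, (k < i)%N -> k != l -> memory_mx n s4 k l = 0])
  80 _ _ (14 * n + 13 + m')%N _ n) => //.
- have -> : memory_mx n s3 = S by [].
  by split=> // hM; apply: (splittable_start sS qS cg d0 hd hM).
- move=> i s4 sm lti h3 [sS4 qS4 sp4 dg4]; pose k := Ordinal lti.
  have es4 := env_same sm isT es3.
  have h3' : nvar s4 3 = k by [].
  have h04 : nvar s4 0 = n by rewrite (same_nvar sm).
  have h154 : narr s4 15 = mate by rewrite (same_narr sm).
  have ed4 : fvar s4 3 = d by rewrite (same_fvar sm).
  apply: (@wp_run _ _ _ _ _ 0%N) => //.
  set c1 := NSet 7 _; set c2 := Seq (put_entry 3 3 _) _; set b := BAnd _ _.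
  have -> : run (Seq c1 (If b c2 Skip)) s4 =
     if beval (run c1 s4) b then run c2 (run c1 s4) else run c1 s4 by [].
  have -> : run c1 s4 = set_nvar s4 7 (mate k - 1) by rewrite /c1 /= h154 h3.
  set s5 := set_nvar s4 7 _.
  have es5 : envs s5 by apply: env_set_nvar.
  have mem5 : memory_mx n s5 = memory_mx n s4 by [].
  have eb (r : 'I_n) : r = (mate k - 1)%N :> nat -> beval s5 b =
      (memory_mx n s4 k k == 0) && (memory_mx n s4 k r != 0).
    move=> er; have h7 : nvar s5 7 = r by rewrite er.
    have h33 : nvar s5 3 = k by [].
    have e0 : beval s5 b = (nvar s5 7 < nvar s5 0)%N &&
      ((feval s5 (entry 3 3) == 0) && ~~ (feval s5 (entry 3 7) == 0)) by [].
    have h05 : nvar s5 0 = n by [].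
    by rewrite e0 (entryE es5 h33 h33) (entryE es5 h33 h7) mem5 h7 h05 ltn_ord.
  case: ifP => [hb|/negbT hb].
    have ltr : (mate k - 1 < n)%N.
      by have /andP[] : (mate k - 1 < nvar s4 0)%N && _ := hb; rewrite h04.
    pose r := Ordinal ltr; rewrite (eb r erefl) in hb; case/andP: hb => /eqP kk nz.
    have kr := split_neq kk nz.
    have mem6 : memory_mx n (set_nvar (run c2 s5) 3 i.+1) = hyper_split (memory_mx n s4) k r d.
      rewrite -mem5; apply: (@memory_hyper_split s5 k r d) => //.
    rewrite mem6; split.
    + exact: symm_hyper_split.
    + exact: quasi_hyper_split.
    + by move=> /sp4; apply: (splittable_hyper_split sS4 qS4 kk nz).
    + move=> k' l hk' kl; have [hin|] := boolP (k' \in [:: k; r]).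
        exact: (split_self d sS4 qS4).
      rewrite !inE negb_or => /andP[k1 k2]; rewrite split_other // dg4 //.
      by move: k1; rewrite -(inj_eq val_inj) /=; move: hk'; rewrite ltnS; lia.
  rewrite -[memory_mx _ _]/(memory_mx n s4); split=> // k' l hk' kl.
  (* When the test failed at k, its row has no entry off the diagonal: such an entry would be at the
     recorded partner and come with a zero diagonal entry, so the test would have succeeded. *)
  have [e|ne] := eqVneq k' k; last first.
    apply: dg4 => //; move: ne; rewrite -(inj_eq val_inj) /=; move: hk'; rewrite ltnS; lia.
  rewrite e in kl *; apply/eqP/negPn/negP => nz.
  have lk : l != k by rewrite eq_sym.
  have [e1 e2] := qS4 _ _ lk nz.
  by rewrite (eb l) ?e2 ?eqxx ?nz // e1 subn1 in hb.
- by lia.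
move=> s4 sm4 [sS4 qS4 sp4 dg4].
have es4 := env_same sm4 isT es3.
have h04 : nvar s4 0 = n by rewrite (same_nvar sm4).
apply: wp_seq.
apply: (@wp_run _ _ _ _ _ (14 * n + 11 + m')%N) => //; first by rewrite /=; lia.
have -> : run (NSet 3 (NConst 0)) s4 = set_nvar s4 3 0 by [].
set s5 := set_nvar _ _ _.
have es5 : envs s5 by apply: env_set_nvar.
apply: (@wp_for_bounded F _ _ _ (fun i s6 => memory_mx n s6 = memory_mx n s4 /\
   forall k : 'I_n, (k < i)%N -> farr s6 1 k = memory_mx n s4 k k)
  7 _ _ m' _ n) => //.
- move=> i s6 sm lti h3 [mem6 o6]; pose k := Ordinal lti.
  have es6 := env_same sm isT es5.
  have h3' : nvar s6 3 = k by [].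
  apply: (@wp_run _ _ _ _ _ 0%N) => //.
  have -> : run (FPut 1 (NVar 3) (entry 3 3)) s6 = set_farr s6 1 i (memory_mx n s4 k k).
    by rewrite -mem6 -(entryE es6 h3' h3') -h3.
  split=> // k' hk'; rewrite /= /upd /=; case: eqP => [e|ne]; last by apply: o6; lia.
  by have -> : k' = k by apply: val_inj.
- by lia.
- move=> s6 sm6 [_ o6]; apply: hQ => hM; have [cg4 _ _] := sp4 hM.
  suff -> : diag_mx (output n s6) = memory_mx n s4 by [].
  apply/matrixP=> k l; rewrite [LHS]mxE [output _ _ _ _]mxE o6 //.
  case: (eqVneq k l) => [->|kl]; first by rewrite mulr1n.
  by rewrite mulr0n dg4.
Qed.

End Finish.

(** * The bottom-up order of the tree *)

Section Tree.

Variables (T : finType) (e : rel T).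
Hypotheses (e_sym : symmetric e) (e_irr : irreflexive e).
Hypothesis e_acyclic : forall c, ucycle e c -> (size c <= 2)%N.
Local Open Scope nat_scope.
Implicit Types (x y z : T) (A : {set T}).

(* Otherwise a longest path inside [A] closes up to a cycle. *)
Lemma exists_leaf A : A != set0 ->
  exists2 x, x \in A & #|[set y in A | e x y]| <= 1.
Proof.
move=> /set0Pn[a aA].
pose P k := [exists x in A, exists p : k.-tuple T,
  [&& path e x p, uniq (x :: p) & all (mem A) p]].
have P0 : P 0.
  by apply/existsP; exists a; rewrite aA; apply/existsP; exists [tuple].
have Pb k : P k -> k <= #|T|.
  case/existsP=> x /andP[_ /existsP[p /and3P[_ u _]]].
  by have := max_card (mem (x :: p)); rewrite (card_uniqP u) /= size_tuple; apply: ltnW.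
have exP : exists k, P k by exists 0.
have [k /existsP[x /andP[xA /existsP[p /and3P[pth un inA]]]] kmax] := ex_maxnP exP Pb.
exists x => //; rewrite leqNgt; apply/negP => /card_gt1P[y1 [y2 [h1 h2 ne]]].
(* Of two neighbours of the end point x, one is not the next vertex of the longest path. Off the
   path it would extend the path; on the path it closes a cycle of length at least 3. *)
have [z zA zh] : exists2 z, z \in [set y in A | e x y] & z != head x p.
  by case: (eqVneq y1 (head x p)) => [e1|]; [exists y2; rewrite // -e1 eq_sym | exists y1].
move: zA; rewrite inE => /andP[zA exz].
have zx : z != x by apply: contraTneq exz => ->; rewrite e_irr.
have [zp|zp] := boolP (z \in (p : seq T)); last first.
  suff : P k.+1 by move/kmax; rewrite ltnn.
  apply/existsP; exists z; rewrite zA; apply/existsP; exists [tuple of x :: p].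
  by rewrite /= e_sym exz pth xA inA inE negb_or zx zp /= andbT -[_ && _]/(uniq (x :: p)).
case/splitPr def_p: {1}(p : seq T) / zp => [p1 p2].
have p1n : 0 < size p1 by case: p1 def_p => [|//] dp; move: zh; rewrite dp /= eqxx.
suff /e_acyclic : ucycle e (x :: rcons p1 z) 
  by rewrite /= size_rcons !ltnS leqNgt p1n.
rewrite /ucycle /= rcons_path last_rcons e_sym exz andbT.
move: pth un; rewrite def_p -cat_rcons cat_path -cat_cons cat_uniq => /andP[-> _] /andP[].
by move=> /= -> _.
Qed.

(** Removing a leaf loses one edge at most, which is two ordered pairs. The bound makes the pass
    over the edge list linear in the number of nodes. *)
Lemma card_edges A : #|[set p : T * T | [&& p.1 \in A, p.2 \in A & e p.1 p.2]]| <= #|A|.*2.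
Proof.
elim: {A}_.+1 {-2}A (ltnSn #|A|) => // N IH A hN.
have [->|nA] := eqVneq A set0.
  by rewrite (_ : [set _ | _] = set0) ?cards0 //; apply/setP => p; rewrite !inE.
have [x xA hx] := exists_leaf nA.
have hA : #|A| = (#|A :\ x|).+1 by rewrite (cardsD1 x A) xA.
have {IH} := IH (A :\ x); rewrite -ltnS -hA => /(_ hN) h.
set N1 := [set y in A | e x y] in hx.
apply: leq_trans (_ : #|[set p : T * T | [&& p.1 \in A :\ x, p.2 \in A :\ x & e p.1 p.2]]
   :|: ([set (x, y) | y in N1] :|: [set (y, x) | y in N1])| <= _).
  apply: subset_leq_card; apply/subsetP => -[a b]; rewrite !inE /= => /and3P[aA bA eab].
  rewrite aA bA eab !andbT; have [ax|ax] /= := eqVneq a x.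
    apply/orP; left; apply/imsetP; exists b; rewrite ?ax // inE bA -ax; exact: eab.
  have [bx|bx] /= := eqVneq b x; last by [].
  apply/orP; right; apply/imsetP; exists a; rewrite ?bx // inE aA e_sym -bx; exact: eab.
apply: leq_trans (leq_card_setU _ _) _; rewrite hA doubleS -addn2 leq_add //.
apply: leq_trans (leq_card_setU _ _) _; rewrite -[2]/(1 + 1).
by rewrite leq_add // (leq_trans (leq_imset_card _ _)).
Qed.

(** If the walk first goes down to x1, then x is the parent of x1 and, by induction, the rest of the
    walk returns to x; cutting off this detour leaves a shorter walk from x. *)
Lemma walk_parent (pos : T -> nat) (par : T -> option T) : injective pos ->
  (forall x z, e x z -> pos x < pos z -> par x = Some z) ->
  forall p x, path e x p -> pos x < pos (last x p) ->
  exists2 z, par x = Some z & z \in p.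
Proof.
move=> pos_inj hpar p; elim: {p}_.+1 {-2}p (ltnSn (size p)) => // N IH [|x1 p] hN x.
  by rewrite ltnn.
rewrite /= in hN *; case/andP=> exx1 pth hlt.
have [h|h] := ltnP (pos x) (pos x1).
  by exists x1; rewrite ?mem_head //; apply: hpar.
have {}h : pos x1 < pos x.
  rewrite ltn_neqAle h andbT; apply: contraTneq exx1 => /pos_inj ->.
  by rewrite e_irr.
have [||z' hz' z'p] := IH p _ x1 pth; rewrite ?(ltn_trans h) //.
have : par x1 = Some x by apply: hpar; rewrite // e_sym.
rewrite hz' => -[ez]; rewrite {}ez in z'p.
case/splitPr def_p: {1}p / z'p => [p1 p2].
move: pth hlt hN; rewrite def_p cat_path last_cat size_cat /= => /and3P[_ _ pth] hlt hN.
have hsz : size p2 < N.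
  by rewrite ltnS in hN; apply: leq_trans (leq_addl (size p1) _) (ltnW hN).
have [z hz zp] := IH p2 hsz x pth hlt.
by exists z; rewrite // inE mem_cat inE zp !orbT.
Qed.

End Tree.

(** The programs cannot multiply integers, so the multiples of n that address two-dimensional tables
    are produced by repeated addition. *)
Definition offsets : cmd :=
  Seq (Seq (NSet 3 (NConst 0)) (NSet 4 (NAdd (NVar 0) (NVar 1))))
  (for_range 3 4
    (NPut 6 (NAdd (NVar 3) (NConst 1)) (NAdd (NGet 6 (NVar 3)) (NVar 0)))).

(* The edge arrays end with a pair (0, 0), which is not an edge. *)
Definition degrees : cmd :=
  Seq (NSet 3 (NConst 0))
  (While (BNot (BEq (NGet 4 (NVar 3)) (NGet 5 (NVar 3))))
    (Seq (Seq (NSet 11 (NGet 4 (NVar 3))) (NSet 12 (NGet 5 (NVar 3))))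
    (Seq (Seq (NPut 8 (NVar 11) (NAdd (NGet 8 (NVar 11)) (NConst 1)))
              (NPut 8 (NVar 12) (NAdd (NGet 8 (NVar 12)) (NConst 1))))
    (Seq (Seq (NPut 9 (NVar 11) (NAdd (NGet 9 (NVar 11)) (NVar 12)))
              (NPut 9 (NVar 12) (NAdd (NGet 9 (NVar 12)) (NVar 11))))
         (NSet 3 (NAdd (NVar 3) (NConst 1))))))).

(* The sum of the remaining neighbours of a leaf is its only neighbour. *)
Definition peel_leaf : cmd :=
  Seq (Seq (NPut 7 (NVar 5) (NVar 6)) (NSet 5 (NAdd (NVar 5) (NConst 1))))
  (Seq (Seq (NSet 7 (NGet 9 (NVar 6))) (NPut 10 (NVar 6) (NAdd (NVar 7) (NConst 1))))
  (Seq (Seq (NPut 8 (NVar 6) (NConst 0))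
            (NPut 8 (NVar 7) (NSub (NGet 8 (NVar 7)) (NConst 1))))
  (Seq (NPut 9 (NVar 7) (NSub (NGet 9 (NVar 7)) (NVar 6))) (NSet 6 (NVar 7))))).

(** Removing a leaf can create a new leaf only at its neighbour, so peeling continues there at once
    and a single scan of the nodes suffices, as in the linear-time computation of a Pruefer code. *)
Definition peel_leaves : cmd :=
  Seq (Seq (NSet 3 (NConst 0)) (NSet 5 (NConst 0)))
  (for_range 3 1
    (Seq (NSet 6 (NVar 3))
         (While (BEq (NGet 8 (NVar 6)) (NConst 1)) peel_leaf))).

Definition append_roots : cmd :=
  Seq (NSet 3 (NConst 0))
  (for_range 3 1
    (If (BEq (NGet 10 (NVar 3)) (NConst 0))
      (Seq (NPut 7 (NVar 5) (NVar 3)) (NSet 5 (NAdd (NVar 5) (NConst 1))))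
      Skip)).

Section Offsets.

Local Open Scope nat_scope.

Lemma wp_offsets (F : fieldType) n t (s : state F) : nvar s 0 = n -> nvar s 1 = t -> narr s 6 0 = 0 ->
  wp offsets (fun _ s' => forall i, i <= n + t -> narr s' 6 i = i * n)
    (15 * (n + t) + 20) s.
Proof.
move=> h0 h1 h6; apply: wp_seq.
apply: (@wp_run _ _ _ _ _ (15 * (n + t) + 10)) => //; first by rewrite /=; lia.
set s1 := run _ s.
apply: (@wp_for_bounded F _ _ _ (fun i s2 => forall j, j <= i -> narr s2 6 j = j * n)
  8 _ _ 0 _ (n + t)) => //.
- by rewrite /= /upd /= h0 h1.
- by move=> j; rewrite leqn0 => /eqP ->.
- move=> i s2 sm lti h3 hI; apply: (@wp_run _ _ _ _ _ 0) => // j hj.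
  have h02 : nvar s2 0 = n by rewrite (same_nvar sm).
  rewrite /= /upd /= h3 h02 addn1; case: eqP => [->|ne]; last by apply: hI; lia.
  by rewrite hI // mulSn addnC.
- by lia.
Qed.

End Offsets.

Section Order.

Variables (F : fieldType) (t : nat) (e : rel 'I_t).
Hypotheses (e_sym : symmetric e) (e_irr : irreflexive e).
Hypothesis e_acyclic : forall c, ucycle e c -> (size c <= 2)%N.
Local Open Scope nat_scope.
Implicit Types (s : state F) (x y z v : 'I_t) (l : seq 'I_t).

Section Edges.

Variable es : seq ('I_t * 'I_t).
Hypothesis es_edges : perm_eq (es ++ [seq (p.2, p.1) | p <- es])
  (enum [pred p : 'I_t * 'I_t | e p.1 p.2]).

Lemma edge_es p : p \in es -> e p.1 p.2.
Proof.
move=> hp; have : p \in es ++ [seq (p.2, p.1) | p <- es] by rewrite mem_cat hp.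
by rewrite (perm_mem es_edges) mem_enum.
Qed.

Lemma size_es : size es <= t.
Proof.
have := perm_size es_edges; rewrite size_cat size_map -cardE => h.
have := card_edges e_sym e_irr e_acyclic [set: 'I_t].
rewrite cardsT card_ord (_ : #|[set p : 'I_t * 'I_t | _]| = size es + size es).
  by rewrite -addnn; lia.
by rewrite h; apply: eq_card => p; rewrite !inE.
Qed.

(** The constant 1 for g gives degrees, the identity gives sums of neighbours, so that one
    computation covers both arrays. *)
Definition edge_sum (g : 'I_t -> nat) (l0 : seq ('I_t * 'I_t)) x : nat :=
  \sum_(p <- l0) ((p.1 == x) * g p.2 + (p.2 == x) * g p.1).

Lemma edge_sum_rcons g (l0 : seq ('I_t * 'I_t)) p x : edge_sum g (rcons l0 p) x =
  edge_sum g l0 x + ((p.1 == x) * g p.2 + (p.2 == x) * g p.1).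
Proof. by rewrite /edge_sum -cats1 big_cat big_seq1. Qed.

Lemma edge_sumE g x : edge_sum g es x = \sum_(y | e x y) g y.
Proof.
transitivity (\sum_(p <- es ++ [seq (p.2, p.1) | p <- es]) (p.1 == x) * g p.2).
  by rewrite big_cat big_map /edge_sum big_split.
rewrite (perm_big _ es_edges) /= big_enum /= -(pair_big_dep xpredT e (fun a b => (a == x) * g b)) /=.
rewrite (bigD1 x) //= eqxx [X in _ + X]big1 ?addn0; last first.
  by move=> a ax; rewrite big1 // => b _; rewrite (negPf ax).
by apply: eq_bigr => y _; rewrite mul1n.
Qed.

Lemma wp_degrees s :
  narr s 4 = nth 0 [seq val p.1 | p <- es] -> narr s 5 = nth 0 [seq val p.2 | p <- es] ->
  narr s 8 =1 (fun=> 0) -> narr s 9 =1 (fun=> 0) ->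
  wp degrees (fun _ s' => forall x, narr s' 8 x = \sum_(y | e x y) 1 /\
                                    narr s' 9 x = \sum_(y | e x y) y)
    (40 * t + 20) s.
Proof.
move=> h4 h5 h8 h9; apply: wp_seq.
apply: (@wp_run _ _ _ _ _ (40 * t + 10)) => //; first by rewrite /=; lia.
set s1 := run _ s.
apply: (@wp_while _ _ _ (fun m s2 => exists i, [/\ i <= size es, nvar s2 3 = i,
  (forall x, narr s2 8 x = edge_sum (fun=> 1) (take i es) x /\
             narr s2 9 x = edge_sum (fun y => y) (take i es) x)
  & 40 * (size es - i) + 10 <= m])).
- exists 0; split=> //; last by have := size_es; lia.
  by move=> x; rewrite take0 /edge_sum !big_nil h8 h9.
- move=> m s2 sm [i [li h3 hI hm]].
  have h4' : narr s2 4 = nth 0 [seq val p.1 | p <- es] by rewrite (same_narr sm).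
  have h5' : narr s2 5 = nth 0 [seq val p.2 | p <- es] by rewrite (same_narr sm).
  rewrite /= h3 h4' h5'; have [lt|ge] := ltnP i (size es); last first.
    by rewrite !nth_default ?size_map // eqxx.
  move=> _; exists (m - 6); first by lia.
  apply: (@wp_run _ _ _ _ _ (m - 40)) => //; first by rewrite /=; lia.
  pose d := (Ordinal (leq_trans lt size_es), Ordinal (leq_trans lt size_es)).
  case Ep : (nth d es i) => [a b].
  have ea : nth 0 [seq val p.1 | p <- es] i = a by rewrite (nth_map d) // Ep.
  have eb : nth 0 [seq val p.2 | p <- es] i = b by rewrite (nth_map d) // Ep.
  exists i.+1; split=> //; last by lia.
    by rewrite /= /upd /= h3 addn1.
  move=> x; have [e8 e9] := hI x.
  rewrite (take_nth d) // Ep !edge_sum_rcons -e8 -e9 /= /upd /= h3 h4' h5' ea eb !muln1.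
  rewrite !(inj_eq val_inj) (eq_sym a) (eq_sym b).
  case: (eqVneq x b) => [exb|xb]; rewrite ?exb ?eqxx.
    by case: (eqVneq b a) => [eba|ba]; rewrite ?eba; split=> /=; lia.
  by case: (eqVneq x a) => [exa|xa]; rewrite ?exa; split=> /=; lia.
- move=> m s2 sm [i [li h3 hI hm]].
  have h4' : narr s2 4 = nth 0 [seq val p.1 | p <- es] by rewrite (same_narr sm).
  have h5' : narr s2 5 = nth 0 [seq val p.2 | p <- es] by rewrite (same_narr sm).
  rewrite /= h3 h4' h5' negbK; have [lt|ge] := ltnP i (size es); last first.
    move=> _; exists (m - 6); first by lia.
    by move=> x; have [-> ->] := hI x; rewrite take_oversize // !edge_sumE.
  pose d := (Ordinal (leq_trans lt size_es), Ordinal (leq_trans lt size_es)).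
  case Ep : (nth d es i) => [a b].
  have ea : nth 0 [seq val p.1 | p <- es] i = a by rewrite (nth_map d) // Ep.
  have eb : nth 0 [seq val p.2 | p <- es] i = b by rewrite (nth_map d) // Ep.
  have : e a b by rewrite -[a]/((a, b).1) -[X in e _ X]/((a, b).2) -Ep edge_es // mem_nth.
  by rewrite ea eb => eab /eqP/val_inj ab; rewrite ab e_irr in eab.
Qed.

End Edges.

Definition rest_sum (g : 'I_t -> nat) l x : nat := \sum_(y | e x y && (y \notin l)) g y.

(** For y not yet in l the index is the length of l, so the relation can be stated as soon as x is
    peeled, before its parent is. *)
Definition is_parent l x y : Prop :=
  index x l < index y l /\ forall z, e x z -> index z l < index x l \/ z = y.

Record peeling s l : Prop := Peeling {
  peel_uniq : uniq l;
  peel_list : forall i x, i < size l -> narr s 7 i = nth x l i;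
  peel_size : nvar s 5 = size l;
  peel_rest : forall x, x \notin l ->
    [/\ narr s 8 x = rest_sum (fun=> 1) l x, narr s 9 x = rest_sum (fun y => y) l x
      & narr s 10 x = 0];
  peel_done : forall x, x \in l -> narr s 8 x = 0;
  peel_parent : forall x, x \in l -> exists2 y : 'I_t, narr s 10 x = y.+1 & is_parent l x y }.

Lemma index_rcons_mem l v x : x \in l -> index x (rcons l v) = index x l.
Proof. by move=> h; rewrite -cats1 index_cat h. Qed.

Lemma index_rcons_notin l v x : x \notin l -> size l <= index x (rcons l v).
Proof. by move=> h; rewrite -cats1 index_cat (negPf h) leq_addr. Qed.

Lemma leq_index_rcons l v x : index x l <= index x (rcons l v).
Proof.
have [h|h] := boolP (x \in l); first by rewrite index_rcons_mem.
by apply: leq_trans (index_size _ _) (index_rcons_notin _ _).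
Qed.

Lemma is_parent_rcons l v x y : x \in l -> is_parent l x y -> is_parent (rcons l v) x y.
Proof.
move=> xl [h1 h2]; have xi : index x l < size l by rewrite index_mem.
split; first by rewrite index_rcons_mem //; apply: leq_trans h1 (leq_index_rcons _ _ _).
move=> z /h2 [h|]; last by right.
by left; rewrite !index_rcons_mem // -index_mem (ltn_trans h).
Qed.

Lemma is_parent_new l v y : v \notin l -> y \notin l -> y != v ->
  (forall z, e v z -> z \notin l -> z = y) -> is_parent (rcons l v) v y.
Proof.
move=> vl yl yv h; have iv : index v (rcons l v) = size l.
  by rewrite -cats1 index_cat (negPf vl) /= eqxx addn0.
split.
  by rewrite iv -cats1 index_cat (negPf yl) /= eq_sym (negPf yv) addn1.
move=> z evz; have [zl|zl] := boolP (z \in l); last by right; apply: h.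
by left; rewrite iv index_rcons_mem // index_mem.
Qed.

Lemma rest_sum_rcons g l v x : v \notin l ->
  rest_sum g l x = (if e x v then g v else 0) + rest_sum g (rcons l v) x.
Proof.
move=> vl; rewrite /rest_sum; case: ifP => exv.
  rewrite (bigD1 v) ?exv //=; congr (_ + _); apply: eq_bigl => y.
  by rewrite mem_rcons inE negb_or -andbA; case: (y == v); rewrite ?andbF ?andbT.
rewrite add0n; apply: eq_bigl => y; rewrite mem_rcons inE negb_or.
by case: (eqVneq y v) => [->|//]; rewrite exv.
Qed.

Lemma rest_one l v : rest_sum (fun=> 1) l v = 1 ->
  exists y, [/\ e v y, y \notin l, forall z, e v z -> z \notin l -> z = y
    & forall g, rest_sum g l v = g y].
Proof.
rewrite /rest_sum sum1_card => /eqP /card1P [y hy].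
have := hy y; rewrite !inE eqxx unfold_in /= => /andP[h1 h2].
exists y; split=> //.
  by move=> z h3 h4; have := hy z; rewrite !inE unfold_in /= h3 h4 => /esym/eqP.
move=> g; rewrite (big_pred1 y) // => z; have := hy z; by rewrite !inE unfold_in.
Qed.

Lemma peeling_step s l v : peeling s l -> nvar s 6 = v -> narr s 8 v = 1 ->
  exists y, [/\ peeling (run peel_leaf s) (rcons l v), nvar (run peel_leaf s) 6 = y,
    narr (run peel_leaf s) 8 v = 0, y != v &
    forall x, x != y -> x != v -> narr (run peel_leaf s) 8 x = narr s 8 x].
Proof.
move=> [p1 p2 p3 p4 p5 p6] h6 h8.
have vl : v \notin l by apply/negP => /p5; rewrite h8.
have [q1 q2 q3] := p4 _ vl.
have [y [evy yl hy hg]] := rest_one (etrans (esym q1) h8).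
have yv : y != v by apply: contraTneq evy => ->; rewrite e_irr.
have h9 : narr s 9 v = y by rewrite q2 hg.
have eyv : e y v by rewrite e_sym.
pose s' := run peel_leaf s; exists y.
have n5 : nvar s' 5 = (size l).+1 by rewrite /= /upd /= p3 addn1.
have n6 : nvar s' 6 = y by rewrite /= /upd /= h6 h9.
have n7 : narr s' 7 = upd (narr s 7) (size l) v by rewrite /= /upd /= h6 p3.
have n8 : narr s' 8 = upd (upd (narr s 8) v 0) y (narr s 8 y - 1).
  by rewrite /= /upd /= h6 h9 (inj_eq val_inj) (negPf yv).
have n9 : narr s' 9 = upd (narr s 9) y (narr s 9 y - v) by rewrite /= /upd /= h6 h9.
have n10 : narr s' 10 = upd (narr s 10) v y.+1 by rewrite /= /upd /= h6 h9 addn1.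
rewrite -/s' n8; split=> //.
- split.
  + by rewrite rcons_uniq vl.
  + move=> i x; rewrite size_rcons ltnS n7 /upd nth_rcons => hi.
    case: eqP => [->|ne]; first by rewrite ltnn ?eqxx.
    have lt : i < size l by lia.
    by rewrite lt (p2 _ x).
  + by rewrite size_rcons.
  + move=> x; rewrite mem_rcons inE negb_or => /andP[xv xl].
    have [r1 r2 r3] := p4 _ xl.
    rewrite n8 n9 n10 /upd !(inj_eq val_inj) (negPf xv).
    rewrite !(rest_sum_rcons _ _ vl) in r1 r2.
    case: (eqVneq x y) r1 r2 r3 => [-> r1 r2 r3|xy r1 r2 r3].
      rewrite eyv /= in r1 r2; by split; rewrite ?r1 ?r2 ?addKn.
    have nxv : e x v = false.
      by apply: contraNF xy => exv; apply/eqP/hy; rewrite // e_sym.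
    by rewrite nxv in r1 r2; split.
  + move=> x; rewrite mem_rcons inE n8 /upd !(inj_eq val_inj).
    case: (eqVneq x y) => [->|xy]; first by rewrite (negPf yv) (negPf yl).
    by case: (eqVneq x v) => //= xv; apply: p5.
  + move=> x; rewrite mem_rcons inE n10 /upd (inj_eq val_inj).
    case: (eqVneq x v) => [-> _|xv /= xl].
      by exists y => //; apply: is_parent_new.
    by have [y' e1 e2] := p6 _ xl; exists y' => //; apply: is_parent_rcons.
- by rewrite /upd !(inj_eq val_inj) eq_sym (negPf yv) eqxx.
- by move=> x xy xv; rewrite /upd !(inj_eq val_inj) (negPf xy) (negPf xv).
Qed.

Lemma size_uniq_ord l : uniq l -> size l <= t.
Proof. by move=> u; rewrite -(card_uniqP u) -[X in _ <= X]card_ord max_card. Qed.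

Lemma wp_peel_leaves s :
  nvar s 1 = t -> narr s 10 =1 (fun=> 0) ->
  (forall x, narr s 8 x = \sum_(y | e x y) 1 /\ narr s 9 x = \sum_(y | e x y) y) ->
  wp peel_leaves (fun _ s' => exists2 l, peeling s' l &
     forall x z, x \notin l -> e x z -> z \in l) (60 * t + 20) s.
Proof.
move=> h1 h10 h89; apply: wp_seq.
apply: (@wp_run _ _ _ _ _ (60 * t + 10)) => //; first by rewrite /=; lia.
set s1 := run _ s.
(* Scanning a node is charged 20, peeling one is charged 40, and no node is peeled twice. *)
apply: (@wp_for_range F _ _ _ (fun i m s2 => exists l,
  [/\ peeling s2 l, (forall j : 'I_t, j < i -> narr s2 8 j != 1) &
      20 * (t - i) + 40 * (t - size l) + 3 <= m]) _ _ _ 0 t) => //.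
- exists [::]; split=> //; last by rewrite /= !subn0; lia.
  split=> // x _; rewrite /rest_sum; have [e1 e2] := h89 x.
  split; [rewrite e1|rewrite e2|exact: h10];
    by apply: eq_bigl => y; rewrite andbT.
- move=> i m s2 sm /andP[_ lti] h3 [l [pl hd hm]]; pose v := Ordinal lti.
  have e1 : t - i = (t - i.+1).+1 by lia.
  exists (m - 7); first by lia.
  apply: wp_seq; apply: (@wp_run _ _ _ _ _ (m - 10)) => //; first by rewrite /=; lia.
  have -> : run (NSet 6 (NVar 3)) s2 = set_nvar s2 6 v by rewrite /= h3.
  set s3 := set_nvar _ _ _.
  (* Among the nodes scanned so far only the node in hand, v1, may be a leaf. *)
  apply: (@wp_while _ _ _ (fun m1 s4 => exists l1 (v1 : 'I_t), [/\ peeling s4 l1, nvar s4 6 = v1,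
    (forall j : 'I_t, j <= i -> j != v1 -> narr s4 8 j != 1) &
    20 * (t - i.+1) + 40 * (t - size l1) + 3 + 4 <= m1])).
  + exists l, v; split=> //; last by lia.
      by case: pl => *; split.
    move=> j hj jv; apply: hd; move: jv; rewrite -(inj_eq val_inj) /=; lia.
  + move=> m1 s4 _ [l1 [v1 [pl1 h6 hd1 hm1]]]; rewrite /= h6 => /eqP h8.
    have [y [pl2 h6' h8' yv hk]] := peeling_step pl1 h6 h8.
    have := size_uniq_ord (peel_uniq pl2); rewrite size_rcons => hs.
    exists (m1 - 4); first by lia.
    apply: (@wp_run _ _ _ _ _ (m1 - 40)) => //; first by rewrite /=; lia.
    exists (rcons l1 v1), y; split=> //; last by rewrite size_rcons; lia.
    move=> j hj jy; have [->|jv] := eqVneq j v1; first by rewrite h8'.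
    by rewrite hk // hd1.
  + move=> m1 s4 _ [l1 [v1 [pl1 h6 hd1 hm1]]]; rewrite /= h6 => h8.
    exists (m1 - 4); first by lia.
    exists l1; split; last by lia.
      by case: pl1 => *; split.
    move=> j; rewrite ltnS => hj; have [->|] := eqVneq j v1; last exact: hd1.
    exact: h8.
- move=> m s2 sm [l [pl hd hm]]; exists (m - 3); first by lia.
  exists l => // x z xl exz; apply/negPn/negP => zl.
  (* If an edge is left, the unpeeled nodes that have an unpeeled neighbour form a nonempty set,
     closed under unpeeled neighbours. A leaf of it has remaining degree 1, but the scan has left no
     such node. *)
  pose A := [set x | (x \notin l) && (rest_sum (fun=> 1) l x != 0)].
  have nbA a : a \in A -> rest_sum (fun=> 1) l a = #|[set y in A | e a y]|.
    rewrite inE => /andP[al _]; rewrite /rest_sum sum1_card; apply: eq_card => y.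
    rewrite [LHS]unfold_in !inE; case eay: (e a y) => /=; rewrite ?andbF ?andbT //.
    have [yl|yl] //= := boolP (y \in l); apply/esym.
    by rewrite /rest_sum (bigD1 a) //= e_sym eay al.
  have xA : x \in A by rewrite inE xl /rest_sum (bigD1 z) //= exz zl.
  have [|a aA] := exists_leaf e_sym e_irr e_acyclic (A := A).
    by apply/set0Pn; exists x.
  rewrite -nbA // => le1; move: aA; rewrite inE => /andP[al nz].
  have [e1 _ _] := peel_rest pl al; have := hd a (ltn_ord a).
  by rewrite e1; lia.
Qed.

Record node_order s l : Prop := NodeOrder {
  order_uniq : uniq l;
  order_full : forall x, x \in l;
  order_list : forall i x, i < t -> narr s 7 i = nth x l i;
  order_parent : forall x,
    (narr s 10 x = 0 /\ forall z, e x z -> index z l < index x l) \/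
    (exists2 y : 'I_t, narr s 10 x = y.+1 & is_parent l x y) }.

Lemma wp_append_roots s l0 : nvar s 1 = t -> peeling s l0 ->
  (forall x z, x \notin l0 -> e x z -> z \in l0) ->
  wp append_roots (fun _ s' => exists l, node_order s' l) (30 * t + 20) s.
Proof.
move=> h1 pl hr; apply: wp_seq.
apply: (@wp_run _ _ _ _ _ (30 * t + 10)) => //; first by rewrite /=; lia.
set s1 := run _ s; have [p1 p2 p3 p4 p5 p6] := pl.
have z10 x : (narr s 10 x == 0) = (x \notin l0).
  have [xl|xl] := boolP (x \in l0); first by have [y -> _] := p6 _ xl.
  by have [_ _ ->] := p4 _ xl.
apply: (@wp_for_bounded F _ _ _ (fun i s2 => exists l, [/\ uniq l,
  (forall j x, j < size l -> narr s2 7 j = nth x l j), nvar s2 5 = size l,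
  (forall x, (x \in l) = (x \in l0) || (x < i)) &
  (forall x, x \in l -> (x \notin l0 /\ forall z, e x z -> index z l < index x l) \/
     (exists2 y : 'I_t, narr s 10 x = y.+1 & is_parent l x y))])
  15 _ _ 0 _ t) => //.
- exists l0; split=> //; first by move=> x; rewrite orbF.
  by move=> x /p6; right.
- move=> i s2 sm lti h3 [l [u h7 h5 hl hp]]; pose v := Ordinal lti.
  have h10 : narr s2 10 = narr s 10 by rewrite (same_narr sm).
  apply: (@wp_run _ _ _ _ _ 0) => //.
  have -> : run (If (BEq (NGet 10 (NVar 3)) (NConst 0))
      (Seq (NPut 7 (NVar 5) (NVar 3)) (NSet 5 (NAdd (NVar 5) (NConst 1)))) Skip) s2
    = if v \notin l0 then set_nvar (set_narr s2 7 (size l) v) 5 (size l).+1 else s2.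
    by rewrite -z10 -h10 /= h3 h5 addn1.
  case: ifP => [vl0|/negbFE vl0]; last first.
    exists l; split=> // x; rewrite hl ltnS (leq_eqVlt x i).
    case: (eqVneq (x : nat) i) => [xi|//] /=.
    have -> : x = v by apply: val_inj.
    by rewrite vl0.
  have vl : v \notin l by rewrite hl (negPf vl0) /= ltnn.
  exists (rcons l v); split.
  + by rewrite rcons_uniq vl.
  + move=> j x; rewrite size_rcons ltnS => hj; rewrite nth_rcons /= /upd /=.
    case: eqP => [->|ne]; first by rewrite ltnn ?eqxx.
    have lt : j < size l by lia.
    by rewrite lt -h7.
  + by rewrite size_rcons.
  + move=> x; rewrite mem_rcons inE hl ltnS (leq_eqVlt x i) -(inj_eq val_inj) /=.
    by rewrite orbCA.
  + move=> x; rewrite mem_rcons inE => /orP[/eqP->|xl].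
      left; split=> // z evz; have zl0 := hr _ _ vl0 evz.
      have zl : z \in l by rewrite hl zl0.
      rewrite index_rcons_mem //; apply: leq_trans (index_rcons_notin v vl).
      by rewrite index_mem.
    case: (hp _ xl) => [[x0 h]|[y e1 e2]]; last first.
      by right; exists y => //; apply: is_parent_rcons.
    left; split=> // z exz; have zl : z \in l by rewrite hl (hr _ _ x0 exz).
    by rewrite !index_rcons_mem // h.
- by lia.
- move=> s2 sm [l [u h7 h5 hl hp]].
  have h10 : narr s2 10 = narr s 10 by rewrite (same_narr sm).
  have full x : x \in l by rewrite hl ltn_ord orbT.
  exists l; split=> //.
    have sl : size l = t.
      by rewrite -(card_uniqP u) -[RHS]card_ord; apply: eq_card => x; rewrite full.
    by move=> i x hi; apply: h7; rewrite sl.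
  move=> x; case: (hp _ (full x)) => [[x0 h]|h]; [left|right]; rewrite h10 //.
  by split=> //; apply/eqP; rewrite z10.
Qed.

End Order.

(** * Homes and ranks of the vertices, and the dense matrix *)

Definition discover : cmd :=
  Seq (Seq (NSet 3 (NVar 1)) (NSet 5 (NConst 0)))
  (While (BLt (NConst 0) (NVar 3))
    (Seq (Seq (NSet 3 (NSub (NVar 3) (NConst 1))) (NSet 4 (NGet 7 (NVar 3))))
    (for_bag 4 11 12 13
      (If (BEq (NGet 11 (NVar 13)) (NConst 0))
        (Seq (Seq (NPut 11 (NVar 13) (NAdd (NVar 4) (NConst 1)))
                  (NPut 12 (NVar 5) (NVar 13)))
             (Seq (NSet 5 (NAdd (NVar 5) (NConst 1)))
                  (NPut 13 (NVar 13) (NVar 5))))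
        Skip)))).

Definition load : cmd :=
  Seq (NSet 3 (NConst 0))
  (for_range 3 2
    (FPut 2 (NAdd (NGet 6 (NGet 0 (NVar 3))) (NGet 1 (NVar 3))) (FGet 0 (NVar 3)))).

Lemma nth_scanl_addn a (l : seq nat) k : (k <= size l)%N ->
  nth 0%N (a :: scanl addn a l) k = (a + sumn (take k l))%N.
Proof.
elim: l a k => [|b l IH] a [|k] //= hk; rewrite ?addn0 //.
by rewrite IH // addnA.
Qed.

Lemma nth_flatten_sumn (T : Type) (d : T) (ss : seq (seq T)) k i :
  (k < size ss)%N -> (i < size (nth [::] ss k))%N ->
  nth d (flatten ss) (sumn (take k (map size ss)) + i)%N = nth d (nth [::] ss k) i.
Proof.
elim: ss k => [|s ss IH] [|k] //= hk hi; rewrite nth_cat ?add0n ?hi //.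
by rewrite -addnA ltnNge leq_addr /= addKn IH.
Qed.

Section Discover.

Variables (F : fieldType) (n t : nat) (B : 'I_t -> {set 'I_n}).
Variables (bs : 'I_t -> seq 'I_n) (K : nat).
Hypothesis mem_bs : forall x, bs x =i B x.
Hypothesis size_bs : forall x, (size (bs x) <= K)%N.
Local Open Scope nat_scope.
Implicit Types (s : state F) (u v w : 'I_n) (x y z : 'I_t) (o : seq 'I_n).

(** P collects the vertices that the scan must have met by now: those of the finished bags, and
    within a bag also those of its visited prefix. *)
Record discovered s (l : seq 'I_t) (i : nat) o (P : pred 'I_n) : Prop := Discovered {
  disc_uniq : uniq o;
  disc_size : nvar s 5 = size o;
  disc_in : forall v, v \in o ->
    [/\ narr s 12 (index v o) = v, narr s 13 v = (index v o).+1 &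
    exists x, [/\ narr s 11 v = x.+1, v \in B x, i <= index x l &
      forall z, v \in B z -> index z l <= index x l]];
  disc_out : forall v, v \notin o ->
    [/\ narr s 11 v = 0, forall z, v \in B z -> index z l <= i & ~~ P v];
  disc_mono : forall v w x y, v \in o -> w \in o -> narr s 11 v = x.+1 ->
    narr s 11 w = y.+1 -> index v o < index w o -> index y l <= index x l }.

(** The nodes are scanned from the last to the first in bottom-up order, so the bag in which a
    vertex is first met is its topmost one. Numbering the vertices as they are met makes homes
    descend as ranks grow. *)
Lemma wp_discover s l : nvar s 1 = t -> bags_stored bs s -> narr s 11 =1 (fun=> 0) ->
  uniq l -> (forall x, x \in l) -> (forall i x, i < t -> narr s 7 i = nth x l i) ->
  wp discover (fun _ s' => exists o, discovered s' l 0 o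
     (fun v => [exists z, v \in B z])) ((40 * K + 60) * t + 20) s.
Proof.
move=> h1 hbag h11 ul fl h7; apply: wp_seq.
apply: (@wp_run _ _ _ _ _ ((40 * K + 60) * t + 10)) => //; first by rewrite /=; lia.
set s1 := run _ s.
have sl : size l = t.
  by rewrite -(card_uniqP ul) -[RHS]card_ord; apply: eq_card => x; rewrite fl.
apply: (@wp_while F _ _ (fun m s2 => exists i o, [/\ i <= t, nvar s2 3 = i,
   discovered s2 l i o (fun v => [exists z, (v \in B z) && (i <= index z l)])
   & (40 * K + 60) * i + 10 <= m])).
- exists t, [::]; split=> //.
  split=> // v _; split; first exact: h11.
    by move=> z _; apply: leq_trans (index_size _ _) _; rewrite sl.
  apply/existsPn => z; rewrite negb_and -ltnNge (_ : index z l < t) ?orbT //.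
  by have := index_mem z l; rewrite sl fl.
- move=> m s2 sm [i [o [lit h3 hd hm]]]; rewrite /= h3 => i0.
  exists (m - 3); first by lia.
  case: i i0 lit h3 hd hm => // i _ lit h3 hd hm.
  rewrite mulnS in hm; set X := (40 * K + 60) * i in hm.
  apply: wp_seq; apply: (@wp_run _ _ _ _ _ (m - 12)) => //; first by rewrite /=; lia.
  have x0 : 'I_t by exists i.
  pose x := nth x0 l i; have ix : index x l = i by rewrite index_uniq // sl.
  have n7 : narr s2 7 i = x.
    by rewrite (same_narr sm) // -(h7 i x0 lit).
  set c0 := Seq (NSet 3 _) _; have -> : run c0 s2 = set_nvar (set_nvar s2 3 i) 4 x.
    by rewrite /c0 /= /upd /= h3 subn1 /= n7.
  set s3 := set_nvar _ _ _.
  have bag3 : bags_stored bs s3.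
    have e2 : narr s3 2 = narr s 2 by apply: (same_narr sm (a := 2)).
    have e3 : narr s3 3 = narr s 3 by apply: (same_narr sm (a := 3)).
    by rewrite /bags_stored e2 e3.
  apply: (@wp_stored_bag _ _ _ bs K size_bs _ _ _ _ _ (fun l1 s4 => nvar s4 3 = i /\ exists o,
     discovered s4 l i o (fun v => [exists z, (v \in B z) && (i < index z l)] || (v \in l1)))
     22 _ _ (X + 10) _ x) => //.
  + move=> l1 s4 y v hy [h3' [o' [d1 d2 d3 d4 d5]]].
    split; first by move: hy; rewrite /= /upd !inE => /or3P[]/eqP->.
    exists o'; split=> //; by move: hy; rewrite /= /upd !inE => /or3P[]/eqP->.
  + split=> //; exists o; case: hd => d1 d2 d3 d4 d5; split=> //.
      move=> v /d3[e1 e2 [y [e3 e4 e5 e6]]]; split=> //; exists y; split=> //; exact: ltnW.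
    move=> v /d4[e1 e2 e3]; split=> //; last by rewrite orbF.
    move=> z vz; rewrite leqNgt; apply: contra e3 => h; apply/existsP; exists z.
    by rewrite vz.
  + move=> l1 v l2 s4 E sm4 h13 [h3' [o' hd']].
    have n4 : nvar s4 4 = x by rewrite (same_nvar sm4).
    have vx : v \in B x by rewrite -mem_bs E mem_cat mem_head orbT.
    have [d1 d2 d3 d4 d5] := hd'.
    apply: (@wp_run _ _ _ _ _ 0) => //.
    have n11 : (narr s4 11 v == 0) = (v \notin o').
      have [vo|vo] := boolP (v \in o'); first by have [_ _ [y [-> _ _ _]]] := d3 _ vo.
      by have [-> _ _] := d4 _ vo.
    set c1 := Seq _ _; have -> : run (If (BEq (NGet 11 (NVar 13)) (NConst 0)) c1 Skip) s4 =
      if v \notin o' then run c1 s4 else s4 by rewrite -n11 /= h13.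
    case: ifP => [vo|/negbFE vo]; last first.
      split=> //; exists o'; split=> // w wo; have [f1 f2 f3] := d4 _ wo; split=> //.
      rewrite mem_rcons inE orbCA negb_or f3 andbT.
      by apply: contraNneq wo => ->.
    have r11 : narr (run c1 s4) 11 = upd (narr s4 11) v x.+1.
      by rewrite /= /upd /= h13 n4 addn1.
    have r12 : narr (run c1 s4) 12 = upd (narr s4 12) (size o') v.
      by rewrite /= /upd /= h13 d2.
    have r13 : narr (run c1 s4) 13 = upd (narr s4 13) v (size o').+1.
      by rewrite /= /upd /= h13 d2 addn1.
    have r5 : nvar (run c1 s4) 5 = (size o').+1 by rewrite /= /upd /= d2 addn1.
    split=> //; exists (rcons o' v).
    have iv : index v (rcons o' v) = size o'.
      by rewrite -cats1 index_cat (negPf vo) /= eqxx addn0.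
    have im w : w \in o' -> index w (rcons o' v) = index w o'.
      by move=> wo; rewrite -cats1 index_cat wo.
    have nvw w : w \in o' -> w != v by apply: contraTneq => ->.
    split.
    * by rewrite rcons_uniq vo.
    * by rewrite size_rcons.
    * move=> w; rewrite mem_rcons inE r11 r12 r13; case: (eqVneq w v) => [-> _|wv /= wo].
        rewrite iv /upd !eqxx; split=> //; exists x; split; rewrite ?ix //.
        by have [] := d4 _ vo.
      have [f1 f2 [y [f3 f4 f5 f6]]] := d3 _ wo.
      rewrite im // /upd (inj_eq val_inj) (negPf wv); split=> //.
        by case: eqP => // ew; move: wo; rewrite -index_mem ew ltnn.
      by exists y.
    * move=> w; rewrite mem_rcons inE negb_or => /andP[wv wo]; have [f1 f2 f3] := d4 _ wo.
      rewrite r11 /upd (inj_eq val_inj) (negPf wv); split=> //.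
      by rewrite mem_rcons inE (negPf wv).
    * move=> w w' y y'; rewrite !mem_rcons !inE r11 /upd !(inj_eq val_inj).
      case: (eqVneq w v) => [->|wv] /=; case: (eqVneq w' v) => [->|wv'] /=.
      - by move=> _ _ _ _; rewrite ltnn.
      - by move=> _ wo' _ _; rewrite iv im // ltnNge index_size.
      - move=> wo _ e1 [/val_inj e2] _; rewrite -e2 ix.
        by have [_ _ [y1 [f3 _ f5 _]]] := d3 _ wo; move: f3; rewrite e1 => -[/val_inj ->].
      - by move=> wo wo' e1 e2; rewrite !im //; apply: d5.
  + by lia.
  + move=> s4 sm4 [h3' [o' [d1 d2 d3 d4 d5]]]; exists i, o'; split=> //; first exact: ltnW.
    split=> // v /d4[f1 f2 f3]; split=> //; move: f3; rewrite negb_or => /andP[f3 f4].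
    apply/existsPn => z; apply/negP => /andP[vz]; rewrite leq_eqVlt => /orP[/eqP iz|lt].
      have ez : z = x by rewrite -(nth_index x0 (fl z)) -iz.
      by rewrite mem_bs -ez vz in f4.
    by move/existsPn/(_ z): f3; rewrite vz lt.
- move=> m s2 sm [i [o [lit h3 hd hm]]]; rewrite /= h3 -eqn0Ngt => /eqP i0.
  exists (m - 3); first by lia.
  rewrite i0 in hd; exists o; case: hd => d1 d2 d3 d4 d5; split=> // v /d4[f1 f2 f3].
  split=> //; apply: contra f3 => /existsP[z vz]; apply/existsP; exists z.
  by rewrite vz.
Qed.

End Discover.

Section Load.

Variables (F : fieldType) (n t : nat) (M : 'M[F]_n) (nz : seq ('I_n * 'I_n)).
Hypothesis nzE : forall p, (p \in nz) = (M p.1 p.2 != 0).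
Implicit Types (s : state F).

Lemma wp_load s : nvar s 2 = size nz ->
  narr s 0 = nth 0%N [seq val p.1 | p <- nz] -> narr s 1 = nth 0%N [seq val p.2 | p <- nz] ->
  farr s 0 = nth 0 [seq M p.1 p.2 | p <- nz] -> farr s 2 =1 (fun=> 0) ->
  (forall i, (i <= n + t)%N -> narr s 6 i = (i * n)%N) ->
  wp load (fun _ s' => memory_mx n s' = M) (16 * size nz + 20)%N s.
Proof.
move=> h2 a0 a1 f0 f2 h6; apply: wp_seq.
apply: (@wp_run _ _ _ _ _ (16 * size nz + 10)%N) => //; first by rewrite /=; lia.
set s1 := run _ s.
apply: (@wp_for_bounded F _ _ _ (fun i s2 => memory_mx n s2 =
   \matrix_(a, b) if (a, b) \in take i nz then M a b else 0) 9 _ _ 0%N _ (size nz)) => //.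
- by apply/matrixP=> a b; rewrite !mxE f2 take0.
- move=> i s2 sm lti h3 hI; apply: (@wp_run _ _ _ _ _ 0%N) => //.
  have n0 : (0 < n)%N by case: (nz) lti => // -[a _] _ _; apply: leq_trans (ltn_ord a).
  pose d := (Ordinal n0, Ordinal n0); case Ep : (nth d nz i) => [a b].
  have b0 : narr s2 0 i = a by rewrite (same_narr sm) // [narr s1 0]a0 (nth_map d) // Ep.
  have b1 : narr s2 1 i = b by rewrite (same_narr sm) // [narr s1 1]a1 (nth_map d) // Ep.
  have g0 : farr s2 0 i = M a b by rewrite (same_farr sm) // [farr s1 0]f0 (nth_map d) // Ep.
  have o6 : narr s2 6 a = (a * n)%N.
    rewrite (same_narr sm) // -[RHS]h6 //; apply: ltnW.
    exact: leq_trans (ltn_ord a) (leq_addr _ _).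
  set c0 := FPut _ _ _; have -> : run c0 s2 = set_farr s2 2 (a * n + b)%N (M a b).
    by rewrite /c0 /= h3 b0 b1 g0 o6.
  rewrite (take_nth d) // Ep; apply/matrixP=> c c'.
  move/matrixP/(_ c c'): hI; rewrite !mxE /= /upd /= offset_inj => ->.
  rewrite mem_rcons inE xpair_eqE (inj_eq val_inj).
  by case: ifP => [/andP[/eqP -> /eqP ->]|].
- by lia.
- move=> s2 sm ->; apply/matrixP=> a b; rewrite mxE take_size nzE /=.
  by case: (eqVneq (M a b) 0) => [->|].
Qed.

End Load.

(** For [eo_par], a walk from x to the home of v through nodes whose bags contain v ends above x, so
    by [walk_parent] it visits the parent of x, whose bag therefore contains v. *)
Lemma tree_elim_order n t (g : rel 'I_n) (e : rel 'I_t) (B : 'I_t -> {set 'I_n})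
    (l : seq 'I_t) (o : seq 'I_n) par home :
  tree_decomposition g e B -> (forall x, x \in l) -> (forall v, v \in o) ->
  (forall x, if par x is Some y then is_parent e l x y
             else forall z, e x z -> (index z l < index x l)%N) ->
  (forall v, v \in B (home v) /\
     forall z, v \in B z -> (index z l <= index (home v) l)%N) ->
  (forall v w, (index v o < index w o)%N -> (index (home w) l <= index (home v) l)%N) ->
  elim_order B (fun x => index x l) par home (fun v => index v o).
Proof.
move=> td fl fo hpar hhome hmono.
have inj_l : injective (fun x => index x l).
  by move=> x y h; rewrite -(nth_index x (fl x)) h nth_index.
split=> //.
- by move=> v w h; rewrite -(nth_index v (fo v)) h nth_index.
- by move=> v; have [] := hhome v.
- by move=> v x; have [_] := hhome v; apply.
- move=> v x vx nx; have [vh hm] := hhome v.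
  have hlt : (index x l < index (home v) l)%N.
    by rewrite ltn_neqAle hm // andbT; apply: contra nx => /eqP/inj_l ->.
  have /connectP[p pth hlast] := td_connected td vx vh.
  set e' := [rel a b | _] in pth.
  have sym' : symmetric e'.
    by move=> a b; rewrite /e' /= (tree_sym (td_tree td) a b) (andbC (v \in B a)).
  have irr' : irreflexive e' by move=> a; rewrite /e' /= (tree_irrefl (td_tree td)).
  have hp a b : e' a b -> (index a l < index b l)%N -> par a = Some b.
    case/and3P=> eab _ _ lt; have := hpar a; case: (par a) => [y [_ h]|h].
      by case: (h _ eab) => [lt'|->] //; move: (ltn_trans lt lt'); rewrite ltnn.
    by move: (ltn_trans lt (h _ eab)); rewrite ltnn.
  rewrite hlast in hlt; have [z hz zp] := walk_parent sym' irr' inj_l hp pth hlt.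
  exists z => //; elim: p x pth {vx nx hlt hlast hz} zp => //= y p IH x /andP[] /and3P[_ _ vy] pth.
  by rewrite inE => /orP[/eqP->//|]; apply: IH pth.
- by move=> x y hx; have := hpar x; rewrite hx => -[].
Qed.

(** Of the two indices of a nonzero entry, the one with the lower home has the other in its home
    bag. So reading the entries takes O(kn) steps. *)
Lemma size_nonzero n t (F : fieldType) (M : 'M[F]_n) (e : rel 'I_t) B nz pos par home rank K :
  tree_decomposition (underlying_graph M) e B -> elim_order B pos par home rank ->
  (forall x, (#|B x| <= K)%N) -> uniq nz -> (forall p, (p \in nz) = (M p.1 p.2 != 0)) ->
  (size nz <= 2 * (n * K))%N.
Proof.
move=> td eo hK unz nzE; rewrite -(card_uniqP unz).
pose A := [set p : 'I_n * 'I_n | p.2 \in B (home p.1)].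
pose A' := [set p : 'I_n * 'I_n | p.1 \in B (home p.2)].
have cA : (#|A| <= n * K)%N.
  rewrite -sum1_card; apply: leq_trans (_ : \sum_(u : 'I_n) \sum_(w | w \in B (home u)) 1 <= _)%N.
    rewrite pair_big_dep /=; apply: eq_leq; apply: eq_bigl => p; by rewrite inE.
  rewrite -[X in (_ <= X * _)%N]card_ord -sum_nat_const; apply: leq_sum => u _.
  by rewrite sum1_card.
have cA' : (#|A'| <= n * K)%N.
  apply: leq_trans cA; rewrite -(card_imset (mem A') (f := fun p => (p.2, p.1))).
    apply: subset_leq_card; apply/subsetP => q /imsetP[p hp ->].
    by move: hp; rewrite !inE.
  by move=> [a b] [c d] [-> ->].
apply: leq_trans (_ : #|A :|: A'| <= _)%N.
  apply: subset_leq_card; apply/subsetP => -[u w]; rewrite nzE !inE /= => nzuw.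
  have [->|uw] := eqVneq u w; first by rewrite (eo_home eo).
  have [|z /andP[uz wz]] := td_edge td (v := u) (w := w).
    by rewrite /underlying_graph uw.
  have [h|h] := leqP (pos (home u)) (pos (home w)).
    by rewrite (later_in_bag eo uz wz h).
  by rewrite (later_in_bag eo wz uz (ltnW h)) orbT.
by apply: leq_trans (leq_card_setU _ _) _; rewrite mul2n -addnn leq_add.
Qed.

Lemma input_bags (F : fieldType) n t (M : 'M[F]_n) nz (bs : 'I_t -> seq 'I_n) es :
  bags_stored bs (input_state M nz bs es).
Proof.
pose bags := [seq bs x | x <- enum 'I_t].
have sb : size bags = t by rewrite size_map size_enum_ord.
have nb (x : 'I_t) : nth [::] bags x = bs x by rewrite (nth_map x) ?size_enum_ord // nth_ord_enum.
have st k : (k <= t)%N -> narr (input_state M nz bs es) 2 k = sumn (take k (map size bags)).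
  move=> hk; transitivity (nth 0%N (0%N :: scanl addn 0%N (map size bags)) k); first by [].
  by rewrite nth_scanl_addn ?add0n // size_map sb.
split=> [x|x i h].
  rewrite !st ?(ltnW (ltn_ord x)) // (take_nth 0%N); last by rewrite size_map sb.
  by rewrite sumn_rcons (nth_map [::]) ?nb // sb.
have sz : size (map (map val) bags) = t by rewrite size_map.
have sh : map size (map (map val) bags) = map size bags.
  by rewrite -map_comp; apply: eq_map => r /=; rewrite size_map.
rewrite st ?(ltnW (ltn_ord x)) // -[narr _ 3]/(nth 0%N (map val (flatten bags))).
have nx : nth [::] (map (map val) bags) x = map val (bs x).
  by rewrite (nth_map [::]) ?nb // sb.
rewrite map_flatten -sh nth_flatten_sumn ?sz // nx ?size_map //.
rewrite (tnth_nth (tnth (in_tuple (bs x)) (Ordinal h))) /= (nth_map (tnth (in_tuple (bs x)) (Ordinal h))) //.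
Qed.

(** * The complete program and its running time *)

Definition diagonalize : cmd :=
  Seq offsets (Seq degrees (Seq peel_leaves (Seq append_roots
  (Seq discover (Seq load (Seq main_loop finish)))))).

(** The summands are the budgets of the phases in order. As k is at least 1, k + 1 is at most 2k; as
    t is positive, kt absorbs the additive constants. The factor 3000 is a generous rounding. *)
Lemma total_cost k n t : (0 < k)%N -> (0 < t)%N ->
  (15 * (n + t) + 20 + (40 * t + 20 + (60 * t + 20 + (30 * t + 20 +
   ((40 * k.+1 + 60) * t + 20 + (16 * (2 * (n * k.+1)) + 20 +
   ((forget_cost k.+1 + 60) * n + (push_cost k.+1 + 60) * t + 100 +
    (200 * n + 50 + 0)))))))
  <= 3000 * (k * t + k ^ 2 * n))%N.
Proof.
rewrite /forget_cost /push_cost /row_cost -mulnn => k0 t0.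
have kt : (t <= k * t)%N by rewrite leq_pmull.
have kn : (n <= k * n)%N by rewrite leq_pmull.
have kkn : (k * n <= k * k * n)%N by rewrite -mulnA leq_pmull.
nia.
Qed.

(** Taking k at least 1 matters for width 0, where the bound would otherwise be 0 steps. The time
    bound is unconditional; correctness of the output assumes diagonalizability in characteristic 2,
    where it can fail. *)
Theorem theorem1 :
  exists (prog : cmd) (C : nat),
  forall (F : fieldType) (n t : nat) (M : 'M[F]_n)
    (e : rel 'I_t) (B : 'I_t -> {set 'I_n})
    (nz : seq ('I_n * 'I_n)) (bs : 'I_t -> seq 'I_n) (es : seq ('I_t * 'I_t)),
  M^T = M ->
  tree_decomposition (underlying_graph M) e B ->
  represents M e B nz bs es ->
  let k := maxn 1 (width B) in
  exists (steps : nat) (final : state F),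
    [/\ exec prog (input_state M nz bs es) steps final,
        (steps <= C * (k * t + k ^ 2 * n))%N &
        (2%N \notin [pchar F]) \/ (exists d : 'rV[F]_n, congruent M (diag_mx d)) ->
        congruent M (diag_mx (output n final))].
Proof.
exists diagonalize, 3000%N => F n t M e B nz bs es symM td [nz_perm bs_perm es_perm] k.
have sM : symm M by move=> i j; rewrite -{1}symM mxE.
have [e_sym e_irr t_gt0 _ e_acyclic] := td_tree td; rewrite card_ord in t_gt0.
pose K := k.+1.
have bs_uniq x : uniq (bs x) by rewrite (perm_uniq (bs_perm x)) enum_uniq.
have mem_bs x : bs x =i B x by move=> v; rewrite (perm_mem (bs_perm x)) mem_enum.
have card_B x : (#|B x| <= K)%N.
  have h : (#|B x|.-1 <= width B)%N by rewrite /width (leq_bigmax x).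
  by rewrite /K /k; lia.
have size_bs x : (size (bs x) <= K)%N by rewrite (perm_size (bs_perm x)) -cardE.
have nzE p : (p \in nz) = (M p.1 p.2 != 0) by rewrite (perm_mem nz_perm) mem_enum.
have nz_uniq : uniq nz by rewrite (perm_uniq nz_perm) enum_uniq.
set s0 := input_state M nz bs es.
have bags0 : bags_stored bs s0 by apply: input_bags.
pose cost := (3000 * (k * t + k ^ 2 * n))%N.
suff [steps [s [m [ex le hs]]]] : wp diagonalize (fun _ s =>
    diagonalizable M -> congruent M (diag_mx (output n s))) cost s0.
  by exists steps, s; split=> //; apply: leq_trans le; rewrite leq_addr.
(* Each of these constants is the budget left for a phase and all that follow it, so they are built
   from the end. *)
pose c7 := (200 * n + 50 + 0)%N.
pose c6 := ((forget_cost K + 60) * n + (push_cost K + 60) * t + 100 + c7)%N.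
pose c5 := (16 * (2 * (n * K)) + 20 + c6)%N.
pose c4 := ((40 * K + 60) * t + 20 + c5)%N.
pose c3 := (30 * t + 20 + c4)%N.
pose c2 := (60 * t + 20 + c3)%N.
pose c1 := (40 * t + 20 + c2)%N.
have cost_le : (15 * (n + t) + 20 + c1 <= cost)%N.
  by apply: total_cost; rewrite // leq_max.
have W1 := @wp_offsets F n t s0 erefl erefl erefl.
apply: wp_seq; apply: (wp_bounded W1 cost_le) => // s1 sm1 off.
apply: wp_seq; apply: (wp_bounded (wp_degrees e_sym e_irr e_acyclic es_perm _ _ _ _) (leqnn c1)).
all: try by rewrite (same_narr sm1).
all: try by move=> i; rewrite (same_narr sm1) //= ?nth_nil.
move=> s2 sm2 deg.
apply: wp_seq; apply: (wp_bounded (wp_peel_leaves e_sym e_irr e_acyclic _ _ deg) (leqnn c2)).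
- by rewrite (same_nvar sm2) // (same_nvar sm1).
- by move=> i; rewrite (same_narr sm2) // (same_narr sm1) //= nth_nil.
move=> s3 sm3 [l0 pl0 done0].
have s31 : nvar s3 1 = t by rewrite (same_nvar sm3) // (same_nvar sm2) // (same_nvar sm1).
apply: wp_seq; apply: (wp_bounded (wp_append_roots s31 pl0 done0) (leqnn c3)).
move=> s4 sm4 [l [ul fl list4 par4]].
have s41 : nvar s4 1 = t by rewrite (same_nvar sm4).
have arr4 a : a \in [:: 2; 3]%N -> narr s4 a = narr s0 a.
  by rewrite !inE => /orP[]/eqP->; rewrite (same_narr sm4) // (same_narr sm3) //
    (same_narr sm2) // (same_narr sm1).
have bags4 : bags_stored bs s4 by rewrite /bags_stored !arr4.
apply: wp_seq; apply: (wp_bounded (wp_discover mem_bs size_bs s41 bags4 _ ul fl list4) (leqnn c4)).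
  by move=> i; rewrite (same_narr sm4) // (same_narr sm3) // (same_narr sm2) //
    (same_narr sm1) //= nth_nil.
move=> s5 sm5 [o [uo size5 in5 out5 mono5]].
have fo v : v \in o.
  apply/negPn/negP => /out5[_ _] /negP; apply; apply/existsP.
  by have [x vx] := td_vertex td v; exists x.
have size_o : size o = n.
  by rewrite -(card_uniqP uo) -[RHS]card_ord; apply: eq_card => v; rewrite fo.
have /fin_all_exists[home home_spec] (v : 'I_n) : exists x : 'I_t,
    [/\ narr s5 11 v = x.+1, v \in B x &
     forall z, v \in B z -> (index z l <= index x l)%N].
  by have [_ _ [x [h1 h2 _ h3]]] := in5 v (fo v); exists x.
have /fin_all_exists[par par_spec] (x : 'I_t) : exists o : option 'I_t,
    narr s4 10 x = oapp (fun y : 'I_t => y.+1) 0%N o /\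
    if o is Some y then is_parent e l x y
    else forall z, e x z -> (index z l < index x l)%N.
  by case: (par4 x) => [[h1 h2]|[y h1 h2]]; [exists None | exists (Some y)].
pose pos (x : 'I_t) := index x l; pose rank (v : 'I_n) := index v o.
have eo : elim_order B pos par home rank.
  apply: (tree_elim_order td fl fo) => [x|v|v w lt].
  - by have [_] := par_spec x.
  - by have [_ h1 h2] := home_spec v.
  - have [h1 _ _] := home_spec v; have [h2 _ _] := home_spec w.
    exact: (mono5 _ _ _ _ (fo v) (fo w) h1 h2 lt).
have arr5 a : a \in [:: 0; 1; 2; 3]%N -> narr s5 a = narr s0 a.
  by rewrite !inE => /or4P[]/eqP->; rewrite (same_narr sm5) // (same_narr sm4) //
    (same_narr sm3) // (same_narr sm2) // (same_narr sm1).
have reg5 a : a \in [:: 0; 1; 2]%N -> nvar s5 a = nvar s0 a.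
  by rewrite !inE => /or3P[]/eqP->; rewrite (same_nvar sm5) // (same_nvar sm4) //
    (same_nvar sm3) // (same_nvar sm2) // (same_nvar sm1).
have off5 i : (i <= n + t)%N -> narr s5 6 i = (i * n)%N.
  by rewrite (same_narr sm5) // (same_narr sm4) // (same_narr sm3) // (same_narr sm2) //; apply: off.
have farr5 a : farr s5 a = farr s0 a.
  by rewrite (same_farr sm5) // (same_farr sm4) // (same_farr sm3) //
    (same_farr sm2) // (same_farr sm1).
have nz_le : (16 * size nz + 20 + c6 <= c5)%N.
  by rewrite !leq_add2r leq_mul2l (size_nonzero td eo card_B nz_uniq nzE).
apply: wp_seq; apply: (wp_bounded (wp_load nzE _ _ _ _ _ off5) nz_le).
- by rewrite reg5.
- by rewrite arr5.
- by rewrite arr5.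
- by rewrite farr5.
- by move=> i; rewrite farr5 /= nth_nil.
move=> s6 sm6 mem6.
have size_l : size l = t.
  by rewrite -(card_uniqP ul) -[RHS]card_ord; apply: eq_card => x; rewrite fl.
have pos_lt x : (pos x < t)%N by rewrite -[X in (_ < X)%N]size_l index_mem.
have rank_lt v : (rank v < n)%N by rewrite -[X in (_ < X)%N]size_o index_mem.
have node_at i : (i < t)%N -> exists x, pos x = i.
  move=> lti; exists (nth (Ordinal lti) l i); by rewrite /pos index_uniq // size_l.
have vertex_at i : (i < n)%N -> exists v, rank v = i.
  move=> lti; exists (nth (Ordinal lti) o i); by rewrite /rank index_uniq // size_o.
have env6 : env bs pos par home rank s6.
  split.
  - by rewrite (same_nvar sm6) // reg5.
  - by move=> x; rewrite (same_narr sm6) // arr5 //; case: bags0.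
  - by move=> x i h; rewrite !(same_narr sm6) // !arr5 //; case: bags0 => _; apply.
  - by move=> i; rewrite (same_narr sm6) //; apply: off5.
  - move=> x; rewrite (same_narr sm6) // (same_narr sm5) // (list4 _ x (pos_lt x)).
    by rewrite nth_index.
  - by move=> x; rewrite (same_narr sm6) // (same_narr sm5) //; have [] := par_spec x.
  - by move=> v; rewrite (same_narr sm6) //; have [] := home_spec v.
  - by move=> v; rewrite (same_narr sm6) //; have [] := in5 v (fo v).
  - by move=> v; rewrite (same_narr sm6) //; have [] := in5 v (fo v).
have W7 : wp main_loop (fun m s => m = c7 /\
    [/\ env bs pos par home rank s, congruent M (memory_mx n s), symm (memory_mx n s)
      & quasi_diagonal (memory_mx n s) (narr s 15)]) c6 s6.
  apply: (wp_main_loop (m' := c7) eo bs_uniq mem_bs size_bs pos_lt node_at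
    rank_lt vertex_at env6 _ mem6 sM) => //.
  - by rewrite (same_nvar sm6) // size5.
  - by move=> i; rewrite (same_narr sm6) // (same_narr sm5) // (same_narr sm4) //
      (same_narr sm3) // (same_narr sm2) // (same_narr sm1) //= nth_nil.
  - by move=> u w uw nzuw; apply: (td_edge td); rewrite /underlying_graph uw.
apply: wp_seq; apply: (wp_mono W7 (leqnn _)) => m s7 sm7 [-> [env7 cg7 sym7 quasi7]].
apply: (wp_finish (m' := 0) env7 _ sym7 cg7 erefl quasi7) => //.
by rewrite (same_nvar sm7) // (same_nvar sm6) // reg5.
Qed.
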